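(* Let $0<\alpha<2$ and $d\ge1$ an integer with $\alpha<d$. Put $\delta^*=(d-\alpha)/2$, $\kappa^*=2^\alpha\,\Gamma\big(\tfrac{d+\alpha}{4}\big)^2/\Gamma\big(\tfrac{d-\alpha}{4}\big)^2$ and $\mu^{\delta^*}(dx)=\kappa^*|x|^{-\alpha}dx$ on $\mathbb{R}^d$. Then: (a) The function $|x|^{-\delta^*}$ belongs to the extended Schrödinger space $\mathcal{D}_e(\mathcal{E}^{\mu^{\delta^*}})$ and $\mathcal{E}^{\mu^{\delta^*}}(|x|^{-\delta^*})=0$; that is, $|x|^{-\delta^*}$ is the ground state, and $(\mathcal{E}^{\mu^{\delta^*}},\mathcal{D}(\mathcal{E}^{\mu^{\delta^*}}))$ is critical. (b) Since $\int_{\mathbb{R}^d}|x|^{-2\delta^*}|x|^{-\alpha}dx=\int_{\mathbb{R}^d}|x|^{-d}dx=\infty$, the function $|x|^{-\delta^*}$ does not belong to the extended Dirichlet space $\mathcal{D}_e(\mathcal{E}^{(\alpha)})$, and thus $\mathcal{D}_e(\mathcal{E}^{(\alpha)})\subset\mathcal{D}_e(\mathcal{E}^{\mu^{\delta^*}})$ with strict inclusion. (c) The minimizer of $\lambda(\mu^{\delta^*})\,(=1)$ does not exist; in particular, $(\mathcal{D}_e(\mathcal{E}^{(\alpha)}),\mathcal{E}^{(\alpha)})$ is not compactly embedded in $L^2(\mathbb{R}^d;|x|^{-\alpha}dx)$.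
   Context: $(\mathcal{E}^{(\alpha)},\mathcal{D}(\mathcal{E}^{(\alpha)}))$ is the Dirichlet form of the symmetric $\alpha$-stable process on $L^2(\mathbb{R}^d)$: $$\mathcal{E}^{(\alpha)}(u)=\frac12\mathcal{A}(d,\alpha)\iint_{x\ne y}\frac{(u(x)-u(y))^2}{|x-y|^{d+\alpha}}\,dx\,dy,\qquad \mathcal{A}(d,\alpha)=\frac{\alpha2^{d-1}\Gamma(\frac{\alpha+d}{2})}{\pi^{d/2}\Gamma(1-\frac\alpha2)},$$ with $\mathcal{D}(\mathcal{E}^{(\alpha)})$ the set of $u\in L^2(\mathbb{R}^d)$ with finite double integral. $C_0(\mathbb{R}^d)$ denotes the continuous functions with compact support. The form $\mathcal{E}^{\mu^{\delta^*}}(u)=\mathcal{E}^{(\alpha)}(u)-\kappa^*\int_{\mathbb{R}^d}u^2|x|^{-\alpha}dx$ on $\mathcal{D}(\mathcal{E}^{(\alpha)})\cap C_0(\mathbb{R}^d)$ is positive semi-definite (Hardy's inequality, in which $\kappa^*$ is the best constant) and closable in $L^2(\mathbb{R}^d)$; $(\mathcal{E}^{\mu^{\delta^*}},\mathcal{D}(\mathcal{E}^{\mu^{\delta^*}}))$ is its closure. For such a positive semi-definite closed form $(a,\mathcal{D}(a))$ (here $a=\mathcal{E}^{(\alpha)}$ or $\mathcal{E}^{\mu^{\delta^*}}$), the extended space $\mathcal{D}_e(a)$ is the set of measurable $u$ with $|u|<\infty$ a.e. for which there is an $a$-Cauchy sequence $u_n\in\mathcal{D}(a)$ with $u_n\to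 u$ a.e., and $a(u)=\lim_na(u_n)$. It is called the extended Dirichlet space for $a=\mathcal{E}^{(\alpha)}$ and the extended Schrödinger space for $a=\mathcal{E}^{\mu^{\delta^*}}$. $(\mathcal{E}^{\mu^{\delta^*}},\mathcal{D}(\mathcal{E}^{\mu^{\delta^*}}))$ is critical if there is $\phi\in\mathcal{D}_e(\mathcal{E}^{\mu^{\delta^*}})$, $\phi>0$ a.e., with $\mathcal{E}^{\mu^{\delta^*}}(\phi)=0$; $\phi$ is then called the ground state. $$\lambda(\mu^{\delta^*})=\inf\Big\{\mathcal{E}^{(\alpha)}(u)\;\Big|\;u\in\mathcal{D}(\mathcal{E}^{(\alpha)})\cap C_0(\mathbb{R}^d),\ \int_{\mathbb{R}^d}u^2\,d\mu^{\delta^*}=1\Big\},$$ and a minimizer is a function $u\in\mathcal{D}_e(\mathcal{E}^{(\alpha)})$ with $\int u^2\,d\mu^{\delta^*}=1$ and $\mathcal{E}^{(\alpha)}(u)=\lambda(\mu^{\delta^*})$.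
   Formalization: The constant A(d,α) is taken with the factor 2^{α-1} instead of the printed 2^{d-1}; with the printed factor the form is multiplied by 2^{d-α}>1, so κ* is not the best Hardy constant, λ=2^{d-α}≠1, and (a), (b) and ''λ=1'' fail. *)

(* Defs.v *)
From HB Require Import structures.
From mathcomp Require Import all_boot all_order all_algebra.
From mathcomp Require Import all_classical all_reals all_analysis.
From mathcomp Require Import measurable_realfun.

Set Implicit Arguments.
Unset Strict Implicit.
Unset Printing Implicit Defensive.

Import Order.TTheory GRing.Theory Num.Theory.
Import numFieldNormedType.Exports.

Local Open Scope classical_set_scope.
Local Open Scope ring_scope.

(* R^d is ['rV[R]_d]: the library gives it the vector space structure and the
   usual topology.  We add the product Borel sigma-algebra (generated by the
   coordinates) and Lebesgue measure. *)

Definition rV_display : measure_display. Proof. exact. Qed.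

Section measurable_rV.
Context (R : realType) (d : nat).

Definition rV_coord (i : 'I_d) (x : 'rV[R]_d) : R := x ord0 i.

Let rV_set0 : g_sigma_preimage rV_coord set0.
Proof. exact: sigma_algebra0. Qed.

Let rV_setC A : g_sigma_preimage rV_coord A -> g_sigma_preimage rV_coord (~` A).
Proof. exact: sigma_algebraC. Qed.

Let rV_bigcup (F : _^nat) : (forall i, g_sigma_preimage rV_coord (F i)) ->
  g_sigma_preimage rV_coord (\bigcup_i (F i)).
Proof. exact: sigma_algebra_bigcup. Qed.

HB.instance Definition _ := @isMeasurable.Build rV_display
  'rV[R]_d (g_sigma_preimage rV_coord) rV_set0 rV_setC rV_bigcup.

Lemma measurable_rV_coord (i : 'I_d) : measurable_fun setT (rV_coord i).
Proof.
move=> _ Y mY; rewrite setTI; apply: sub_sigma_algebra => /=.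
rewrite -bigcup_seq/=; exists i => /=; first by rewrite mem_index_enum.
by exists Y => //; rewrite setTI.
Qed.

Lemma measurable_fun_rVP d1 (T1 : measurableType d1) (f : T1 -> 'rV[R]_d) :
  (forall i, measurable_fun setT (fun t => f t ord0 i)) ->
  measurable_fun setT f.
Proof.
move=> mf.
have pre : g_sigma_preimage (fun i => rV_coord i \o f) `<=` measurable.
  apply: smallest_sub; first exact: sigma_algebra_measurable.
  rewrite -bigcup_seq => A [i _ [B mB <-]].
  exact: (mf i).
move: pre; rewrite g_sigma_preimage_comp => pre _ A mA.
by apply: pre; exists A.
Qed.

End measurable_rV.

(* The library's instance for [m1 \x m2] is shadowed by a later one that is
   restricted to probability measures. *)
Lemma sigma_finite_product d1 d2 (T1 : measurableType d1)
    (T2 : measurableType d2) (R : realType)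
    (m1 : {sigma_finite_measure set T1 -> \bar R})
    (m2 : {sigma_finite_measure set T2 -> \bar R}) :
  sigma_finite setT (m1 \x m2)%E.
Proof.
have /sigma_finiteP[F [TF ndF Foo]] := sigma_finiteT m1.
have /sigma_finiteP[G [TG ndG Goo]] := sigma_finiteT m2.
exists (fun n => F n `*` G n).
  rewrite -setXTT TF TG predeqE => -[x y]; split.
    move=> [/= [n _ Fnx] [k _ Gky]]; exists (maxn n k) => //; split.
    - by move: x Fnx; exact/subsetPset/ndF/leq_maxl.
    - by move: y Gky; exact/subsetPset/ndG/leq_maxr.
  by move=> [n _ []/= ? ?]; split; exists n.
move=> k; have [? ?] := Foo k; have [? ?] := Goo k.
split; first exact: measurableX.
by rewrite product_measure1E// lte_mul_pinfty// ge0_fin_numE.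
Qed.

Lemma sigma_finite_pushforward_product d1 d2 d3 (T1 : measurableType d1)
    (T2 : measurableType d2) (T3 : measurableType d3) (R : realType)
    (m1 : {sigma_finite_measure set T1 -> \bar R})
    (m2 : {sigma_finite_measure set T2 -> \bar R})
    (f : T1 * T2 -> T3) (g : T3 -> T1 * T2) :
    cancel f g -> measurable_fun setT f -> measurable_fun setT g ->
  exists m : {sigma_finite_measure set T3 -> \bar R},
    pushforward (m1 \x m2)%E f = m :> (set T3 -> \bar R).
Proof.
move=> fK mf mg.
pose nu := measure_function_pushforward__canonical__measure_function_Measure
  (m1 \x m2)%E mf.
have sf : sigma_finite setT nu.
  have [F F_T F_oo] := sigma_finite_product m1 m2.
  exists (fun n => g @^-1` F n).
    apply/seteqP; split => // x _.
    by have : setT (g x) by []; rewrite F_T => -[n _ Fn]; exists n.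
  move=> n; have [mF Foo] := F_oo n; split.
    by rewrite -[X in measurable X]setTI; exact: mg.
  rewrite /nu /= /pushforward.
  rewrite (_ : f @^-1` _ = F n) //.
  by apply/seteqP; split => y /=; rewrite fK.
pose H := Measure_isSigmaFinite.Build _ _ _ nu sf.
pose nu' : {sigma_finite_measure set T3 -> \bar R} := HB.pack (nu : _ -> _) nu H.
by exists nu'.
Qed.

Section lebesgue_rV.
Context (R : realType).
Local Open Scope ereal_scope.

Definition rV_cons (d : nat) (tx : R * 'rV[R]_d) : 'rV[R]_d.+1 :=
  \row_i (if unlift ord0 i is Some j then tx.2 ord0 j else tx.1).

Definition rV_uncons (d : nat) (x : 'rV[R]_d.+1) : R * 'rV[R]_d :=
  (x ord0 ord0, \row_j x ord0 (lift ord0 j)).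

Lemma rV_consK d : cancel (@rV_cons d) (@rV_uncons d).
Proof.
move=> [t x]; rewrite /rV_uncons mxE unlift_none /=; congr pair.
by apply/rowP => j; rewrite !mxE liftK.
Qed.

Lemma rV_unconsK d : cancel (@rV_uncons d) (@rV_cons d).
Proof.
move=> x; apply/rowP => i; rewrite mxE.
by case: unliftP => [j ->|->] //=; rewrite mxE.
Qed.

Lemma measurable_rV_cons d : measurable_fun setT (@rV_cons d).
Proof.
apply: measurable_fun_rVP => i.
under eq_fun do rewrite mxE.
case: unliftP => [j _|_]; last exact: measurable_fst.
exact: measurableT_comp (measurable_rV_coord j) measurable_snd.
Qed.

Lemma measurable_rV_uncons d : measurable_fun setT (@rV_uncons d).
Proof.
apply/measurable_fun_pairP; split; first exact: (measurable_rV_coord ord0).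
apply: measurable_fun_rVP => i.
under eq_fun do rewrite mxE.
exact: measurable_rV_coord.
Qed.

Fixpoint lebesgue_rV (d : nat) : set 'rV[R]_d -> \bar R :=
  if d is d'.+1 then
    pushforward (@lebesgue_measure R \x @lebesgue_rV d') (@rV_cons d')
  else dirac (0%R : 'rV[R]_0).

Lemma lebesgue_rV_sigma_finite_measure d :
  exists m : sigma_finite_measure 'rV[R]_d R, @lebesgue_rV d = m.
Proof.
elim: d => [|d [m mE]] /=; first by exists (dirac (0%R : 'rV[R]_0)).
rewrite mE.
exact: (@sigma_finite_pushforward_product _ _ _ (measurableTypeR R) 'rV[R]_d
  'rV[R]_d.+1 R (@lebesgue_measure R) m (@rV_cons d) (@rV_uncons d)
  (@rV_consK d) (@measurable_rV_cons d) (@measurable_rV_uncons d)).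
Qed.

Let lebesgue_rV0 d : @lebesgue_rV d set0 = 0.
Proof. by have [m ->] := lebesgue_rV_sigma_finite_measure d. Qed.

Let lebesgue_rV_ge0 d A : 0 <= @lebesgue_rV d A.
Proof. by have [m ->] := lebesgue_rV_sigma_finite_measure d. Qed.

Let lebesgue_rV_sigma_additive d : semi_sigma_additive (@lebesgue_rV d).
Proof.
have [m ->] := lebesgue_rV_sigma_finite_measure d.
exact: measure_semi_sigma_additive.
Qed.

Let lebesgue_rV_sigma_finite d : sigma_finite setT (@lebesgue_rV d).
Proof.
by have [m ->] := lebesgue_rV_sigma_finite_measure d; exact: sigma_finiteT.
Qed.

HB.instance Definition _ d := isMeasure.Build _ 'rV[R]_d R (@lebesgue_rV d)
  (@lebesgue_rV0 d) (@lebesgue_rV_ge0 d) (@lebesgue_rV_sigma_additive d).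

HB.instance Definition _ d := Measure_isSigmaFinite.Build _ 'rV[R]_d R
  (@lebesgue_rV d) (@lebesgue_rV_sigma_finite d).

(* This property characterizes Lebesgue measure on R^d. *)
Lemma lebesgue_rV_box d (A : 'I_d -> set R) : (forall i, measurable (A i)) ->
  lebesgue_rV [set x | forall i, A i (x ord0 i)] =
  \prod_(i < d) lebesgue_measure (A i).
Proof.
elim: d A => [|d IHd] A mA /=.
  by rewrite big_ord0 diracE mem_set//= => -[].
rewrite big_ord_recl -IHd => [|i]; last exact: mA.
rewrite /pushforward.
rewrite [X in (_ \x _) X](_ : _ = A ord0 `*`
    [set x : 'rV[R]_d | forall i, A (lift ord0 i) (x ord0 i)]); last first.
  apply/seteqP; split => -[t x] /=.
    move=> h; split; first by have := h ord0; rewrite mxE unlift_none.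
    by move=> i; have := h (lift ord0 i); rewrite mxE liftK.
  move=> [At Ax] i; rewrite mxE; case: unliftP => [j ->|->] //.
rewrite (@product_measure1E _ _ (measurableTypeR R) 'rV[R]_d)//; first exact: mA.
rewrite (_ : mkset _ = \bigcap_(i in [set: 'I_d])
    (@rV_coord R d i @^-1` A (lift ord0 i))); last first.
  by apply/seteqP; split => x /= h i; [move=> _|]; exact: h.
apply: fin_bigcap_measurable => // i _.
by rewrite -[X in measurable X]setTI; exact: measurable_rV_coord.
Qed.

End lebesgue_rV.
Arguments lebesgue_rV {R d}.

Section euclidean_norm.
Context {R : realType}.

(* The library's norm on ['rV[R]_d] is the sup norm. *)
Definition enorm (d : nat) (x : 'rV[R]_d) : R :=
  Num.sqrt (\sum_(i < d) x ord0 i ^+ 2).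

Lemma measurable_enorm d : measurable_fun setT (@enorm d).
Proof.
apply: measurableT_comp; first exact: (continuous_measurable_fun (@sqrt_continuous R)).
apply: measurable_sum => i; apply: measurable_funX.
exact: (measurable_rV_coord i).
Qed.

End euclidean_norm.

Section density_measure.
Context d (T : measurableType d) (R : realType).
Variables (mu : {measure set T -> \bar R}) (f : T -> R).
Hypotheses (mf : measurable_fun setT f) (f0 : forall x, 0 <= f x).
Local Open Scope ereal_scope.

Definition density (A : set T) : \bar R := \int[mu]_(x in A) (f x)%:E.

Lemma density_set0 : density set0 = 0.
Proof. by rewrite /density integral_set0. Qed.

Lemma density_ge0 A : 0 <= density A.
Proof. by apply: integral_ge0 => x _; rewrite lee_fin. Qed.

Lemma density_sigma_additive : semi_sigma_additive density.
Proof.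
apply: semi_sigma_additive_nng_induced; last by move=> x; rewrite lee_fin.
exact/measurable_EFinP.
Qed.

End density_measure.

(* A symmetric form on a space of real functions, given by its domain and its
   diagonal u |-> a(u, u), which is only meaningful on the domain. *)
Record qform (T : Type) (R : realType) := QForm {
  qdom : set (T -> R) ;
  qval :> (T -> R) -> R }.

Section forms.
Context d (T : measurableType d) (R : realType).
Variable mu : {measure set T -> \bar R}.
Implicit Types a : qform T R.

Definition form_cauchy a (u_ : (T -> R)^nat) : Prop :=
  forall e : R, 0 < e ->
    \forall n & m \near \oo, `|a (fun x => u_ n x - u_ m x)| < e.

Definition closure_approx a (u_ : (T -> R)^nat) (u : T -> R) : Prop :=
  [/\ forall n, qdom a (u_ n), form_cauchy a u_ &
      Lnorm mu 2%:E (fun x => (u_ n x - u x)%:E) @[n --> \oo] --> 0%E].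

(* The smallest closed extension of a closable form.  Closability says exactly
   that the limit of a (u_ n) is independent of the approximating sequence. *)
Definition form_closure a : qform T R := {|
  qdom := [set u | [/\ measurable_fun setT u, finite_norm mu 2%:E u &
                       exists u_, closure_approx a u_ u]] ;
  qval := fun u => get [set l : R | exists u_,
                         closure_approx a u_ u /\ a (u_ n) @[n --> \oo] --> l] |}.

Definition ext_approx a (u_ : (T -> R)^nat) (u : T -> \bar R) : Prop :=
  [/\ forall n, qdom a (u_ n), form_cauchy a u_ &
      {ae mu, forall x, (u_ n x)%:E @[n --> \oo] --> u x}].

Definition ext_dom a : set (T -> \bar R) :=
  [set u | [/\ measurable_fun setT u, {ae mu, forall x, (`|u x| < +oo)%E} &
               exists u_, ext_approx a u_ u]].

Definition ext_val a (u : T -> \bar R) : R :=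
  get [set l : R | exists u_,
         ext_approx a u_ u /\ a (u_ n) @[n --> \oo] --> l].

Definition ground_state a (phi : T -> \bar R) : Prop :=
  [/\ ext_dom a phi, {ae mu, forall x, (0 < phi x)%E} & ext_val a phi = 0].

Definition critical a : Prop := exists phi, ground_state a phi.

Definition compactly_embedded a (nu : {measure set T -> \bar R}) : Prop :=
  (forall u, ext_dom a u -> (Lnorm nu 2%:E u < +oo)%E) /\
  (forall u_ : nat -> T -> \bar R,
    (forall n, ext_dom a (u_ n)) ->
    (exists C : R, forall n, ext_val a (u_ n) <= C) ->
    exists (k : nat -> nat) (v : T -> \bar R),
      [/\ {homo k : m n / (m < n)%N}, measurable_fun setT v,
          (Lnorm nu 2%:E v < +oo)%E &
          Lnorm nu 2%:E (fun x => u_ (k n) x - v x)%E @[n --> \oo] --> 0%E]).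

End forms.

Section hardy.
Context {R : realType}.

Definition Gamma (s : R) : R :=
  \int[lebesgue_measure]_(t in `]0, +oo[) (t `^ (s - 1) * expR (- t)).

(* With the factor 2^(alpha - 1), [stable_energy] is the form of the fractional
   Laplacian (- Delta)^(alpha / 2), i.e. of the symmetric alpha-stable process,
   and [kappa_star] is the best constant in Hardy's inequality for it.  The
   factor is sometimes printed 2^(d - 1), which is a misprint: it would multiply
   the best constant by 2^(d - alpha). *)
Definition stable_const (d : nat) (alpha : R) : R :=
  alpha * 2 `^ (alpha - 1) * Gamma ((alpha + d%:R) / 2) /
  (pi `^ (d%:R / 2) * Gamma (1 - alpha / 2)).

Definition delta_star (d : nat) (alpha : R) : R := (d%:R - alpha) / 2.

Definition kappa_star (d : nat) (alpha : R) : R :=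
  2 `^ alpha * Gamma ((d%:R + alpha) / 4) ^+ 2 / Gamma ((d%:R - alpha) / 4) ^+ 2.

Definition stable_energy (d : nat) (alpha : R) (u : 'rV[R]_d -> R) : \bar R :=
  ((stable_const d alpha / 2)%:E *
   \int[lebesgue_rV \x lebesgue_rV]_(z in [set z | z.1 != z.2])
     ((u z.1 - u z.2) ^+ 2 / enorm (z.1 - z.2) `^ (d%:R + alpha))%:E)%E.

Definition stable_form (d : nat) (alpha : R) : qform 'rV[R]_d R := {|
  qdom := [set u | [/\ measurable_fun setT u,
                       finite_norm (@lebesgue_rV R d) 2%:E u &
                       (stable_energy alpha u < +oo)%E]] ;
  qval := fun u => fine (stable_energy alpha u) |}.

Definition C0 (d : nat) : set ('rV[R]_d -> R) :=
  [set u | continuous u /\ compact (closure [set x | u x != 0])].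

Definition hardy_preform (d : nat) (alpha : R) : qform 'rV[R]_d R := {|
  qdom := qdom (stable_form d alpha) `&` @C0 d ;
  qval := fun u => stable_form d alpha u -
    kappa_star d alpha *
    \int[lebesgue_rV]_x (u x ^+ 2 * enorm x `^ (- alpha)) |}.

Definition hardy_form (d : nat) (alpha : R) : qform 'rV[R]_d R :=
  form_closure lebesgue_rV (hardy_preform d alpha).

Definition power_measure (d : nat) (alpha : R) : set 'rV[R]_d -> \bar R :=
  density lebesgue_rV (fun x => enorm x `^ (- alpha)).

Definition mu_star (d : nat) (alpha : R) : set 'rV[R]_d -> \bar R :=
  density lebesgue_rV (fun x => kappa_star d alpha * enorm x `^ (- alpha)).

Section instances.
Variables (d : nat) (alpha : R).

Let mpow : measurable_fun setT (fun x : 'rV[R]_d => enorm x `^ (- alpha)).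
Proof.
exact: measurableT_comp (measurable_powR (- alpha)) (@measurable_enorm R d).
Qed.

Let pow_ge0 (x : 'rV[R]_d) : 0 <= enorm x `^ (- alpha).
Proof. exact: powR_ge0. Qed.

HB.instance Definition _ := isMeasure.Build _ 'rV[R]_d R
  (power_measure alpha) (density_set0 _ _) (density_ge0 _ pow_ge0)
  (density_sigma_additive mpow pow_ge0).

Let mkpow : measurable_fun setT
  (fun x : 'rV[R]_d => kappa_star d alpha * enorm x `^ (- alpha)).
Proof. exact: measurable_funM. Qed.

Let kpow_ge0 (x : 'rV[R]_d) : 0 <= kappa_star d alpha * enorm x `^ (- alpha).
Proof.
by rewrite mulr_ge0// divr_ge0 ?sqr_ge0// mulr_ge0 ?sqr_ge0 ?powR_ge0.
Qed.

HB.instance Definition _ := isMeasure.Build _ 'rV[R]_d R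
  (mu_star alpha) (density_set0 _ _) (density_ge0 _ kpow_ge0)
  (density_sigma_additive mkpow kpow_ge0).

End instances.

Definition hardy_lambda (d : nat) (alpha : R) : \bar R :=
  ereal_inf [set stable_energy alpha u | u in
    [set u : 'rV[R]_d -> R | [/\ qdom (stable_form d alpha) u, @C0 d u &
      (\int[mu_star alpha]_x (u x ^+ 2)%:E)%E = 1%E]]].

Definition hardy_minimizer (d : nat) (alpha : R) (u : 'rV[R]_d -> \bar R) :=
  [/\ ext_dom lebesgue_rV (stable_form d alpha) u,
      (\int[mu_star alpha]_x (u x ^+ 2))%E = 1%E &
      (ext_val lebesgue_rV (stable_form d alpha) u)%:E = hardy_lambda d alpha].

(* The value at the origin, where [powR] is 0, is irrelevant. *)
Definition power_delta (d : nat) (alpha : R) : 'rV[R]_d -> \bar R :=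
  fun x => (enorm x `^ (- delta_star d alpha))%:E.

End hardy.

(* Main.v *)
Require Import Defs.
From HB Require Import structures.
From mathcomp Require Import all_boot all_order all_algebra.
From mathcomp Require Import all_classical all_reals all_analysis.
From mathcomp Require Import measurable_realfun.
From mathcomp Require Import ring lra.

(** Writing [|z| ^ (- 2q)] as a Gamma integral of Gaussians and using Tonelli's
    theorem, one obtains the ground state representation
    [E(u) = G(u) + kappa* int u^2 |x|^(- alpha)], where, with
    [phi = |x| ^ (- delta-star)] and the constant and kernel of [E],
    [G(u)] is the double integral of
    [(u/phi (x) - u/phi (y))^2 phi(x) phi(y) |x - y| ^ (- d - alpha)].
    Thus the Hardy form is [G >= 0] on its core, and [G(phi) = 0].  The
    functions [phi eta_n], with [eta_n] a cutoff to [1/n < |x| < n], have bounded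
    [G] and converge to [phi]; by Banach-Saks, convex combinations of them are
    [G]-Cauchy, so [phi] lies in the extended Schroedinger space.  Their Hardy
    masses tend to infinity.  Hence [lambda = 1], and the normalized functions
    are bounded in [E] and tend to [0] pointwise, which excludes compactness.
    A minimizer would satisfy [G(u) = 0], i.e. be a multiple of [phi], whose
    Hardy mass is infinite. *)

Set Implicit Arguments.
Unset Strict Implicit.
Unset Printing Implicit Defensive.

Import Order.TTheory GRing.Theory Num.Theory.
Import numFieldNormedType.Exports.

Local Open Scope classical_set_scope.
Local Open Scope ring_scope.

(** * Measurability, substitution and Tonelli's theorem *)

(** Formally the representation says that [phi] solves [(- Delta)^(alpha / 2) phi = kappa* |x|^(-
    alpha) phi], where the left-hand side is in general only a principal value. For one fixed
    Gaussian kernel the mass of [u ^ 2] is finite and cancels, and what remains of the potential of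
    [phi] is split into two nonnegative kernels; only then is the Gaussian scale integrated. Thus no
    signed integral ever occurs. The identity needs a finite Hardy mass, so Hardy's inequality is
    obtained for bounded truncations and extended by Fatou's lemma. Both forms are squared L2 norms
    of linear images of [u]; Fatou's lemma then shows that the limits defining closure and extended
    space do not depend on the sequence. The inclusion of the extended spaces rests on [D(E)] lying
    in the domain of the closure taken from C0 functions. Cutoffs and mollification give C0
    approximants that converge in L2 and merely have bounded energy; Banach-Saks turns them into
    Cauchy sequences, just as it does for [phi]. *)

Lemma measurable_fun_inv d (T : measurableType d) (R : realType) (D : set T)
    (f : T -> R) : measurable_fun D f -> measurable_fun D (fun x => (f x)^-1).
Proof.
move=> mf; rewrite (_ : (fun x => _) = fun x => f x * (f x ^+ 2) `^ (-1)).
  apply: measurable_funM => //; apply: measurableT_comp (measurable_powR _) _.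
  exact: measurable_funX.
apply/funext => x; rewrite powR_inv1 ?sqr_ge0// expr2 invfM mulrA.
by have [->|fx0] := eqVneq (f x) 0; rewrite ?invr0 ?mulr0// divff// mul1r.
Qed.

Lemma emeasurable_funM_EFin d (T : measurableType d) (R : realType) (D : set T)
    (f : T -> \bar R) (g : T -> R) :
  measurable_fun D f -> measurable_fun D g ->
  measurable_fun D (fun x => f x * (g x)%:E)%E.
Proof. by move=> mf mg; apply: emeasurable_funM => //; exact/measurable_EFinP. Qed.

Section measurable_rV_ops.
Context d (T : measurableType d) (R : realType) (n : nat).
Implicit Types f g : T -> 'rV[R]_n.

Lemma measurable_rV_comp_coord f i :
  measurable_fun setT f -> measurable_fun setT (fun t => f t ord0 i).
Proof. by move=> mf; exact: measurableT_comp (measurable_rV_coord i) mf. Qed.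

Lemma measurable_rVD f g : measurable_fun setT f -> measurable_fun setT g ->
  measurable_fun setT (fun t => f t + g t).
Proof.
move=> mf mg; apply: measurable_fun_rVP => i.
under eq_fun do rewrite mxE.
by apply: measurable_funD; exact: measurable_rV_comp_coord.
Qed.

Lemma measurable_rVN f : measurable_fun setT f -> measurable_fun setT (fun t => - f t).
Proof.
move=> mf; apply: measurable_fun_rVP => i.
under eq_fun do rewrite mxE.
by apply: measurableT_comp => //; exact: measurable_rV_comp_coord.
Qed.

Lemma measurable_rV_norm f : measurable_fun setT f -> measurable_fun setT (fun t => `|f t|).
Proof.
move=> mf; rewrite (_ : (fun t => _) = fun t =>
  \big[Num.max/0]_i `|f t i.1 i.2|); last first.
  by apply/funext => t; rewrite /Num.Def.normr/= mx_normrE.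
elim: (index_enum _) => [|i s IHs].
  by under eq_fun do rewrite big_nil; exact: measurable_cst.
under eq_fun do rewrite big_cons.
apply: measurable_maxr => //; apply: measurableT_comp => //.
by rewrite (ord1 i.1); exact: measurable_rV_comp_coord.
Qed.

End measurable_rV_ops.

(** [meas] recurses on the syntax of the function. The [constr_eq] guards restrict hypotheses to
    syntactic matches, so that unification cannot unfold one function into another. *)
Ltac meas_hyp :=
  match goal with
  | H : measurable_fun _ ?f |- measurable_fun _ ?g => constr_eq f g; exact: H
  | H : measurable_fun _ ?f |- measurable_fun _ (fun x => ?u (@?g x)) =>
      constr_eq f u; apply: measurableT_comp H _
  end.
Ltac meas1 :=
  lazymatch goal with
  | |- measurable_fun _ (fun x => (@?f x + @?g x)%R) =>
      first [apply: measurable_funD | apply: measurable_rVD | apply: emeasurable_funD]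
  | |- measurable_fun _ (fun x => (- @?f x)%R) =>
      first [apply: measurable_rVN | apply: measurableT_comp]
  | |- measurable_fun _ (fun x => enorm (@?f x)) =>
      apply: measurableT_comp (@measurable_enorm _ _) _
  | |- measurable_fun _ (fun x => `|@?f x|%R) =>
      first [apply: measurable_rV_norm | apply: measurableT_comp]
  | |- measurable_fun _ (fun x => fun_of_matrix (@?f x) ord0 _) =>
      apply: measurable_rV_comp_coord
  | |- measurable_fun _ (fun x => Num.max (@?f x) (@?g x)) => apply: measurable_maxr
  | |- measurable_fun _ (fun x => Num.min (@?f x) (@?g x)) => apply: measurable_minr
  | |- measurable_fun _ (fun x => (@?f x * @?g x)%R) => apply: measurable_funM
  | |- measurable_fun _ (fun x => ((@?f x)^-1)%R) => apply: measurable_fun_inv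
  | |- measurable_fun _ (fun x => (@?f x ^+ _)%R) => apply: measurable_funX
  | |- measurable_fun _ (fun x => (@?f x `^ ?p)%R) =>
      apply: measurableT_comp (measurable_powR p) _
  | |- measurable_fun _ (fun x => expR (@?f x)) =>
      apply: measurableT_comp (@measurable_expR _) _
  | |- measurable_fun _ (fun x => (@?f x * EFin (@?g x))%E) =>
      apply: emeasurable_funM_EFin
  | |- measurable_fun _ (fun x => (@?f x * @?g x)%E) => apply: emeasurable_funM
  | |- measurable_fun _ (fun x => EFin (@?f x)) =>
      apply/measurable_EFinP; rewrite /comp/=
  | |- measurable_fun _ (EFin \o _) => apply/measurable_EFinP
  | |- measurable_fun _ (fun x => fst x) => exact: measurable_fst
  | |- measurable_fun _ (fun x => snd x) => exact: measurable_snd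
  | |- measurable_fun _ (fun x => x) => exact: measurable_id
  | |- measurable_fun _ (fun x => fst (@?g x)) =>
      apply: measurableT_comp measurable_fst _
  | |- measurable_fun _ (fun x => snd (@?g x)) =>
      apply: measurableT_comp measurable_snd _
  | |- measurable_fun _ (fun x => \1_?A (@?g x)) =>
      apply: measurableT_comp (measurable_indic _) _
  | |- measurable_fun _ (fun x => (@?f x, @?g x)) =>
      apply/measurable_fun_pairP; split; rewrite /comp/=
  | |- measurable_fun _ (pair _) => apply/measurable_fun_pairP; split; rewrite /comp/=
  | |- measurable_fun _ (fun x => _) => exact: measurable_cst
  | |- measurable_fun _ (@enorm _ _) => exact: measurable_enorm
  | |- measurable_fun _ (-%R) => first [by [] | apply: measurable_rVN]
  | |- measurable_fun _ (@Num.Def.normr _ _) => first [by [] | apply: measurable_rV_norm]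
  | |- measurable_fun _ (@GRing.inv _) => apply: measurable_fun_inv
  | |- measurable_fun _ (\1_ _) => apply: measurable_indic
  | |- measurable_fun _ (@expR _) => apply: measurable_expR
  | |- measurable_fun ?D (@GRing.add _ ?a) =>
      apply: (@measurable_funD _ _ _ D (fun=> a) id)
  | |- measurable_fun ?D (@GRing.mul _ ?a) =>
      apply: (@measurable_funM _ _ _ D (fun=> a) id)
  | |- measurable_fun _ id => exact: measurable_id
  | |- measurable_fun _ fst => exact: measurable_fst
  | |- measurable_fun _ snd => exact: measurable_snd
  end.
Ltac meas := repeat first [meas_hyp | meas1]; try by [].

Ltac pos1 :=
  first
  [ match goal with
    | H : is_true (@Order.le _ _ _ ?x) |- is_true (@Order.le _ _ _ ?y) =>
        constr_eq x y; exact: H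
    | H : is_true (@Order.lt _ _ _ ?x) |- is_true (@Order.le _ _ _ ?y) =>
        constr_eq x y; exact: ltW H
    | H : forall x, is_true (@Order.le _ _ _ (?f x)) |- is_true (@Order.le _ _ _ (?g _)) =>
        constr_eq f g; exact: H
    end
  | lazymatch goal with
    | |- is_true (@Order.le _ _ _ (mule _ _)) => apply: mule_ge0
    | |- is_true (@Order.le _ _ _ (adde _ _)) => apply: adde_ge0
    | |- is_true (@Order.le _ _ _ (EFin _)) => rewrite lee_fin
    | |- is_true (@Order.le _ _ _ (integral _ _ _)) => apply: integral_ge0 => ? _
    | |- is_true (@Order.le _ _ _ (GRing.mul _ _)) => apply: mulr_ge0
    | |- is_true (@Order.le _ _ _ (Algebra.add _ _)) =>
        first [apply: addr_ge0 | apply: adde_ge0]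
    | |- is_true (@Order.le _ _ _ (GRing.inv _)) => rewrite invr_ge0
    | |- is_true (@Order.le _ _ _ (powR _ _)) => apply: powR_ge0
    | |- is_true (@Order.le _ _ _ (expR _)) => apply: expR_ge0
    | |- is_true (@Order.le _ _ _ (GRing.exp _ 2)) => apply: sqr_ge0
    | |- is_true (@Order.le _ _ _ (\1_ _ _)) => rewrite indicE ler0n
    end ].
Ltac pos := repeat pos1; try by [].

Ltac side :=
  lazymatch goal with
  | |- measurable_fun _ _ => by meas
  | |- is_true (@Order.le _ _ _ _) => by pos
  | |- forall x, is_true (@Order.le _ _ _ _) => by move=> ?; pos
  | |- forall x, _ -> is_true (@Order.le _ _ _ _) => by move=> ? _; pos
  | |- _ => by []
  end.

Lemma indic_congr (T U : Type) (R : pzRingType) (A : set T) (B : set U) x y :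
  (A x <-> B y) -> \1_A x = \1_B y :> R.
Proof.
move=> AB; rewrite !indicE; congr (nat_of_bool _)%:R.
by apply/idP/idP; rewrite !inE => /AB.
Qed.

Lemma indic_mul (T U V : Type) (R : pzRingType) (A : set T) (B : set U)
    (C : set V) x y z :
  (C z <-> A x /\ B y) -> \1_A x * \1_B y = \1_C z :> R.
Proof.
move=> CAB; rewrite !indicE -natrM mulnb; congr (nat_of_bool _)%:R.
by apply/andP/idP; rewrite !inE => /CAB.
Qed.

(** * Nonnegative integrals, densities and Tonelli's theorem *)

Section nonneg_integrals.
Context d (T : measurableType d) (R : realType).
Variable m : {measure set T -> \bar R}.
Local Open Scope ereal_scope.

Lemma ge0_integral_patch (D : set T) (f : T -> \bar R) : measurable D ->
  \int[m]_(x in D) f x = \int[m]_x (f x * (\1_D x)%:E).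
Proof.
move=> mD; rewrite integral_mkcond; apply: eq_integral => x _.
by rewrite patchE indicE; case: (x \in D); rewrite ?mule1 ?mule0.
Qed.

(** Constraints between two variables, such as [r < s], pass through Tonelli's theorem as indicators
    of a fixed set; this turns them back into domains of integration. *)
Lemma integral_indicr (U : Type) (A C : set T) (B : set U) (g : T -> U)
    (f : T -> \bar R) :
  measurable A -> measurable C -> (forall x, C x <-> A x /\ B (g x)) ->
  \int[m]_(x in A) (f x * (\1_B (g x))%:E) = \int[m]_(x in C) f x.
Proof.
move=> mA mC CAB; rewrite ge0_integral_patch// [RHS]ge0_integral_patch//.
apply: eq_integral => x _; rewrite -muleA -EFinM mulrC.
by rewrite (@indic_mul _ _ _ R A B C x (g x) x).
Qed.

Lemma ge0_integralkl (D : set T) (k : \bar R) (f : T -> \bar R) :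
  measurable D -> measurable_fun setT f -> (forall x, 0 <= f x) -> 0 <= k ->
  \int[m]_(x in D) (k * f x) = k * \int[m]_(x in D) f x.
Proof.
by move=> mD mf f0 k0; rewrite ge0_integralZl//; exact: measurable_funTS.
Qed.

Lemma ge0_integralkr (D : set T) (k : \bar R) (f : T -> \bar R) :
  measurable D -> measurable_fun setT f -> (forall x, 0 <= f x) -> 0 <= k ->
  \int[m]_(x in D) (f x * k) = (\int[m]_(x in D) f x) * k.
Proof.
by move=> mD mf f0 k0; rewrite ge0_integralZr//; exact: measurable_funTS.
Qed.

Lemma ge0_integralDT (f g : T -> \bar R) :
  measurable_fun setT f -> measurable_fun setT g ->
  (forall x, 0 <= f x) -> (forall x, 0 <= g x) ->
  \int[m]_x (f x + g x) = \int[m]_x f x + \int[m]_x g x.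
Proof. by move=> mf mg f0 g0; exact: ge0_integralD. Qed.

Lemma ge0_le_integralT (f g : T -> \bar R) :
  measurable_fun setT f -> measurable_fun setT g ->
  (forall x, 0 <= f x) -> (forall x, f x <= g x) ->
  \int[m]_x f x <= \int[m]_x g x.
Proof.
by move=> mf mg f0 fg; apply: ge0_le_integral => //= x _; exact: le_trans (fg x).
Qed.

End nonneg_integrals.
Arguments integral_indicr {d T R m U A} C {B} g {f}.

Section density_integral.
Context d (T : measurableType d) (R : realType).
Variables (mu m : {measure set T -> \bar R}) (w : T -> R).
Hypotheses (mw : measurable_fun setT w) (w0 : forall x, 0 <= w x).
Hypothesis mE : forall A, measurable A -> m A = density mu w A.
Local Open Scope ereal_scope.
Import HBNNSimple.

Let integral_density_nnsfun (h : {nnsfun T >-> R}) :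
  \int[m]_x (h x)%:E = \int[mu]_x ((h x)%:E * (w x)%:E).
Proof.
under [LHS]eq_integral do rewrite fimfunE -fsumEFin//.
rewrite [LHS]ge0_integral_fsum//; last 2 first.
  - by move=> r; exact/measurable_EFinP/measurableT_comp.
  - by move=> n x _; rewrite EFinM nnfun_muleindic_ge0.
under [RHS]eq_integral.
  move=> x _; rewrite fimfunE -fsumEFin// muleC ge0_mule_fsumr; last first.
    by move=> r; rewrite EFinM nnfun_muleindic_ge0.
  over.
rewrite [RHS]ge0_integral_fsum//; last 2 first.
  - move=> r; apply: emeasurable_funM; first exact/measurable_EFinP.
    by apply/measurable_EFinP; do 2 apply/measurableT_comp => //.
  - move=> r x _; apply: mule_ge0; first by rewrite lee_fin.
    by rewrite EFinM nnfun_muleindic_ge0.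
apply: eq_fsbigr => r _.
have [r0|r0] := ltP r 0%R.
  by rewrite preimage_nnfun0// !integral0_eq// => x _;
    rewrite indicE in_set0 mulr0 ?mule0.
rewrite (eq_integral (fun x => r%:E * (\1_(h @^-1` [set r]) x)%:E)); last first.
  by move=> x _; rewrite EFinM.
rewrite ge0_integralZl//; last exact/measurable_EFinP.
rewrite integral_indic// setIT mE// /density integral_mkcond.
under [RHS]eq_integral do rewrite EFinM muleCA.
rewrite ge0_integralZl//; last 2 first.
  by apply: emeasurable_funM; apply/measurable_EFinP.
  by move=> x _; rewrite mule_ge0 ?lee_fin.
congr (_ * _); apply: eq_integral => x _.
by rewrite patchE indicE; case: (x \in _); rewrite ?mule1 ?mule0.
Qed.

Lemma integral_density (g : T -> \bar R) : measurable_fun setT g ->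
  (forall x, 0 <= g x) -> \int[m]_x g x = \int[mu]_x (g x * (w x)%:E).
Proof.
move=> mg g0; pose g_ := nnsfun_approx measurableT mg.
have g_g x : (g_ n x)%:E @[n --> \oo] --> g x by exact: cvg_nnsfun_approx.
have mg_ n : measurable_fun setT (EFin \o g_ n) by exact/measurable_EFinP.
transitivity (limn (fun n => \int[m]_x (g_ n x)%:E)).
  rewrite -monotone_convergence//=.
  - by apply: eq_integral => x _; apply/esym/cvg_lim => //; exact: g_g.
  - by move=> n x _; rewrite lee_fin.
  - by move=> x _ a b ab; rewrite lee_fin//; exact/lefP/nd_nnsfun_approx.
rewrite (_ : \int[mu]_x _ =
    limn (fun n => \int[mu]_x ((g_ n x)%:E * (w x)%:E))); last first.
  rewrite -monotone_convergence//=.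
  - apply: eq_integral => x _; apply/esym/cvg_lim => //.
    by apply: cvgeZr => //; exact: g_g.
  - by move=> n; apply: emeasurable_funM => //; exact/measurable_EFinP.
  - by move=> n x _; rewrite mule_ge0 ?lee_fin.
  - move=> x _ a b ab; apply: lee_wpmul2r; rewrite lee_fin//.
    exact/lefP/nd_nnsfun_approx.
by congr (limn _); apply/funext => n; rewrite integral_density_nnsfun.
Qed.

End density_integral.

Lemma integral_image d1 d2 (T1 : measurableType d1) (T2 : measurableType d2)
    (R : realType) (m1 : {measure set T1 -> \bar R})
    (m2 : {measure set T2 -> \bar R}) (phi : T1 -> T2) (f : T2 -> \bar R) :
  measurable_fun setT phi -> (forall A, measurable A -> m2 A = m1 (phi @^-1` A)) ->
  measurable_fun setT f -> (forall x, 0 <= f x)%E ->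
  (\int[m2]_x f x = \int[m1]_x f (phi x))%E.
Proof.
move=> mphi mE mf f0.
rewrite (eq_measure_integral (pushforward m1 phi)) => [|A mA _]; last exact: mE.
by rewrite ge0_integral_pushforward.
Qed.

Section tonelli_on.
Context d1 d2 (T1 : measurableType d1) (T2 : measurableType d2) (R : realType).
Variables (m1 : {sigma_finite_measure set T1 -> \bar R}).
Variables (m2 : {sigma_finite_measure set T2 -> \bar R}).
Variables (A : set T1) (B : set T2) (f : T1 * T2 -> \bar R).
Hypotheses (mA : measurable A) (mB : measurable B).
Hypotheses (mf : measurable_fun setT f) (f0 : forall z, (0 <= f z)%E).
Local Open Scope ereal_scope.

Let mfB : measurable_fun setT (fun z => f z * (\1_B z.2)%:E).
Proof.
apply: emeasurable_funM => //; apply/measurable_EFinP.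
by apply: measurableT_comp; [exact: measurable_indic|exact: measurable_snd].
Qed.

Let mfA : measurable_fun setT (fun z => f z * (\1_A z.1)%:E).
Proof.
apply: emeasurable_funM => //; apply/measurable_EFinP.
by apply: measurableT_comp; [exact: measurable_indic|exact: measurable_fst].
Qed.

Lemma measurable_integral1 :
  measurable_fun setT (fun x => \int[m2]_(y in B) f (x, y)).
Proof.
rewrite [X in measurable_fun _ X](_ : _ =
  fun x => \int[m2]_y (f (x, y) * (\1_B y)%:E)); last first.
  by apply/funext => x; rewrite ge0_integral_patch.
apply: (measurable_fun_fubini_tonelli_F (m2 := m2)
  (fun z => f z * (\1_B z.2)%:E)) => // z.
by rewrite mule_ge0// lee_fin.
Qed.

Lemma measurable_integral2 :
  measurable_fun setT (fun y => \int[m1]_(x in A) f (x, y)).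
Proof.
rewrite [X in measurable_fun _ X](_ : _ =
  fun y => \int[m1]_x (f (x, y) * (\1_A x)%:E)); last first.
  by apply/funext => y; rewrite ge0_integral_patch.
apply: (measurable_fun_fubini_tonelli_G (m1 := m1)
  (fun z => f z * (\1_A z.1)%:E)) => // z.
by rewrite mule_ge0// lee_fin.
Qed.

Lemma tonelli_on : \int[m1]_(x in A) \int[m2]_(y in B) f (x, y) =
                   \int[m2]_(y in B) \int[m1]_(x in A) f (x, y).
Proof.
pose g z := f z * (\1_A z.1)%:E * (\1_B z.2)%:E.
have mg : measurable_fun setT g.
  apply: emeasurable_funM => //; apply/measurable_EFinP.
  by apply: measurableT_comp; [exact: measurable_indic|exact: measurable_snd].
have g0 z : 0 <= g z by rewrite !mule_ge0// lee_fin.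
transitivity (\int[m1]_x \int[m2]_y g (x, y)).
  rewrite ge0_integral_patch//; apply: eq_integral => x _.
  rewrite ge0_integral_patch// muleC -ge0_integralZl//; last 2 first.
    by apply: measurableT_comp mfB _; exact: measurable_pair1.
    by move=> y _; rewrite mule_ge0// lee_fin.
  by apply: eq_integral => y _; rewrite /g/= muleA (muleC (\1_A x)%:E).
rewrite (fubini_tonelli g mg g0) [RHS]ge0_integral_patch//.
apply: eq_integral => y _.
rewrite [X in _ = X * _]ge0_integral_patch// muleC -ge0_integralZl//; last 2 first.
  by apply: measurableT_comp mfA _; exact: measurable_pair2.
  by move=> x _; rewrite mule_ge0// lee_fin.
by apply: eq_integral => x _; rewrite /g/= muleC.
Qed.

End tonelli_on.
Arguments tonelli_on {d1 d2 T1 T2 R m1 m2 A B f}.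
Arguments measurable_integral1 {d1 d2 T1 T2 R m2 B f}.
Arguments measurable_integral2 {d1 d2 T1 T2 R m1 A f}.

(** * Changes of variables on the real line *)

Section substitution.
Context {R : realType}.
Local Open Scope ereal_scope.
Local Notation leb := (@lebesgue_measure R).

Lemma tonelli_pos (F : R * R -> \bar R) :
  measurable_fun setT F -> (forall z, 0 <= F z) ->
  \int[leb]_(x in `]0%R, +oo[) \int[leb]_(y in `]0%R, +oo[) F (x, y) =
  \int[leb]_(y in `]0%R, +oo[) \int[leb]_(x in `]0%R, +oo[) F (x, y).
Proof.
move=> mF F0; exact: (@tonelli_on _ _ (measurableTypeR R) (measurableTypeR R) R
  leb leb `]0%R, +oo[%classic `]0%R, +oo[%classic F).
Qed.

Lemma integral_indic_lt (c : R) (f : R -> \bar R) :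
  \int[leb]_(y in `]0%R, +oo[)
    (f y * (\1_(`]0%R, +oo[%classic : set R) (c - y)%R)%:E) =
  \int[leb]_(y in `]0%R, c[) f y.
Proof.
apply: (@integral_indicr _ (measurableTypeR R) R leb R `]0%R, +oo[%classic
  `]0%R, c[%classic `]0%R, +oo[%classic (fun y : R => c - y)%R f) => // y.
by rewrite /= !in_itv/= !andbT subr_gt0; split => [/andP[]|[-> ->]].
Qed.

Lemma integral_indic_gt (c : R) (f : R -> \bar R) : (0 <= c)%R ->
  \int[leb]_(y in `]0%R, +oo[)
    (f y * (\1_(`]0%R, +oo[%classic : set R) (y - c)%R)%:E) =
  \int[leb]_(y in `]c, +oo[) f y.
Proof.
move=> c0; apply: (@integral_indicr _ (measurableTypeR R) R leb R
  `]0%R, +oo[%classic `]c, +oo[%classic `]0%R, +oo[%classic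
  (fun y : R => y - c)%R f) => // y.
rewrite /= !in_itv/= !andbT subr_gt0; split => [cy|[]//].
by split => //; exact: le_lt_trans cy.
Qed.

(* A change of variables formula only has to be checked on half-open intervals. *)
Lemma lebesgue_transport (phi w : R -> R) (f : R -> \bar R) :
  measurable_fun setT phi -> measurable_fun setT w -> (forall t, 0 <= w t)%R ->
  (forall x y : R, (x < y)%R ->
    \int[leb]_t (w t * \1_(`]x, y]%classic : set R) (phi t))%:E = (y - x)%:E) ->
  measurable_fun setT f -> (forall x, 0 <= f x) ->
  \int[leb]_x f x = \int[leb]_t (f (phi t) * (w t)%:E).
Proof.
move=> mphi mw w0 wE mf f0.
have mw' : measurable_fun [set: measurableTypeR R] (w : measurableTypeR R -> R).
  exact: mw.
pose H := isMeasure.Build _ (measurableTypeR R) R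
  (density leb (w : measurableTypeR R -> R))
  (density_set0 leb _) (density_ge0 leb w0) (density_sigma_additive mw' w0).
pose m : {measure set (measurableTypeR R) -> \bar R} :=
  HB.pack (density leb (w : measurableTypeR R -> R)) H.
pose nu : {measure set (measurableTypeR R) -> \bar R} :=
  measure_function_pushforward__canonical__measure_function_Measure m
    (mphi : measurable_fun setT (phi : _ -> measurableTypeR R)).
(* [nu] is the image under [phi] of the measure with density [w]. It agrees with Lebesgue measure on
   half-open intervals, hence on all Borel sets. *)
have leE A : measurable A -> leb A = nu A.
  apply: lebesgue_measure_unique => _ [[x y]] _ <-.
  rewrite lebesgue_measure_itv/= lte_fin.
  have [xy|yx] := ltP x y; last first.
    rewrite set_itv_ge; last by rewrite bnd_simp -leNgt.
    by rewrite /pushforward preimage_set0 density_set0.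
  rewrite /pushforward /density -EFinB -wE// integral_mkcond.
  apply: eq_integral => t _; rewrite patchE indicE.
  have -> : (t \in phi @^-1` `]x, y]) = (phi t \in (`]x, y]%classic : set R)).
    by apply/idP/idP; rewrite !inE.
  by case: (phi t \in _); rewrite ?mulr1 ?mulr0.
rewrite (integral_image (T1 := measurableTypeR R) (T2 := measurableTypeR R)
  (m1 := m) mphi leE mf f0).
rewrite (integral_density (T := measurableTypeR R) (mu := leb) (m := m) mw w0)//.
exact: measurableT_comp mf mphi.
Qed.

Lemma integral_affine (c b : R) (f : R -> \bar R) : (c != 0)%R ->
  measurable_fun setT f -> (forall x, 0 <= f x) ->
  `|c|%:E * \int[leb]_x f (c * x + b)%R = \int[leb]_x f x.
Proof.
move=> c0 mf f0.
have mphi : measurable_fun [set: R] (fun t : R => c * t + b)%R by meas.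
rewrite [RHS](lebesgue_transport mphi (w := cst `|c|%R))//; last first.
  move=> x y xy; under eq_integral do rewrite EFinM /cst.
  rewrite ge0_integralZl//; last by meas.
  rewrite [X in _ * X](_ : _ = leb ((fun t => c * t + b)%R @^-1` `]x, y])); last first.
    rewrite -[RHS]mul1e -integral_cst; last first.
      by rewrite -[X in measurable X]setTI; exact: mphi.
    rewrite [RHS]ge0_integral_patch; last first.
      by rewrite -[X in measurable X]setTI; exact: mphi.
    apply: eq_integral => t _; rewrite mul1e !indicE.
    by congr (nat_of_bool _)%:R%:E; apply/idP/idP; rewrite !inE.
  have [cp|cn] := boolP (0 < c)%R.
    have -> : (fun z : R => c * z + b)%R @^-1` `]x, y] =
        `](x - b) / c, (y - b) / c]%classic%R.
      apply/seteqP; split => z /=; rewrite !in_itv/= ltr_pdivrMr// ler_pdivlMr//.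
        by move=> /andP[? ?]; apply/andP; split; lra.
      by move=> /andP[? ?]; apply/andP; split; lra.
    rewrite lebesgue_measure_itv/= !lte_fin ltr_pM2r ?invr_gt0// ltrD2r xy.
    by rewrite -!EFinB -EFinM gtr0_norm//; congr EFin; field.
  (* A negative slope reverses the interval, so the preimage is closed on the left instead of on the
     right. *)
  have cn' : (c < 0)%R by rewrite lt_neqAle c0 leNgt.
  have -> : (fun z : R => c * z + b)%R @^-1` `]x, y] =
      `[(y - b) / c, (x - b) / c[%classic%R.
    apply/seteqP; split => z /=; rewrite !in_itv/= ler_ndivrMr// ltr_ndivlMr//.
      by move=> /andP[? ?]; apply/andP; split; lra.
    by move=> /andP[? ?]; apply/andP; split; lra.
  rewrite lebesgue_measure_itv/= !lte_fin ltr_nM2r ?invr_lt0// ltrD2r xy.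
  by rewrite -!EFinB -EFinM ltr0_norm//; congr EFin; field.
under [RHS]eq_integral do rewrite muleC /cst.
by rewrite ge0_integralZl//; exact: measurableT_comp mf mphi.
Qed.

Lemma integral_translate (b : R) (f : R -> \bar R) :
  measurable_fun setT f -> (forall x, 0 <= f x) ->
  \int[leb]_x f (x + b)%R = \int[leb]_x f x.
Proof.
move=> mf f0; rewrite -[RHS](integral_affine b (oner_neq0 R))// normr1 mul1e.
by under [RHS]eq_integral do rewrite mul1r.
Qed.

Lemma integral_reflect (b : R) (f : R -> \bar R) :
  measurable_fun setT f -> (forall x, 0 <= f x) ->
  \int[leb]_x f (b - x)%R = \int[leb]_x f x.
Proof.
move=> mf f0; have n0 : (-1 != 0 :> R)%R by rewrite oppr_eq0 oner_eq0.
rewrite -[RHS](integral_affine b n0)// normrN1 mul1e.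
by under [RHS]eq_integral do rewrite mulN1r addrC.
Qed.

Lemma integral_scale (c : R) (f : R -> \bar R) : (0 < c)%R ->
  measurable_fun setT f -> (forall x, 0 <= f x) ->
  c%:E * \int[leb]_(x in `]0%R, +oo[) f (c * x)%R = \int[leb]_(x in `]0%R, +oo[) f x.
Proof.
move=> c0 mf f0; rewrite ge0_integral_patch// [RHS]ge0_integral_patch//.
rewrite -[RHS](integral_affine 0 (lt0r_neq0 c0)); last 2 first.
  by apply: emeasurable_funM => //; exact/measurable_EFinP/measurable_indic.
  by move=> x; rewrite mule_ge0// lee_fin.
rewrite gtr0_norm//; congr (_ * _); apply: eq_integral => x _.
rewrite addr0; congr (_ * _); congr EFin; rewrite !indicE; congr (_%:R).
by congr nat_of_bool; apply/idP/idP; rewrite !inE/= !in_itv/= !andbT pmulr_rgt0.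
Qed.

Lemma integral_expR_gt (y : R) :
  \int[leb]_(x in `]y, +oo[) (expR (- x))%:E = (expR (- y))%:E.
Proof.
have ce : continuous (fun z : R^o => expR (- z) : R).
  by move=> z; apply: continuous_comp; [exact: continuousN|exact: continuous_expR].
rewrite integral_itv_obnd_cbnd; last first.
  apply/measurable_EFinP; apply: measurable_funTS.
  exact: continuous_measurable_fun.
rewrite (@ge0_continuous_FTC2y _ _ (fun x => - expR (- x))%R _ 0)//.
- by rewrite -EFinB opprK add0r.
- exact: continuous_subspaceT.
- by rewrite -oppr0; apply: cvgN; exact: cvgr_expR.
- by apply: cvgN; apply/cvg_at_right_filter; exact: ce.
- move=> x _; rewrite derive1N//; last first.
  rewrite derive1_comp// derive1N// derive1_id derive1E.
  have /funeqP -> := @derive_expR R.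
  by rewrite mulrN1 opprK.
Qed.

Lemma integral_ln_subst (F : R -> \bar R) :
  measurable_fun setT F -> (forall x, 0 <= F x) ->
  \int[leb]_x F x = \int[leb]_(t in `]0%R, +oo[) (F (ln t) * (t^-1)%:E).
Proof.
move=> mF F0.
(* The indicator removes [t <= 0], where [ln] only has a default value. *)
pose w (t : R) : R := (t^-1 * \1_(`]0%R, +oo[%classic : set R) t)%R.
have w0 t : (0 <= w t)%R.
  rewrite /w indicE; case: (boolP (t \in _)) => [|_]; last by rewrite mulr0.
  by rewrite inE/= in_itv/= andbT => t0; rewrite mulr1 invr_ge0 ltW.
have mw : measurable_fun setT w by rewrite /w; meas.
rewrite (lebesgue_transport (@measurable_ln R) mw w0)//; last first.
  move=> x y xy.
  have exy : (expR x < expR y)%R by rewrite ltr_expR.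
  transitivity (\int[leb]_(t in `[expR x, expR y]) (t^-1)%:E).
    rewrite -integral_itv_obnd_cbnd; last by meas.
    rewrite [RHS]ge0_integral_patch//; apply: eq_integral => t _.
    rewrite /w -mulrA EFinM; congr (_ * _); congr EFin.
    rewrite mulrC [LHS]mulrC.
    apply: indic_mul; rewrite /= !in_itv/= andbT; split; last first.
      by move=> [t0]; rewrite -{3 4}(lnK (x := t)) ?posrE// ltr_expR ler_expR.
    move=> /andP[xt ty]; have t0 : (0 < t)%R by rewrite (lt_trans _ xt) ?expR_gt0.
    by move: xt ty; rewrite -{1 2}(lnK (x := t)) ?posrE// ltr_expR ler_expR => -> ->.
  rewrite (@continuous_FTC2 _ _ (@ln R))//; first by rewrite !expRK EFinB.
  - apply: continuous_in_subspaceT => t; rewrite inE/= in_itv/= => /andP[xt _].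
    by apply: inv_continuous; rewrite gt_eqF// (lt_le_trans _ xt) ?expR_gt0.
  - split.
    + move=> t; rewrite in_itv/= => /andP[xt _].
      by apply: ex_derive; apply: is_derive1_ln; rewrite (lt_trans _ xt) ?expR_gt0.
    + by apply/cvg_at_right_filter; apply: continuous_ln; rewrite expR_gt0.
    + by apply/cvg_at_left_filter; apply: continuous_ln; rewrite expR_gt0.
  - move=> t; rewrite in_itv/= => /andP[xt _].
    have t0 : (0 < t)%R by rewrite (lt_trans _ xt) ?expR_gt0.
    by rewrite derive1E; have [_ ->] := is_derive1_ln t0.
rewrite [RHS]ge0_integral_patch//; apply: eq_integral => t _.
by rewrite /w EFinM muleA.
Qed.

Lemma integral_expR_subst (f : R -> \bar R) :
  measurable_fun setT f -> (forall x, 0 <= f x) ->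
  \int[leb]_(t in `]0%R, +oo[) f t = \int[leb]_x (f (expR x) * (expR x)%:E).
Proof.
move=> mf f0; rewrite integral_ln_subst; last 2 first.
  by meas.
  by move=> x; rewrite mule_ge0// lee_fin expR_ge0.
apply: eq_integral => t; rewrite inE/= in_itv/= andbT => t0.
by rewrite lnK ?posrE// -muleA -EFinM divff ?gt_eqF// mule1.
Qed.

(** In the coordinate [t = exp x] the inversion is the reflection [x -> - x]; the factor [t ^ -2] is
    its Jacobian. *)
Lemma integral_inversion (f : R -> \bar R) :
  measurable_fun setT f -> (forall x, 0 <= f x) ->
  \int[leb]_(t in `]0%R, +oo[) (f (t^-1)%R * (t^-1 ^+ 2)%:E) =
  \int[leb]_(t in `]0%R, +oo[) f t.
Proof.
move=> mf f0.
rewrite !integral_expR_subst//; last 2 first.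
  by meas.
  by move=> x; rewrite mule_ge0// lee_fin sqr_ge0.
rewrite -[RHS](integral_reflect 0); last 2 first.
  by meas.
  by move=> x; rewrite mule_ge0// lee_fin expR_ge0.
apply: eq_integral => x _; rewrite sub0r -expRN -muleA -EFinM; congr (_ * _%:E).
by rewrite expr2 -mulrA -expRD addNr expR0 mulr1.
Qed.

(** The substitution [y = exp (- x / p)] leads to the exponential tail beyond [- p ln w]. A direct
    use of the fundamental theorem of calculus would meet the singularity at 0 when [p < 1]. *)
Lemma integral_powR_lt (p w : R) : (0 < p)%R -> (0 < w)%R ->
  \int[leb]_(y in `]0%R, w[) (p * y `^ (p - 1))%:E = (w `^ p)%:E.
Proof.
move=> p0 w0.
pose F (x : R) : \bar R :=
  (expR (- x) * \1_(`]- (p * ln w), +oo[%classic%R : set R) x)%:E.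
transitivity (\int[leb]_(y in `]0%R, +oo[)
    (p * y `^ (p - 1) * \1_(`]-oo, w[%classic : set R) y)%:E).
  under [RHS]eq_integral do rewrite EFinM.
  apply/esym; apply: (integral_indicr _ id) => // y; rewrite /= !in_itv/= andbT.
  by split => [/andP[]|[-> ->]].
have mF : measurable_fun setT F by rewrite /F; meas.
have F0 x : 0 <= F x by rewrite lee_fin mulr_ge0 ?expR_ge0.
rewrite integral_expR_subst; last 2 first.
  by meas.
  by move=> x; rewrite lee_fin !mulr_ge0 ?powR_ge0// ltW.
transitivity (`|- p|%:E * \int[leb]_x F (- p * x + 0)%R).
  rewrite normrN gtr0_norm// -ge0_integralZl//; last 2 first.
    by meas.
    by rewrite lee_fin ltW.
  apply: eq_integral => x _; rewrite /F addr0 -!EFinM; congr EFin.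
  rewrite /powR gt_eqF ?expR_gt0// expRK -!mulrA; congr (_ * _)%R.
  rewrite mulrCA mulrC -expRD; congr (expR _ * _)%R; first by ring.
  apply: indic_congr; rewrite /= !in_itv/= andbT mulNr ltrN2 ltr_pM2l//.
  by rewrite -[(x < ln w)%R]ltr_expR lnK ?posrE.
rewrite integral_affine ?oppr_eq0 ?gt_eqF// /F.
under eq_integral do rewrite EFinM.
by rewrite -ge0_integral_patch// integral_expR_gt opprK /powR gt_eqF.
Qed.

Lemma integral_powR_gt (p w : R) : (0 < p)%R -> (0 < w)%R ->
  \int[leb]_(y in `]w, +oo[) (p * y `^ (- p - 1))%:E = (w `^ (- p))%:E.
Proof.
move=> p0 w0.
have wV : (0 < w^-1)%R by rewrite invr_gt0.
rewrite powRN -powR_inv1 ?powR_ge0// -powRrM mulrC powRrM powR_inv1 ?ltW//.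
rewrite -(integral_powR_lt p0 wV).
have mP : measurable_fun setT (fun x : R => (p * x `^ (p - 1))%:E *
    (\1_(`]0%R, (w^-1)%R[%classic : set R) x)%:E) by meas.
transitivity (\int[leb]_(x in `]0%R, +oo[) ((p * x `^ (- p - 1))%:E *
    (\1_(`]w, +oo[%classic : set R) x)%:E)).
  apply/esym; apply: (integral_indicr _ id) => // x; rewrite /= !in_itv/= !andbT.
  by split => [wx|[]//]; split => //; exact: lt_trans wx.
transitivity (\int[leb]_(x in `]0%R, +oo[) ((p * x `^ (p - 1))%:E *
    (\1_(`]0%R, (w^-1)%R[%classic : set R) x)%:E)); last first.
  apply: (integral_indicr _ id) => // x; rewrite /= !in_itv/= !andbT.
  by split => [/andP[-> ->]|[]].
rewrite -integral_inversion//; last 2 first.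
  by meas.
  by move=> x; rewrite mule_ge0// lee_fin// mulr_ge0 ?powR_ge0// ltW.
apply: eq_integral => x; rewrite inE/= in_itv/= andbT => x0.
rewrite muleAC -EFinM; congr (_%:E * _%:E).
  rewrite -powR_inv1 ?ltW// -powRrM -powR_mulrn ?powR_ge0// -powRrM -mulrA.
  rewrite -powRD; last by rewrite (gt_eqF x0) implybT.
  by congr (_ * _ `^ _)%R; ring.
apply: indic_congr; rewrite /= !in_itv/= !andbT x0/=.
by rewrite -[in X in _ <-> X](invrK x) ltf_pV2 ?posrE ?invr_gt0.
Qed.

End substitution.

(** * Gamma and Beta integrals *)

Section gamma.
Context {R : realType}.
Implicit Types p q s r c t : R.
Local Open Scope ereal_scope.
Local Notation leb := (@lebesgue_measure R).

Definition gamma_integral p : \bar R :=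
  \int[leb]_(t in `]0%R, +oo[) (t `^ (p - 1) * expR (- t))%:E.

(** From [t / c <= exp (t / c)], raised to the power [c]. *)
Lemma expRN_le_powR c t : (0 < c)%R -> (0 < t)%R ->
  ((expR (- t) : R) <= c `^ c * t `^ (- c))%R.
Proof.
move=> c0 t0; have tc : (0 < t / c)%R by rewrite divr_gt0.
have : ((t / c) `^ c <= expR (t / c) `^ c)%R.
  rewrite ge0_ler_powR ?nnegrE ?expR_ge0 1?ltW//.
  by rewrite (lt_le_trans _ (expR_ge1Dx _))// ltrDr.
rewrite -expRM divfK ?gt_eqF// => h.
rewrite powRN -[(c `^ c)%R]invrK -invfM expRN lef_pV2 ?posrE ?expR_gt0//; last first.
  by rewrite mulr_gt0 ?invr_gt0// powR_gt0.
rewrite mulrC; apply: le_trans h.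
rewrite powRM ?invr_ge0 ?(ltW t0) ?(ltW c0)//.
by rewrite -[(c^-1)%R]powR_inv1 ?(ltW c0)// -powRrM mulN1r powRN.
Qed.

Lemma gamma_integral_lty p : (0 < p)%R -> gamma_integral p < +oo.
Proof.
(* With the exponent [p + 1] in [expRN_le_powR] the integrand on the tail is at most a constant
   times [t ^ -2]. *)
move=> p0; have c0 : (0 < p + 1)%R by rewrite addr_gt0.
rewrite /gamma_integral.
have -> : (`]0%R, +oo[%classic : set R) = `]0%R, 1%R] `|` `]1%R, +oo[.
  apply/seteqP; split => x /=; rewrite !in_itv/= !andbT.
    by move=> x0; rewrite x0/=; case: (leP x 1%R) => ?; [left|right].
  by case=> [/andP[]//|]; exact: lt_trans.
have mf A : measurable_fun A (fun t : R => (t `^ (p - 1) * expR (- t))%:E).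
  by apply: measurable_funTS; meas.
have f0 t : 0 <= (t `^ (p - 1) * expR (- t))%:E :> \bar R.
  by rewrite lee_fin mulr_ge0 ?powR_ge0 ?expR_ge0.
rewrite ge0_integral_setU//; last 2 first.
- exact: mf.
- apply/disj_setPRL => x /=; rewrite !in_itv/= andbT => x1.
  by apply/negP; rewrite negb_and -ltNge x1 orbT.
apply: lte_add_pinfty.
  (* The piece []0, 1]] is enlarged to []0, 2[], to fit the open interval of [integral_powR_lt]. *)
  apply: (@le_lt_trans _ _
    (\int[leb]_(t in `]0%R, 2%R[) (p^-1%:E * (p * t `^ (p - 1))%:E))).
    apply: (@le_trans _ _
      (\int[leb]_(t in `]0%R, 2%R[) (t `^ (p - 1) * expR (- t))%:E)).
      apply: ge0_subset_integral => //; first exact: mf.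
      move=> x /=; rewrite !in_itv/= => /andP[-> x1]/=.
      by rewrite (le_lt_trans x1)// ltr1n.
    apply: ge0_le_integral => //.
    - by apply: measurable_funTS; meas.
    - by apply: measurable_funTS; meas.
    move=> t; rewrite /= in_itv/= => /andP[t0 _].
    rewrite -EFinM mulrA mulVf ?gt_eqF// mul1r lee_fin ler_piMr ?powR_ge0//.
    by rewrite -expR0 ler_expR lerNl oppr0 ltW.
  rewrite ge0_integralkl; [|side..].
  by rewrite integral_powR_lt// -EFinM ltry.
apply: (@le_lt_trans _ _ (\int[leb]_(t in `]1%R, +oo[)
    (((p + 1) `^ (p + 1))%:E * (1 * t `^ (- 1 - 1))%:E))).
  apply: ge0_le_integral => //.
  - by apply: measurable_funTS; meas.
  - by apply: measurable_funTS; meas.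
  move=> t; rewrite /= in_itv/= andbT => t1.
  have t0 : (0 < t)%R by exact: lt_trans t1.
  rewrite -EFinM mul1r lee_fin.
  apply: (le_trans (ler_wpM2l (powR_ge0 _ _) (expRN_le_powR c0 t0))).
  rewrite mulrCA -powRD; last by rewrite (gt_eqF t0) implybT.
  by rewrite le_eqVlt; apply/orP; left; apply/eqP; congr (_ * _ `^ _)%R; ring.
rewrite ge0_integralkl; [|side..].
by rewrite integral_powR_gt// -EFinM ltry.
Qed.

Lemma gamma_integralE p : (0 < p)%R -> gamma_integral p = (Gamma p)%:E.
Proof.
move=> p0; rewrite /Gamma /Rintegral fineK// ge0_fin_numE ?gamma_integral_lty//.
by apply: integral_ge0 => t _; rewrite lee_fin mulr_ge0 ?powR_ge0 ?expR_ge0.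
Qed.

Lemma Gamma_gt0 p : (0 < p)%R -> (0 < Gamma p)%R.
Proof.
move=> p0; rewrite -lte_fin -gamma_integralE//.
apply: (@lt_le_trans _ _ (\int[leb]_(t in `]0%R, 1%R[)
    ((expR (- 1) / p)%:E * (p * t `^ (p - 1))%:E))).
  rewrite ge0_integralkl; [|side..].
  by rewrite integral_powR_lt// -EFinM lte_fin powR1 mulr1 divr_gt0 ?expR_gt0.
apply: (@le_trans _ _
  (\int[leb]_(t in `]0%R, 1%R[) (t `^ (p - 1) * expR (- t))%:E)).
  apply: ge0_le_integral => //.
  - by move=> t _; pos.
  - by apply: measurable_funTS; meas.
  - by apply: measurable_funTS; meas.
  move=> t; rewrite /= in_itv/= => /andP[t0 t1].
  rewrite -EFinM mulrA divfK ?gt_eqF// lee_fin mulrC ler_wpM2l ?powR_ge0//.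
  by rewrite ler_expR lerN2 ltW.
apply: ge0_subset_integral => //.
- by apply: measurable_funTS; meas.
- by move=> t _; rewrite lee_fin mulr_ge0 ?powR_ge0 ?expR_ge0.
- by move=> x /=; rewrite !in_itv/= andbT => /andP[].
Qed.

Lemma gamma_integral_scale p s : (0 < p)%R -> (0 < s)%R ->
  \int[leb]_(t in `]0%R, +oo[) (t `^ (p - 1) * expR (- (t * s)))%:E =
  (Gamma p * s `^ (- p))%:E.
Proof.
move=> p0 s0; rewrite EFinM -gamma_integralE// /gamma_integral.
rewrite -[X in _ = X * _](integral_scale s0); last 2 first.
- by meas.
- by move=> t; rewrite lee_fin mulr_ge0 ?powR_ge0 ?expR_ge0.
rewrite [RHS]muleC muleA -EFinM -ge0_integralkl; [|side..].
apply: eq_integral => t; rewrite inE/= in_itv/= andbT => t0.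
rewrite -EFinM; congr EFin; rewrite powRM ?ltW// (mulrC t s) !mulrA.
congr (_ * _)%R; rewrite -[LHS]mul1r; congr (_ * _)%R; rewrite mulrAC -powRD; last by rewrite (gt_eqF s0) implybT.
rewrite (_ : - p + (p - 1) = - 1)%R; last by ring.
by rewrite powR_inv1 ?(ltW s0)// mulVf ?gt_eqF.
Qed.

(** Replaces integration by parts: [t ^ p] is the integral of [p y ^ (p - 1)] over [0 < y < t], and
    Tonelli's theorem leaves the exponential tail beyond [y]. *)
Lemma Gamma_recr p : (0 < p)%R -> Gamma (p + 1) = (p * Gamma p)%R.
Proof.
move=> p0; apply: EFin_inj.
rewrite EFinM -!gamma_integralE ?addr_gt0// /gamma_integral.
pose F (z : R * R) : \bar R := (p * z.2 `^ (p - 1) * expR (- z.1))%:E *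
  (\1_(`]0%R, +oo[%classic : set R) (z.1 - z.2)%R)%:E.
have mF : measurable_fun setT F by rewrite /F; meas.
have F0 z : 0 <= F z.
  by rewrite mule_ge0// lee_fin ?mulr_ge0 ?powR_ge0 ?expR_ge0 ?(ltW p0).
transitivity (\int[leb]_(t in `]0%R, +oo[) \int[leb]_(y in `]0%R, +oo[) F (t, y)).
  apply: eq_integral => t; rewrite inE/= in_itv/= andbT => t0.
  rewrite /F/= integral_indic_lt.
  under eq_integral do rewrite mulrC EFinM.
  rewrite ge0_integralkl; [|side..].
  by rewrite integral_powR_lt// addrK -EFinM mulrC.
rewrite (tonelli_pos mF F0) -ge0_integralkl; [|side..].
apply: eq_integral => y; rewrite inE/= in_itv/= andbT => y0.
rewrite /F/= integral_indic_gt ?ltW//.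
under eq_integral do rewrite EFinM.
rewrite ge0_integralkl; [|side..].
by rewrite integral_expR_gt -!EFinM mulrA.
Qed.

(** * Beta integrals and the kernels of the Gaussian identity *)

Definition beta_integral p q : \bar R :=
  \int[leb]_(w in `]0%R, 1%R[) (w `^ (p - 1) * (1 - w) `^ (q - 1))%:E.

Lemma beta_integral_scale p q (u : R) : (0 < u)%R ->
  \int[leb]_(r in `]0%R, u[) (r `^ (p - 1) * (u - r) `^ (q - 1))%:E =
  (u `^ (p + q - 1))%:E * beta_integral p q.
Proof.
move=> u0.
transitivity (\int[leb]_(r in `]0%R, +oo[) ((r `^ (p - 1) * (u - r) `^ (q - 1))%:E *
   (\1_(`]0%R, u[%classic : set R) r)%:E)).
  apply/esym; apply: (integral_indicr _ id) => // r.
  by rewrite /= !in_itv/= !andbT; split => [/andP[-> ->]|[]].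
rewrite -(integral_scale u0); last 2 first.
- by meas.
- by move=> r; pos.
transitivity (u%:E * \int[leb]_(w in `]0%R, 1%R[)
   ((u * w) `^ (p - 1) * (u - u * w) `^ (q - 1))%:E).
  congr (_ * _); apply: (@integral_indicr _ (measurableTypeR R) R leb R
    `]0%R, +oo[%classic `]0%R, 1%R[%classic `]0%R, u[%classic
    (fun w : R => u * w)%R) => // w.
  rewrite /= !in_itv/= !andbT pmulr_rgt0// -ltr_pdivlMl// mulVf ?gt_eqF//.
  by split => [/andP[-> ->]|[]].
rewrite -[LHS]ge0_integralkl; [|side..].
rewrite /beta_integral -[RHS]ge0_integralkl; [|side..].
apply: eq_integral => w; rewrite inE/= in_itv/= => /andP[w0 w1].
rewrite -!EFinM; congr EFin.
rewrite -[X in (X - _ * _)%R]mulr1 -mulrBr !powRM ?subr_ge0 ?ltW//.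
have -> : (u `^ (p + q - 1) = u * (u `^ (p - 1) * u `^ (q - 1)))%R.
  rewrite -[X in (X * _)%R](powRr1 (ltW u0)) -!powRD ?(gt_eqF u0) ?implybT//.
  by congr (_ `^ _)%R; ring.
by ring.
Qed.

(** In the product of two Gamma integrals the second variable is replaced by the sum [u] of both.
    After Tonelli's theorem the integral over [0 < r < u] is [u ^ (p + q - 1)] times the beta
    integral, by scaling. *)
Lemma beta_integral_Gamma p q : (0 < p)%R -> (0 < q)%R ->
  (Gamma (p + q))%:E * beta_integral p q = (Gamma p * Gamma q)%:E.
Proof.
move=> p0 q0.
have beta0 : 0 <= beta_integral p q by apply: integral_ge0 => w _; pos.
have gam0 r : 0 <= gamma_integral r by apply: integral_ge0 => w _; pos.
transitivity (gamma_integral p * gamma_integral q); last first.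
  by rewrite (gamma_integralE p0) (gamma_integralE q0) EFinM.
rewrite -(gamma_integralE (addr_gt0 p0 q0)) {1}/gamma_integral.
pose F (z : R * R) : \bar R := (z.1 `^ (p - 1) * (z.2 - z.1) `^ (q - 1) * expR (- z.2))%:E *
  (\1_(`]0%R, +oo[%classic : set R) (z.2 - z.1)%R)%:E.
have mF : measurable_fun setT F by rewrite /F; meas.
have F0 z : 0 <= F z by rewrite /F; pos.
transitivity (\int[leb]_(r in `]0%R, +oo[) \int[leb]_(u in `]0%R, +oo[) F (r, u)); last first.
  rewrite {1}/gamma_integral muleC -[RHS]ge0_integralkl; [|side..].
  apply: eq_integral => r; rewrite inE/= in_itv/= andbT => r0.
  rewrite muleC /gamma_integral ge0_integral_patch//.
  rewrite [X in _ * X]ge0_integral_patch// -[X in _ * X](integral_translate (- r)); last 2 first.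
  - by meas.
  - by move=> w; pos.
  rewrite -[RHS]ge0_integralkl; [|side..].
  apply: eq_integral => u _.
  have e : (\1_(`]0%R, +oo[%classic : set R) (u - r) *
      \1_(`]0%R, +oo[%classic : set R) u =
      \1_(`]0%R, +oo[%classic : set R) (u - r) :> R)%R.
    apply: indic_mul; rewrite /= !in_itv/= !andbT subr_gt0.
    by split => [ru|[]//]; split => //; exact: lt_trans ru.
  rewrite /F/= -!EFinM -mulrA e [in RHS]mulrA; congr (EFin (_ * _))%R.
  by rewrite [RHS]mulrACA -expRD (_ : - r + - (u - r) = - u)%R//; ring.
rewrite (tonelli_pos mF F0) muleC -ge0_integralkl; [|side..].
apply: eq_integral => u; rewrite inE/= in_itv/= andbT => u0.
rewrite /F/= integral_indic_lt.
under eq_integral do rewrite mulrC EFinM.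
rewrite ge0_integralkl; [|side..].
by rewrite beta_integral_scale// muleA -EFinM muleC [in LHS]mulrC.
Qed.

(** The substitution [w = r / s], composed of an inversion and a scaling: the dependence on [r]
    separates from a Mellin integral of [k]. *)
Lemma integral_ratio g r (k : R -> R) : (0 < r)%R ->
  measurable_fun setT k -> (forall w, 0 <= k w)%R ->
  \int[leb]_(s in `]0%R, +oo[) (s `^ (g - 1) * k (r / s))%:E =
  (r `^ g)%:E * \int[leb]_(w in `]0%R, +oo[) (w `^ (- g - 1) * k w)%:E.
Proof.
move=> r0 mk k0.
rewrite -[LHS]integral_inversion; [|side..].
rewrite -[X in _ * X](integral_scale r0); [|side..].
rewrite muleA -EFinM -[RHS]ge0_integralkl; [|side..].
apply: eq_integral => x; rewrite inE/= in_itv/= andbT => x0.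
rewrite -!EFinM invrK; congr EFin.
rewrite mulrAC !mulrA; congr (_ * _)%R.
have e : (r `^ g * r * r `^ (- g - 1) = 1)%R.
  rewrite -[X in (_ * X * _)%R](powRr1 (ltW r0)) -!powRD ?(gt_eqF r0) ?implybT//.
  by rewrite (_ : g + 1 + (- g - 1) = 0)%R ?powRr0//; ring.
rewrite powRM ?(ltW r0) ?(ltW x0)// [RHS]mulrA e mul1r -[LHS]mulrA -expr2.
rewrite -powR_inv1 ?ltW// -powR_mulrn ?powR_ge0// -!powRrM -powRD ?(gt_eqF x0) ?implybT//.
by congr (_ `^ _)%R; ring.
Qed.

(** The substitution [1 / r = 1 / s + 1 / t], a translation between two inversions. Convolving
    Gaussians with parameters [s] and [t] produces exactly the parameter [s t / (s + t)], which
    ranges over []0, s[]. *)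
Lemma integral_harmonic s (h : R -> \bar R) : (0 < s)%R ->
  measurable_fun setT h -> (forall x, 0 <= h x) ->
  \int[leb]_(r in `]0%R, s[) h r =
  \int[leb]_(t in `]0%R, +oo[) (h (s * t / (s + t))%R * ((s / (s + t)) ^+ 2)%:E).
Proof.
move=> s0 mh h0; have sV0 : (0 < s^-1)%R by rewrite invr_gt0.
transitivity (\int[leb]_(r in `]0%R, +oo[)
    (h r * (\1_(`]0%R, s[%classic : set R) r)%:E)).
  apply/esym; apply: (@integral_indicr _ (measurableTypeR R) R leb R
    `]0%R, +oo[%classic `]0%R, s[%classic `]0%R, s[%classic id) => // r.
  by rewrite /= !in_itv/= !andbT; split => [/andP[-> ->]|[]].
rewrite -[LHS]integral_inversion; [|side..].
transitivity (\int[leb]_(y in `]s^-1%R, +oo[) (h (y^-1)%R * (y^-1 ^+ 2)%:E)).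
  rewrite -(@integral_indic_gt _ s^-1%R) ?ltW//.
  apply: eq_integral => y; rewrite inE/= in_itv/= andbT => y0.
  rewrite muleAC; congr (_ * _%:E); apply: indic_congr.
  rewrite /= !in_itv/= andbT subr_gt0 invr_gt0 y0/=.
  by rewrite -[in X in X <-> _](invrK s) ltf_pV2 ?posrE.
rewrite ge0_integral_patch// -(integral_translate s^-1); [|side..].
rewrite (_ : (fun _ => _) = (fun x => h ((x + s^-1)^-1)%R * ((x + s^-1)^-1 ^+ 2)%:E *
    (\1_(`]0%R, +oo[%classic : set R) x)%:E)); last first.
  apply/funext => x; congr (_ * _%:E); apply: indic_congr.
  by rewrite /= !in_itv/= !andbT ltrDr.
rewrite -ge0_integral_patch// -[LHS]integral_inversion; [|side..].
apply: eq_integral => t; rewrite inE/= in_itv/= andbT => t0.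
have e : ((t^-1 + s^-1)^-1 = s * t / (s + t))%R.
  by field; rewrite ?gt_eqF// addr_gt0.
rewrite e -muleA -EFinM; congr (_ * _%:E).
by field; rewrite ?gt_eqF// addr_gt0.
Qed.

(** The function [1 - (1 - w) ^ (c - 1)] on []0, 1[], continued by 1, compares [phi] with its
    Gaussian average. It is negative on []0, 1[] when [c < 1], so it is written as [kern1 - kern2]
    with both kernels nonnegative. Both are of order [w] at 0, hence integrable there against
    [w ^ (- g - 1)] for [g < 1]. *)
Definition kern1 c w : R := (1 - \1_(`]0%R, 1%R[%classic : set R) w * (1 - w) `^ c)%R.
Definition kern2 c w : R :=
  (\1_(`]0%R, 1%R[%classic : set R) w * (w * (1 - w) `^ (c - 1)))%R.

Lemma kern2_ge0 c w : (0 <= kern2 c w)%R.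
Proof.
rewrite /kern2 indicE; case: (boolP (w \in _)) => [|_]; last by rewrite mul0r.
by rewrite inE/= in_itv/= => /andP[w0 _]; pos.
Qed.

Lemma kern1_ge0 c w : (0 < c)%R -> (0 <= kern1 c w)%R.
Proof.
move=> c0; rewrite /kern1 indicE subr_ge0.
case: (boolP (w \in _)) => [|_]; last by rewrite mul0r ler01.
rewrite inE/= in_itv/= mul1r => /andP[w0 w1].
have h : (1 `^ c = 1 :> R)%R by rewrite powR1.
by rewrite -[leRHS]h ge0_ler_powR ?nnegrE ?subr_ge0 ?gerBl ?(ltW w0) ?(ltW w1) ?(ltW c0).
Qed.

Lemma measurable_kern1 c : measurable_fun setT (kern1 c).
Proof. by rewrite /kern1; meas. Qed.

Lemma measurable_kern2 c : measurable_fun setT (kern2 c).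
Proof. by rewrite /kern2; meas. Qed.

Lemma kern12 c w : (0 < c)%R ->
  (1 + kern2 c w = \1_(`]0%R, 1%R[%classic : set R) w * (1 - w) `^ (c - 1) + kern1 c w)%R.
Proof.
move=> c0; rewrite /kern1 /kern2 indicE.
case: (boolP (w \in _)) => [|_]; last by rewrite !mul0r; ring.
rewrite inE/= in_itv/= => /andP[w0 w1].
rewrite -[in X in (_ + (_ - _ * X))%R]mulr_powRB1 ?subr_ge0 ?(ltW w1)//; ring.
Qed.

Lemma integral_kern2 g c :
  \int[leb]_(w in `]0%R, +oo[) (w `^ (- g - 1) * kern2 c w)%:E = beta_integral (1 - g) c.
Proof.
transitivity (\int[leb]_(w in `]0%R, +oo[) ((w `^ (1 - g - 1) * (1 - w) `^ (c - 1))%:E *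
    (\1_(`]0%R, 1%R[%classic : set R) w)%:E)).
  apply: eq_integral => w; rewrite inE/= in_itv/= andbT => w0.
  rewrite -EFinM /kern2; congr EFin.
  rewrite -(_ : w `^ (- g - 1) * w = w `^ (1 - g - 1))%R; first by ring.
  rewrite -[X in (_ * X)%R](powRr1 (ltW w0)) -powRD ?(gt_eqF w0) ?implybT//.
  by congr (_ `^ _)%R; ring.
apply: (@integral_indicr _ (measurableTypeR R) R leb R
    `]0%R, +oo[%classic `]0%R, 1%R[%classic `]0%R, 1%R[%classic id) => // r.
by rewrite /= !in_itv/= !andbT; split => [/andP[-> ->]|[]].
Qed.

(** The integrals over []0, w]] and []w, 1[] add up to 1, and the first is [w ^ c]. *)
Lemma integral_powR_between (c w : R) : (0 < c)%R -> (0 < w < 1)%R ->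
  \int[leb]_(z in `]w, 1%R[) (c * z `^ (c - 1))%:E = (1 - w `^ c)%:E.
Proof.
move=> c0 /andP[w0 w1].
have mf A : measurable_fun A (fun z : R => (c * z `^ (c - 1))%:E).
  by apply: measurable_funTS; meas.
have h : \int[leb]_(z in `]0%R, w]) (c * z `^ (c - 1))%:E +
    \int[leb]_(z in `]w, 1%R[) (c * z `^ (c - 1))%:E = 1.
  rewrite -ge0_integral_setU//; last 3 first.
  - exact: mf.
  - by move=> x _; pos.
  - apply/disj_setPRL => x /=; rewrite !in_itv/= => /andP[x1 _].
    by apply/negP; rewrite negb_and -ltNge x1 orbT.
  rewrite -(_ : (`]0%R, 1%R[%classic : set R) = `]0%R, w] `|` `]w, 1%R[).
    by rewrite integral_powR_lt// powR1.
  apply/seteqP; split => x /=; rewrite !in_itv/=.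
    by move=> /andP[-> ->]; rewrite !andbT/=; case: (leP x w) => ?; [left|right].
  by case=> /andP[x0 x1]; apply/andP; split => //;
    [exact: le_lt_trans w1|exact: lt_trans x0].
have e : \int[leb]_(z in `]0%R, w]) (c * z `^ (c - 1))%:E = (w `^ c)%:E.
  rewrite -integral_itv_bndo_bndc; last exact: mf.
  by rewrite integral_powR_lt.
move: h; rewrite e.
have : 0 <= \int[leb]_(z in `]w, 1%R[) (c * z `^ (c - 1))%:E by pos.
case: (\int[leb]_(z in `]w, 1%R[) _) => [r _||]//=.
by rewrite -EFinD => -[<-]; rewrite addrAC subrr add0r.
Qed.

Lemma kern1_integral (c w : R) : (0 < c)%R -> (0 < w)%R ->
  \int[leb]_(y in `]0%R, w[)
    (c * (1 - y) `^ (c - 1) * \1_(`]0%R, 1%R[%classic : set R) y)%:E = (kern1 c w)%:E.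
Proof.
move=> c0 w0.
rewrite ge0_integral_patch// -(integral_reflect 1); [|side..].
have [w1|w1] := ltP w 1%R.
  transitivity (\int[leb]_(z in `](1 - w)%R, 1%R[) (c * z `^ (c - 1))%:E).
    rewrite [RHS]ge0_integral_patch//; apply: eq_integral => z _.
    rewrite -!EFinM; congr EFin; rewrite -[LHS]mulrA subKr; congr (_ * _)%R.
    rewrite mulrC; apply: indic_mul; rewrite /= !in_itv/=; split.
      by move=> /andP[? ?]; split; apply/andP; split; lra.
    by move=> [/andP[? ?] /andP[? ?]]; apply/andP; split; lra.
  rewrite integral_powR_between//; last by rewrite subr_gt0 w1/= ltrBlDr ltrDl.
  by rewrite /kern1 indicE mem_set ?mul1r//= in_itv/= w0.
transitivity (\int[leb]_(z in `]0%R, 1%R[) (c * z `^ (c - 1))%:E).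
  rewrite [RHS]ge0_integral_patch//; apply: eq_integral => z _.
  rewrite -!EFinM; congr EFin; rewrite -[LHS]mulrA subKr; congr (_ * _)%R.
  rewrite mulrC; apply: indic_mul; rewrite /= !in_itv/=; split.
    by move=> /andP[? ?]; split; apply/andP; split; lra.
  by move=> [/andP[? ?] /andP[? ?]]; apply/andP; split; lra.
rewrite integral_powR_lt// powR1 /kern1 indicE memNset ?mul0r ?subr0//.
by rewrite /= in_itv/= => /andP[_]; rewrite ltNge w1.
Qed.

(** [kern1] is the primitive given by [kern1_integral], and the tail of [w ^ (- g - 1)] beyond [y]
    is [y ^ (- g) / g]. The result is [c / g] times the value in [integral_kern2]; the surplus
    [c / g - 1] is the source of the Hardy constant. *)
Lemma integral_kern1 (g c : R) : (0 < g)%R -> (0 < c)%R ->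
  \int[leb]_(w in `]0%R, +oo[) (w `^ (- g - 1) * kern1 c w)%:E =
  (c / g)%:E * beta_integral (1 - g) c.
Proof.
move=> g0 c0.
pose F (z : R * R) : \bar R := (z.1 `^ (- g - 1) *
  (c * (1 - z.2) `^ (c - 1) * \1_(`]0%R, 1%R[%classic : set R) z.2))%:E *
  (\1_(`]0%R, +oo[%classic : set R) (z.1 - z.2)%R)%:E.
have mF : measurable_fun setT F by rewrite /F; meas.
have F0 z : 0 <= F z by rewrite /F; pos.
transitivity (\int[leb]_(w in `]0%R, +oo[) \int[leb]_(y in `]0%R, +oo[) F (w, y)).
  apply: eq_integral => w; rewrite inE/= in_itv/= andbT => w0.
  rewrite /F/= integral_indic_lt EFinM -kern1_integral//.
  rewrite -ge0_integralkl; [|side..].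
  by apply: eq_integral => y _; rewrite -EFinM.
rewrite (tonelli_pos mF F0).
transitivity (\int[leb]_(y in `]0%R, +oo[) ((c / g * (y `^ (1 - g - 1) * (1 - y) `^ (c - 1)))%:E *
    (\1_(`]0%R, 1%R[%classic : set R) y)%:E)).
  apply: eq_integral => y; rewrite inE/= in_itv/= andbT => y0.
  rewrite /F/= integral_indic_gt ?ltW//.
  set z := (c * _ * _)%R.
  have z0 : (0 <= z)%R by rewrite /z; pos.
  transitivity (\int[leb]_(w in `]y, +oo[) ((z / g)%:E * (g * w `^ (- g - 1))%:E)).
    apply: eq_integral => w _; rewrite -EFinM; congr EFin.
    by rewrite [RHS]mulrA divfK ?gt_eqF// mulrC.
  rewrite ge0_integralkl; [|side..].
  rewrite integral_powR_gt// -!EFinM; congr EFin.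
  rewrite (_ : 1 - g - 1 = - g)%R; last by ring.
  by rewrite /z; ring.
transitivity (\int[leb]_(y in `]0%R, 1%R[) (c / g * (y `^ (1 - g - 1) * (1 - y) `^ (c - 1)))%:E).
  apply: (@integral_indicr _ (measurableTypeR R) R leb R
    `]0%R, +oo[%classic `]0%R, 1%R[%classic `]0%R, 1%R[%classic id) => // r.
  by rewrite /= !in_itv/= !andbT; split => [/andP[-> ->]|[]].
rewrite /beta_integral -ge0_integralkl; [|side..].
by apply: eq_integral => y _; rewrite -EFinM.
Qed.

Lemma integral_gauss s m : (0 < s)%R ->
  \int[leb]_x (expR (- (s * (x - m) ^+ 2)))%:E = ((pi / s) `^ 2^-1)%:E.
Proof.
move=> s0; have rs0 : (0 < Num.sqrt s)%R by rewrite sqrtr_gt0.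
have := @integralT_gauss R.
rewrite -(integral_affine (- (Num.sqrt s * m)) (lt0r_neq0 rs0)); last 2 first.
- by apply/measurable_EFinP; exact: measurable_gauss_fun.
- by move=> x; rewrite lee_fin gauss_fun_ge0.
rewrite gtr0_norm// => h.
have -> : ((pi / s) `^ 2^-1 = (Num.sqrt s)^-1 * Num.sqrt pi :> R)%R.
  rewrite powR12_sqrt ?divr_ge0 ?pi_ge0 ?ltW// sqrtrM ?pi_ge0//.
  by rewrite sqrtrV ?ltW// mulrC.
rewrite EFinM -h muleA -EFinM mulVf ?gt_eqF// mul1e.
apply: eq_integral => x _; congr EFin; rewrite /gauss_fun; congr expR.
by rewrite -mulrBr exprMn sqr_sqrtr ?ltW.
Qed.

(** Completing the square: the product is a Gaussian in [y] with parameter [s + t] and centre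
    [s x / (s + t)]. *)
Lemma integral_gauss_conv s t x : (0 < s)%R -> (0 < t)%R ->
  \int[leb]_y (expR (- (s * (x - y) ^+ 2)) * expR (- (t * y ^+ 2)))%:E =
  ((pi / (s + t)) `^ 2^-1 * expR (- (s * t / (s + t) * x ^+ 2)))%:E.
Proof.
move=> s0 t0; have st0 : (0 < s + t)%R by rewrite addr_gt0.
rewrite mulrC EFinM -(integral_gauss (s * x / (s + t))%R st0).
rewrite -ge0_integralkl; [|side..].
apply: eq_integral => y _; rewrite -EFinM -!expRD; congr (EFin (expR _)).
by field; rewrite gt_eqF.
Qed.

End gamma.

(** * Integration on R^d *)

Section euclidean.
Context {R : realType}.
Implicit Types d n : nat.

Lemma enorm_ge0 d (x : 'rV[R]_d) : 0 <= enorm x.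
Proof. exact: sqrtr_ge0. Qed.

Lemma sqr_enorm d (x : 'rV[R]_d) : enorm x ^+ 2 = \sum_(i < d) x ord0 i ^+ 2.
Proof. by rewrite sqr_sqrtr// sumr_ge0// => i _; exact: sqr_ge0. Qed.

Lemma enorm_eq0 d (x : 'rV[R]_d) : (enorm x == 0) = (x == 0).
Proof.
apply/idP/eqP => [|->]; last first.
  rewrite /enorm big1 ?sqrtr0// => i _.
  by rewrite mxE expr0n.
rewrite -sqrf_eq0 sqr_enorm psumr_eq0 => [/allP x0|i _]; last exact: sqr_ge0.
apply/rowP => i; rewrite mxE; apply/eqP; rewrite -sqrf_eq0.
by apply: x0; rewrite mem_index_enum.
Qed.

Lemma enorm_gt0 d (x : 'rV[R]_d) : (0 < enorm x) = (x != 0).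
Proof. by rewrite lt_neqAle enorm_ge0 andbT eq_sym enorm_eq0. Qed.

Lemma enormN d (x : 'rV[R]_d) : enorm (- x) = enorm x.
Proof.
by rewrite /enorm; congr Num.sqrt; apply: eq_bigr => i _; rewrite mxE sqrrN.
Qed.

Lemma enormB d (x y : 'rV[R]_d) : enorm (x - y) = enorm (y - x).
Proof. by rewrite -enormN opprB. Qed.

Lemma coord_le_norm d (x : 'rV[R]_d) i : `|x ord0 i| <= `|x|.
Proof.
rewrite [leRHS]/Num.Def.normr/= mx_normrE.
exact: (le_bigmax _ (fun ij => `|x ij.1 ij.2|) (ord0, i)).
Qed.

Lemma coord_le_enorm d (x : 'rV[R]_d) i : `|x ord0 i| <= enorm x.
Proof.
rewrite -ler_sqr ?nnegrE ?enorm_ge0// sqr_enorm real_normK ?num_real//.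
by rewrite (bigD1 i)//= lerDl sumr_ge0// => j _; exact: sqr_ge0.
Qed.

Lemma norm_le_enorm d (x : 'rV[R]_d) : `|x| <= enorm x.
Proof.
rewrite [leLHS]/Num.Def.normr/= mx_normrE bigmax_le ?enorm_ge0// => -[i j] _ /=.
by rewrite (ord1 i); exact: coord_le_enorm.
Qed.

Lemma enorm_le_norm d (x : 'rV[R]_d) : enorm x <= Num.sqrt d%:R * `|x|.
Proof.
rewrite -ler_sqr ?nnegrE ?mulr_ge0 ?sqrtr_ge0 ?enorm_ge0// sqr_enorm.
rewrite exprMn sqr_sqrtr// mulr_natl -[X in _ *+ X](card_ord d) -sumr_const.
apply: ler_sum => i _.
by rewrite -[leLHS]real_normK ?num_real// ler_sqr ?nnegrE// coord_le_norm.
Qed.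

End euclidean.

Section lebesgue_rV_integration.
Context {R : realType}.
Implicit Types d n : nat.
Local Open Scope ereal_scope.
Local Notation leb := (@lebesgue_measure R).
Local Notation mu := (@lebesgue_rV R _).

Lemma integral_rV0 (f : 'rV[R]_0 -> \bar R) :
  measurable_fun setT f -> \int[mu]_x f x = f 0%R.
Proof.
move=> mf; rewrite (eq_measure_integral (dirac (0%R : 'rV[R]_0)))//.
by rewrite integral_dirac// diracT mul1e.
Qed.

Lemma integral_rV_cons d (f : 'rV[R]_d.+1 -> \bar R) :
  measurable_fun setT f -> (forall x, 0 <= f x) ->
  \int[mu]_x f x = \int[leb]_t \int[mu]_x f (rV_cons (t, x)).
Proof.
move=> mf f0.
rewrite (integral_image (m1 := leb \x @lebesgue_rV R d)
  (@measurable_rV_cons R d) _ mf f0)//.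
rewrite (@fubini_tonelli1 _ _ (measurableTypeR R) 'rV[R]_d R leb (@lebesgue_rV R d)
  (fun z => f (rV_cons z)))//.
exact: measurableT_comp mf (@measurable_rV_cons R d).
Qed.

Lemma rV_consD d t u (x y : 'rV[R]_d) :
  rV_cons (t + u, x + y)%R = (rV_cons (t, x) + rV_cons (u, y))%R.
Proof. by apply/rowP => i; rewrite !mxE; case: unliftP => [j|] _ //=; rewrite mxE. Qed.

Lemma measurable_cons_section d (f : 'rV[R]_d.+1 -> \bar R) t :
  measurable_fun setT f -> measurable_fun setT (fun x => f (rV_cons (t, x))).
Proof.
move=> mf; apply: measurableT_comp mf _.
by apply: measurableT_comp (@measurable_rV_cons R d) _; exact: measurable_pair1.
Qed.

Lemma measurable_integral_cons d (f : 'rV[R]_d.+1 -> \bar R) :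
  measurable_fun setT f -> (forall x, 0 <= f x) ->
  measurable_fun setT (fun t : R => \int[mu]_x f (rV_cons (t, x))).
Proof.
move=> mf f0.
apply: (@measurable_integral1 _ _ (measurableTypeR R) 'rV[R]_d R
  (@lebesgue_rV R d) setT (fun z => f (rV_cons z))) => //.
exact: measurableT_comp mf (@measurable_rV_cons R d).
Qed.

Lemma integral_rV_translate d (h : 'rV[R]_d) (f : 'rV[R]_d -> \bar R) :
  measurable_fun setT f -> (forall x, 0 <= f x) ->
  \int[mu]_x f (x + h)%R = \int[mu]_x f x.
Proof.
elim: d h f => [|d IHd] h f mf f0.
  by apply: eq_integral => x _; congr f; apply/rowP => -[].
have mfh : measurable_fun setT (fun x : 'rV[R]_d.+1 => f (x + h)%R).
  by apply: measurableT_comp mf _; meas.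
rewrite (integral_rV_cons mfh (fun x => f0 _)) (integral_rV_cons mf f0).
rewrite -[RHS](integral_translate (rV_uncons h).1); last 2 first.
- exact: measurable_integral_cons.
- by move=> t; exact: integral_ge0.
apply: eq_integral => t _.
rewrite -[RHS](IHd (rV_uncons h).2); last 2 first.
- exact: measurable_cons_section.
- by [].
by apply: eq_integral => x _; rewrite rV_consD -surjective_pairing rV_unconsK.
Qed.

Lemma integral_rV_prod d (g : 'I_d -> R -> R) (c : 'I_d -> R) :
  (forall i, measurable_fun setT (g i)) -> (forall i t, 0 <= g i t)%R ->
  (forall i, \int[leb]_t (g i t)%:E = (c i)%:E) ->
  \int[mu]_x (\prod_(i < d) g i (x ord0 i))%:E = (\prod_(i < d) c i)%:E.
Proof.
elim: d g c => [|d IHd] g c mg g0 gc.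
  rewrite integral_rV0 ?big_ord0//.
  by under eq_fun do rewrite big_ord0; exact: measurable_cst.
have mgp n (g' : 'I_n -> R -> R) : (forall i, measurable_fun setT (g' i)) ->
    measurable_fun setT (fun x : 'rV[R]_n => (\prod_(i < n) g' i (x ord0 i))%:E).
  move=> mg'; apply/measurable_EFinP; apply: measurable_prod => i _.
  by apply: measurableT_comp (mg' i) _; exact: measurable_rV_coord.
rewrite integral_rV_cons//; last 2 first.
- exact: mgp.
- by move=> x; rewrite lee_fin prodr_ge0.
rewrite big_ord_recl EFinM -gc.
have c0 : (0 <= \prod_(i < d) c (lift ord0 i))%R.
  by rewrite prodr_ge0// => i _; rewrite -lee_fin -gc integral_ge0// => t _; rewrite lee_fin.
rewrite -ge0_integralkr//; last 2 first.
- by apply/measurable_EFinP; exact: mg.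
- by move=> t; rewrite lee_fin; exact: g0.
apply: eq_integral => t _.
rewrite -(IHd (fun i => g (lift ord0 i)))//.
rewrite -ge0_integralkl//; last 3 first.
- by apply: (mgp _ (fun i => g (lift ord0 i))) => i; exact: mg.
- by move=> x; rewrite lee_fin prodr_ge0.
- by rewrite lee_fin; exact: g0.
apply: eq_integral => x _; rewrite -EFinM big_ord_recl mxE unlift_none/=.
by congr (_ * _)%:E; apply: eq_bigr => i _; rewrite mxE liftK.
Qed.

Lemma expR_sqr_enorm d (s : R) (x : 'rV[R]_d) :
  expR (- (s * enorm x ^+ 2)) = (\prod_(i < d) expR (- (s * x ord0 i ^+ 2)))%R.
Proof. by rewrite sqr_enorm mulr_sumr -sumrN expR_sum. Qed.

Lemma integral_rV_gauss d (s : R) (x : 'rV[R]_d) : (0 < s)%R ->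
  \int[mu]_y (expR (- (s * enorm (x - y)%R ^+ 2)))%:E = ((pi / s) `^ (d%:R / 2))%:E.
Proof.
move=> s0.
rewrite (_ : (pi / s) `^ (d%:R / 2) = \prod_(i < d) (pi / s) `^ 2^-1)%R; last first.
  by rewrite prodr_const card_ord (mulrC d%:R) powRrM powR_mulrn// powR_ge0.
rewrite -(integral_rV_prod (g := fun i t => expR (- (s * (t - x ord0 i) ^+ 2))%R))//.
- apply: eq_integral => y _; rewrite enormB expR_sqr_enorm.
  by congr EFin; apply: eq_bigr => i _; rewrite !mxE.
- by move=> i; meas.
- by move=> i; exact: integral_gauss.
Qed.

Lemma integral_rV_gauss_conv d (s t : R) (x : 'rV[R]_d) : (0 < s)%R -> (0 < t)%R ->
  \int[mu]_y (expR (- (s * enorm (x - y)%R ^+ 2)) * expR (- (t * enorm y ^+ 2)))%:E =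
  ((pi / (s + t)) `^ (d%:R / 2) * expR (- (s * t / (s + t) * enorm x ^+ 2)))%:E.
Proof.
move=> s0 t0.
rewrite expR_sqr_enorm.
rewrite (_ : (pi / (s + t)) `^ (d%:R / 2) = \prod_(i < d) (pi / (s + t)) `^ 2^-1)%R; last first.
  by rewrite prodr_const card_ord (mulrC d%:R) powRrM powR_mulrn// powR_ge0.
rewrite -big_split/= -(integral_rV_prod (g := fun i u =>
  expR (- (s * (x ord0 i - u) ^+ 2)) * expR (- (t * u ^+ 2)))%R)//.
- apply: eq_integral => y _; rewrite !expR_sqr_enorm -big_split/=.
  by congr EFin; apply: eq_bigr => i _; rewrite !mxE.
- by move=> i; meas.
- by move=> i; exact: integral_gauss_conv.
Qed.

Lemma lebesgue_rV_set0 d : (0 < d)%N -> mu [set (0%R : 'rV[R]_d)] = 0.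
Proof.
case: d => // d _.
rewrite (_ : [set (0%R : 'rV[R]_d.+1)] =
    [set x | forall i, [set (0%R : R)] (x ord0 i)]); last first.
  apply/seteqP; split => x /=; first by move=> -> i; rewrite mxE.
  by move=> x0; apply/rowP => i; rewrite x0 mxE.
transitivity (\prod_(i < d.+1) leb [set (0%R : R)]).
  exact: (@lebesgue_rV_box R d.+1 (fun=> [set (0%R : R)])).
by rewrite big_ord_recl lebesgue_measure_set1 mul0e.
Qed.

Lemma measurable_rV_set0 d : measurable [set (0%R : 'rV[R]_d)].
Proof.
rewrite (_ : [set (0%R : 'rV[R]_d)] =
    (fun x : 'rV[R]_d => `|x|%R) @^-1` [set (0%R : R)]).
  rewrite -[X in measurable X]setTI.
  have mn : measurable_fun setT (fun x : 'rV[R]_d => `|x|%R) by meas.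
  exact: mn.
by apply/seteqP; split => x /=; [move=> ->; rewrite normr0|move/normr0_eq0].
Qed.

(** Negative powers of [enorm] are 0 at the origin by default, so the Gamma formulas for them fail
    there. This lemma discards the origin, a null set. *)
Lemma eq_integral_rV_neq0 d (f g : 'rV[R]_d -> \bar R) : (0 < d)%N ->
  measurable_fun setT f -> measurable_fun setT g ->
  (forall x, 0 <= f x) -> (forall x, 0 <= g x) ->
  (forall x, x != 0%R -> f x = g x) -> \int[mu]_x f x = \int[mu]_x g x.
Proof.
move=> d0 mf mg f0 g0 fg; apply: ge0_ae_eq_integral => //.
exists [set 0%R]; split; [exact: measurable_rV_set0|exact: lebesgue_rV_set0|].
move=> x /= xfg; apply: contrapT => /eqP x0; apply: xfg => _; exact: fg.
Qed.

Lemma enorm_powR_gamma d (p : R) (x : 'rV[R]_d) : (0 < p)%R -> x != 0%R ->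
  \int[leb]_(t in `]0%R, +oo[) (t `^ (p / 2 - 1) * expR (- (t * enorm x ^+ 2)))%:E =
  (Gamma (p / 2) * enorm x `^ (- p))%:E.
Proof.
move=> p0 x0; have nx0 : (0 < enorm x)%R by rewrite enorm_gt0.
rewrite gamma_integral_scale ?exprn_gt0// ?divr_gt0//.
rewrite -powR_mulrn ?(ltW nx0)// -powRrM.
by congr (_ * _ `^ _)%:E; field.
Qed.

Lemma tonelli_pos_rV d (F : R * 'rV[R]_d -> \bar R) :
  measurable_fun setT F -> (forall z, 0 <= F z) ->
  \int[leb]_(s in `]0%R, +oo[) \int[mu]_x F (s, x) =
  \int[mu]_x \int[leb]_(s in `]0%R, +oo[) F (s, x).
Proof.
move=> mF F0; exact: (@tonelli_on _ _ (measurableTypeR R) 'rV[R]_d R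
  leb (@lebesgue_rV R d) `]0%R, +oo[%classic setT F).
Qed.

Lemma tonelli_rV d n (F : 'rV[R]_d * 'rV[R]_n -> \bar R) :
  measurable_fun setT F -> (forall z, 0 <= F z) ->
  \int[mu]_x \int[mu]_y F (x, y) = \int[mu]_y \int[mu]_x F (x, y).
Proof.
move=> mF F0; exact: (@tonelli_on _ _ 'rV[R]_d 'rV[R]_n R
  (@lebesgue_rV R d) (@lebesgue_rV R n) setT setT F).
Qed.

End lebesgue_rV_integration.

(** * Gaussian and power integrals *)

Section powR_extra.
Context {R : realType}.
Implicit Types x y r s : R.

Lemma gt0_powRD x r s : 0 < x -> x `^ (r + s) = x `^ r * x `^ s.
Proof. by move=> x0; rewrite powRD// (gt_eqF x0) implybT. Qed.

Lemma powRV x r : 0 <= x -> x^-1 `^ r = x `^ (- r).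
Proof. by move=> x0; rewrite -powR_inv1// -powRrM mulN1r. Qed.

Lemma powR_div x y r : 0 <= x -> 0 <= y -> (x / y) `^ r = x `^ r * y `^ (- r).
Proof. by move=> x0 y0; rewrite powRM ?invr_ge0// powRV. Qed.

End powR_extra.

Lemma lee_cancel_mul (R : realFieldType) (c K : R) (x : \bar R) :
  0 < c -> (c%:E * x <= K%:E -> x <= (c^-1 * K)%:E)%E.
Proof. by move=> c0 h; rewrite EFinM lee_pdivlMl. Qed.

Lemma lebesgue_measure_setT (R : realType) : lebesgue_measure [set: R] = +oo%E.
Proof. by rewrite -set_itvNyy lebesgue_measure_itv. Qed.

Section power_estimates.
Context {R : realType}.
Implicit Types d n : nat.
Local Open Scope ereal_scope.
#[local] Opaque Gamma.
Local Notation leb := (@lebesgue_measure R).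
Local Notation mu := (@lebesgue_rV R _).

Lemma measurable_integral_pos_rV d (F : R * 'rV[R]_d -> \bar R) :
  measurable_fun setT F -> (forall z, 0 <= F z) ->
  measurable_fun setT (fun x => \int[leb]_(t in `]0%R, +oo[) F (t, x)).
Proof.
move=> mF F0; exact: (@measurable_integral2 _ _ (measurableTypeR R) 'rV[R]_d R
  leb `]0%R, +oo[%classic F).
Qed.

Lemma measurable_integral_rV d (d' : measure_display) (T : measurableType d')
    (F : T * 'rV[R]_d -> \bar R) :
  measurable_fun setT F -> (forall z, 0 <= F z) ->
  measurable_fun setT (fun t => \int[mu]_x F (t, x)).
Proof.
move=> mF F0; exact: (@measurable_integral1 _ _ T 'rV[R]_d R mu setT F).
Qed.

Lemma integral_split_le (s : R) (f f1 f2 : R -> \bar R) : (0 < s)%R ->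
  measurable_fun setT f -> measurable_fun setT f1 -> measurable_fun setT f2 ->
  (forall t, 0 <= f t) ->
  (forall t, (0 < t < s)%R -> f t <= f1 t) -> (forall t, (s < t)%R -> f t <= f2 t) ->
  \int[leb]_(t in `]0%R, +oo[) f t <=
  \int[leb]_(t in `]0%R, s[) f1 t + \int[leb]_(t in `]s, +oo[) f2 t.
Proof.
move=> s0 mf mf1 mf2 f0 ff1 ff2.
have -> : (`]0%R, +oo[%classic : set R) = `]0%R, s] `|` `]s, +oo[.
  apply/seteqP; split => x /=; rewrite !in_itv/= !andbT.
    by move=> x0; rewrite x0/=; case: (leP x s) => ?; [left|right].
  by case=> [/andP[]//|]; exact: lt_trans.
rewrite ge0_integral_setU//; last 2 first.
- exact: measurable_funTS.
- apply/disj_setPRL => x /=; rewrite !in_itv/= andbT => x1.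
  by apply/negP; rewrite negb_and -ltNge x1 orbT.
apply: leeD.
  rewrite -integral_itv_bndo_bndc; last exact: measurable_funTS.
  apply: ge0_le_integral => //; try exact: measurable_funTS.
apply: ge0_le_integral => //; try exact: measurable_funTS.
by move=> t; rewrite /= in_itv/= andbT => /ff2.
Qed.

Lemma integral_rV_gauss0 d (s : R) : (0 < s)%R ->
  \int[mu]_(y in [set: 'rV[R]_d]) (expR (- (s * enorm y ^+ 2)))%:E =
  ((pi / s) `^ (d%:R / 2))%:E.
Proof.
move=> s0; rewrite -(integral_rV_gauss (0%R : 'rV[R]_d) s0).
by apply: eq_integral => y _; rewrite sub0r enormN.
Qed.

(** Takes the place of polar coordinates: the power is a superposition of Gaussians, each of which
    has an explicit integral. The case [s = 0] is included because the divergence in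
    [integral_power_dim] uses it. *)
Lemma integral_power_gauss d (p s : R) : (0 < d)%N -> (0 < p)%R -> (0 <= s)%R ->
  (Gamma (p / 2))%:E *
  \int[mu]_(x in [set: 'rV[R]_d])
      (enorm x `^ (- p) * expR (- (s * enorm x ^+ 2)))%:E =
  \int[leb]_(t in `]0%R, +oo[) (t `^ (p / 2 - 1) * (pi / (s + t)) `^ (d%:R / 2))%:E.
Proof.
move=> d0 p0 s0; have p20 : (0 < p / 2)%R by rewrite divr_gt0.
have G0 := Gamma_gt0 p20.
pose F (z : R * 'rV[R]_d) : \bar R := (z.1 `^ (p / 2 - 1) *
  expR (- (z.1 * enorm z.2 ^+ 2)) * expR (- (s * enorm z.2 ^+ 2)))%:E.
have mF : measurable_fun setT F by rewrite /F; meas.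
have F0 z : 0 <= F z by rewrite /F; pos.
rewrite -ge0_integralkl; [|side..].
transitivity (\int[mu]_x \int[leb]_(t in `]0%R, +oo[) F (t, x)).
  apply: eq_integral_rV_neq0 => //.
  - by meas.
  - exact: measurable_integral_pos_rV.
  - by move=> x; pos.
  - by move=> x; exact: integral_ge0.
  move=> x x0; rewrite -EFinM mulrA EFinM -enorm_powR_gamma//.
  rewrite -ge0_integralkr; [|side..].
  by apply: eq_integral => t _.
rewrite -tonelli_pos_rV//; apply: eq_integral => t.
rewrite inE/= in_itv/= andbT => t0.
rewrite EFinM -integral_rV_gauss0 ?ltr_wpDl// -ge0_integralkl; [|side..].
apply: eq_integral => x _; rewrite /F/= -EFinM -mulrA -expRD; congr (EFin (_ * expR _)%R).
by ring.
Qed.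

(** In the integral of [integral_power_gauss], [s + t] is bounded below by [s] for [t < s] and by
    [t] for [t > s]; both pieces then scale like [s ^ (- (d - p) / 2)]. *)
Lemma integral_power_gauss_le d (p : R) : (0 < d)%N -> (0 < p)%R -> (p < d%:R)%R ->
  exists2 C : R, (0 <= C)%R & forall s : R, (0 < s)%R ->
    \int[mu]_(x in [set: 'rV[R]_d])
      (enorm x `^ (- p) * expR (- (s * enorm x ^+ 2)))%:E <=
    (C * s `^ (- ((d%:R - p) / 2)))%:E.
Proof.
move=> d0 p0 pd; have p20 : (0 < p / 2)%R by rewrite divr_gt0.
pose e := ((d%:R - p) / 2)%R.
have e0 : (0 < e)%R by rewrite divr_gt0 ?subr_gt0.
have G0 := Gamma_gt0 p20.
exists ((Gamma (p / 2))^-1 * (pi `^ (d%:R / 2) * (2 / p + e^-1)))%R.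
  by have := @pi_ge0 R; move=> ?; pos.
move=> s s0; rewrite -mulrA; apply: lee_cancel_mul => //.
rewrite integral_power_gauss// ?(ltW s0)//.
pose f1 t : \bar R := ((pi / s) `^ (d%:R / 2) * (2 / p))%:E * (p / 2 * t `^ (p / 2 - 1))%:E.
pose f2 t : \bar R := (pi `^ (d%:R / 2) * e^-1)%:E * (e * t `^ (- e - 1))%:E.
have pi0 := @pi_ge0 R.
have mono (r t : R) : (0 < r)%R -> (r <= t)%R -> ((pi / t) `^ (d%:R / 2) <= (pi / r) `^ (d%:R / 2))%R.
  move=> r0 rt; have t0 := lt_le_trans r0 rt.
  rewrite ge0_ler_powR ?nnegrE ?divr_ge0 ?(ltW r0) ?(ltW t0)//.
  by rewrite ler_wpM2l// lef_pV2 ?posrE.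
have le12 := @integral_split_le s
  (fun t => (t `^ (p / 2 - 1) * (pi / (s + t)) `^ (d%:R / 2))%:E) f1 f2 s0.
apply: (le_trans (le12 _ _ _ _ _ _)).
- by meas.
- by rewrite /f1; meas.
- by rewrite /f2; meas.
- by move=> t; pos.
- move=> t /andP[t0 ts]; rewrite /f1 -EFinM lee_fin.
  rewrite (_ : (_ * (2 / p) * _)%R = (t `^ (p / 2 - 1) * (pi / s) `^ (d%:R / 2))%R); last first.
    by field; exact: lt0r_neq0.
  by rewrite ler_wpM2l ?powR_ge0// mono// lerDl ltW.
- move=> t st; have t0 := lt_trans s0 st; rewrite /f2 -EFinM lee_fin.
  apply: (@le_trans _ _ (t `^ (p / 2 - 1) * (pi / t) `^ (d%:R / 2))%R).
    by rewrite ler_wpM2l ?powR_ge0// mono// lerDr ltW.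
  rewrite powR_div ?(ltW t0)// mulrCA -gt0_powRD// mulrA divfK ?gt_eqF//.
  by rewrite le_eqVlt (_ : p / 2 - 1 + - (d%:R / 2) = - e - 1)%R ?eqxx// /e; field.
rewrite /f1 /f2 ge0_integralkl; [|side..].
rewrite ge0_integralkl; [|side..].
rewrite integral_powR_lt// integral_powR_gt// -!EFinM -EFinD lee_fin.
rewrite powR_div ?(ltW s0)//.
rewrite (_ : pi `^ (d%:R / 2) * s `^ (- (d%:R / 2)) * (2 / p) * s `^ (p / 2) =
  pi `^ (d%:R / 2) * (2 / p) * s `^ (- e))%R; last first.
  rewrite (_ : - e = - (d%:R / 2) + p / 2)%R; last by rewrite /e; field.
  by rewrite gt0_powRD//; ring.
by rewrite le_eqVlt; apply/orP; left; apply/eqP; rewrite -/e; ring.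
Qed.

(** For [p = d] and [s = 0] the one-dimensional integrand is a multiple of [1 / t], which becomes a
    constant on the whole line in the coordinate [ln t]. *)
Lemma integral_power_dim d : (0 < d)%N ->
  \int[mu]_(x in [set: 'rV[R]_d]) (enorm x `^ (- d%:R))%:E = +oo.
Proof.
move=> d0; have dR : (0 < d%:R :> R)%R by rewrite ltr0n.
have G0 := Gamma_gt0 (divr_gt0 dR (ltr0Sn R 1)).
have := @integral_power_gauss d d%:R 0%R d0 dR (lexx _).
rewrite (_ : \int[mu]_(x in _) _ =
    \int[mu]_(x in [set: 'rV[R]_d]) (enorm x `^ (- d%:R))%:E); last first.
  by apply: eq_integral => x _; rewrite mul0r oppr0 expR0 mulr1.
have -> : \int[leb]_(t in `]0%R, +oo[)
    (t `^ (d%:R / 2 - 1) * (pi / (0 + t)) `^ (d%:R / 2))%:E = +oo.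
  transitivity (\int[leb]_(t in `]0%R, +oo[) (pi `^ (d%:R / 2) * t `^ (- 1))%:E).
    apply: eq_integral => t; rewrite inE/= in_itv/= andbT => t0.
    rewrite add0r powR_div ?pi_ge0 ?(ltW t0)// mulrCA -gt0_powRD//.
    by congr (_ * _ `^ _)%:E; ring.
  rewrite integral_expR_subst; last 2 first.
  - by meas.
  - by move=> t; pos.
  rewrite (eq_integral (fun=> (pi `^ (d%:R / 2))%:E)); last first.
    move=> x _; rewrite -EFinM powR_inv1 ?expR_ge0// -mulrA mulVf ?mulr1//.
    by rewrite gt_eqF// expR_gt0.
  transitivity ((pi `^ (d%:R / 2))%:E * leb [set: R]); first exact: integral_cst.
  rewrite lebesgue_measure_setT.
  by rewrite gt0_muley// lte_fin powR_gt0// pi_gt0.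
have : 0 <= \int[mu]_(x in [set: 'rV[R]_d]) (enorm x `^ (- d%:R))%:E by pos.
by case: (\int[mu]_(x in _) _) => // r _; rewrite -EFinM.
Qed.

(* The kernel [(1 - exp (- l |z|^2)) |z|^(-2q)] is comparable to [min (1, l |z|^2) |z|^(-2q)]. *)
Lemma integral_levy_le d (q : R) : (0 < d)%N ->
  (d%:R / 2 < q)%R -> (q < d%:R / 2 + 1)%R ->
  exists2 C : R, (0 <= C)%R & forall (l : R) (x : 'rV[R]_d), (0 < l)%R ->
    \int[mu]_y ((1 - expR (- (l * enorm (x - y)%R ^+ 2))) *
                enorm (x - y)%R `^ (- (2 * q)))%:E <= (C * l `^ (q - d%:R / 2))%:E.
Proof.
move=> d0 dq qd.
have dR : (0 < d%:R :> R)%R by rewrite ltr0n.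
have q0 : (0 < q)%R by rewrite (lt_trans _ dq)// divr_gt0.
have G0 := Gamma_gt0 q0; have pi0 := @pi_ge0 R.
pose g := (q - d%:R / 2)%R.
have g0 : (0 < g)%R by rewrite subr_gt0.
have g1 : (0 < 1 - g)%R by rewrite subr_gt0 ltrBlDl.
exists ((Gamma q)^-1 * (pi `^ (d%:R / 2) * (g^-1 + d%:R / (1 - g))))%R.
  by pos.
move=> l x l0; rewrite -mulrA; apply: lee_cancel_mul => //.
pose k (y : 'rV[R]_d) : R := (1 - expR (- (l * enorm (x - y) ^+ 2)))%R.
rewrite (eq_integral (fun y => (k y * enorm (x - y) `^ (- (2 * q)))%:E)); last by [].
have k0 y : (0 <= k y)%R.
  by rewrite subr_ge0 -expR0 ler_expR oppr_le0 mulr_ge0 ?sqr_ge0// ltW.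
have mk : measurable_fun setT k by rewrite /k; meas.
pose F (z : R * 'rV[R]_d) : \bar R :=
  (z.1 `^ (q - 1) * expR (- (z.1 * enorm (x - z.2) ^+ 2)) * k z.2)%:E.
have mF : measurable_fun setT F by rewrite /F; meas.
have F0 z : 0 <= F z by rewrite /F; pos.
rewrite -ge0_integralkl; [|side..].
rewrite (_ : \int[mu]_x0 _ = \int[mu]_y \int[leb]_(t in `]0%R, +oo[) F (t, y)); last first.
  apply: eq_integral => y _; have [<-|xy] := eqVneq x y.
    rewrite subrr (_ : enorm 0 = 0)%R; last by apply/eqP; rewrite enorm_eq0.
    have kx : k x = 0%R.
      rewrite /k subrr (_ : enorm 0 = 0)%R; last by apply/eqP; rewrite enorm_eq0.
      by rewrite expr0n mulr0 oppr0 expR0 subrr.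
    rewrite kx mul0r mule0 integral0_eq// => t _.
    by rewrite /F/= kx mulr0.
  rewrite mulrC EFinM muleA -EFinM.
  have qE : (2 * q / 2 = q)%R by field.
  rewrite EFinM -[X in Gamma X]qE -enorm_powR_gamma ?subr_eq0 ?mulr_gt0//.
  rewrite -ge0_integralkr; [|side..].
  apply: eq_integral => t _; rewrite /F/= -EFinM.
  by rewrite qE.
rewrite -tonelli_pos_rV//.
pose f1 t : \bar R := (pi `^ (d%:R / 2) / g)%:E * (g * t `^ (g - 1))%:E.
pose f2 t : \bar R := (pi `^ (d%:R / 2) * (d%:R * l) / (1 - g))%:E *
  ((1 - g) * t `^ (- (1 - g) - 1))%:E.
(* The factor [1 - exp (- l |x - y|^2)] turns the Gaussian mass at [t] into the difference of the
   masses at [t] and [t + l]. The identity is first proved as a sum and subtracted once everything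
   is known to be finite. *)
have FE t : (0 < t)%R -> \int[mu]_y F (t, y) =
    (t `^ (q - 1) * ((pi / t) `^ (d%:R / 2) - (pi / (t + l)) `^ (d%:R / 2)))%:E.
  move=> t0; have tl0 : (0 < t + l)%R by rewrite addr_gt0.
  have : \int[mu]_y (expR (- (t * enorm (x - y)%R ^+ 2)) * k y)%:E +
      ((pi / (t + l)) `^ (d%:R / 2))%:E = ((pi / t) `^ (d%:R / 2))%:E.
    rewrite -(integral_rV_gauss x t0) -(integral_rV_gauss x tl0).
    rewrite -ge0_integralD//; [|side..].
    apply: eq_integral => y _; rewrite -EFinD; congr EFin.
    by rewrite /k mulrBr mulr1 -expRD mulrDl opprD subrK.
  have : 0 <= \int[mu]_y (expR (- (t * enorm (x - y)%R ^+ 2)) * k y)%:E.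
    by pos.
  rewrite (_ : \int[mu]_y F (t, y) = (t `^ (q - 1))%:E *
    \int[mu]_y (expR (- (t * enorm (x - y)%R ^+ 2)) * k y)%:E).
    case: (\int[mu]_y (expR _ * _)%:E) => // r _.
    by rewrite -EFinD => -[<-]; rewrite addrK -EFinM.
  rewrite -ge0_integralkl; [|side..].
  apply: eq_integral => y _; rewrite -EFinM mulrA.
  by [].

(* [integral_split_le] asks for an integrand that is nonnegative everywhere; the absolute value
   ensures this outside [t > 0] as well. *)
pose f t : \bar R :=
  (t `^ (q - 1) * `|(pi / t) `^ (d%:R / 2) - (pi / (t + l)) `^ (d%:R / 2)|)%:E.
have diff_le t : (0 < t)%R -> (0 <= (pi / t) `^ (d%:R / 2) - (pi / (t + l)) `^ (d%:R / 2) <=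
    pi `^ (d%:R / 2) * t `^ (- (d%:R / 2)) * Num.min 1 (d%:R * l / t))%R.
  move=> t0; have tl0 : (0 < t + l)%R by rewrite addr_gt0.
  (* With this [u] the ratio of the two masses is [u ^ d], and [1 - u ^ d <= d (1 - u) <= d (1 - u ^
     2) = d l / (t + l)]. *)
  pose u := Num.sqrt (t / (t + l))%R.
  have u01 : (0 <= u <= 1)%R.
    rewrite sqrtr_ge0/= -sqrtr1 ler_wsqrtr// ler_pdivrMr// mul1r lerDl ltW//.
  have -> : ((pi / (t + l)) `^ (d%:R / 2) = pi `^ (d%:R / 2) * t `^ (- (d%:R / 2)) * u ^+ d)%R.
    rewrite powR_div ?(ltW tl0)// -mulrA; congr (_ * _)%R.
    rewrite /u -powR12_sqrt ?divr_ge0 ?ltW// -powR_mulrn ?powR_ge0// -powRrM.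
    rewrite (mulrC 2^-1%R) powR_div ?(ltW t0) ?(ltW tl0)// mulrA -gt0_powRD//.
    by rewrite addNr powRr0 mul1r.
  rewrite powR_div ?(ltW t0)// -[X in (0 <= X - _ <= _)%R]mulr1 -mulrBr.
  have ud1 : (u ^+ d <= 1)%R by case/andP: u01 => *; rewrite exprn_ile1.
  apply/andP; split; first by rewrite mulr_ge0 ?subr_ge0// mulr_ge0 ?powR_ge0.
  apply: ler_wpM2l; first by pos.
  rewrite le_min; apply/andP; split.
    by rewrite gerBl exprn_ge0//; case/andP: u01.
  apply: (@le_trans _ _ (d%:R * (1 - u))%R).
    rewrite -[X in (X - _)%R](expr1n _ d) subrXX.
    rewrite mulrC ler_wpM2r// ?subr_ge0; first by case/andP: u01.
    rewrite -[X in (_ <= X%:R)%R](card_ord d) -sumr_const.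
    apply: ler_sum => i _; rewrite expr1n mul1r.
    by case/andP: u01 => *; rewrite exprn_ile1.
  rewrite -mulrA ler_wpM2l//.
  apply: (@le_trans _ _ (1 - u ^+ 2)%R).
    by case/andP: u01 => u0 u1; rewrite lerD2l lerN2 expr2 ler_piMl.
  rewrite sqr_sqrtr ?divr_ge0 ?(ltW t0) ?(ltW tl0)//.
  rewrite (_ : 1 - t / (t + l) = l / (t + l))%R; last by field; exact: lt0r_neq0.
  by rewrite ler_wpM2l ?(ltW l0)// lef_pV2 ?posrE// lerDl ltW.
rewrite (_ : \int[leb]_(t in _) _ = \int[leb]_(t in `]0%R, +oo[) f t); last first.
  apply: eq_integral => t; rewrite inE/= in_itv/= andbT => t0; rewrite FE// /f ger0_norm//.
  by case/andP: (diff_le _ t0).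
have mf : measurable_fun setT f by rewrite /f; meas.
have le12 := @integral_split_le l f f1 f2 l0 mf.
apply: (le_trans (le12 _ _ _ _ _)).
- by rewrite /f1; meas.
- by rewrite /f2; meas.
- by move=> t; rewrite /f lee_fin mulr_ge0 ?powR_ge0.
- move=> t /andP[t0 tl]; rewrite /f /f1 -EFinM lee_fin.
  have /andP[df0 dfle] := diff_le _ t0; rewrite ger0_norm//.
  apply: (le_trans (ler_wpM2l (powR_ge0 _ _) dfle)).
  apply: (@le_trans _ _ (t `^ (q - 1) * (pi `^ (d%:R / 2) * t `^ (- (d%:R / 2)))))%R.
    apply: ler_wpM2l; first by pos.
    by apply: ler_piMr; [pos|rewrite ge_min lexx].
  rewrite mulrCA -gt0_powRD// mulrA divfK ?gt_eqF//.
  by rewrite le_eqVlt (_ : q - 1 + - (d%:R / 2) = g - 1)%R ?eqxx// /g; ring.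
- move=> t lt; have t0 := lt_trans l0 lt; rewrite /f /f2 -EFinM lee_fin.
  have /andP[df0 dfle] := diff_le _ t0; rewrite ger0_norm//.
  apply: (le_trans (ler_wpM2l (powR_ge0 _ _) dfle)).
  apply: (@le_trans _ _ (t `^ (q - 1) * (pi `^ (d%:R / 2) * t `^ (- (d%:R / 2)) * (d%:R * l / t))))%R.
    apply: ler_wpM2l; first by pos.
    by apply: ler_wpM2l; [pos|rewrite ge_min lexx orbT].
  rewrite -[(t^-1)%R]powR_inv1 ?(ltW t0)// [leRHS]mulrA divfK ?gt_eqF//.
  rewrite (_ : - (1 - g) - 1 = q - 1 + - (d%:R / 2) + - 1)%R; last by rewrite /g; ring.
  by rewrite !gt0_powRD// le_eqVlt; apply/orP; left; apply/eqP; ring.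
rewrite /f1 /f2 ge0_integralkl; [|side..].
rewrite ge0_integralkl; [|side..].
rewrite integral_powR_lt// integral_powR_gt// -!EFinM -EFinD lee_fin.
rewrite (_ : - (1 - g) = g + - 1)%R; last by ring.
rewrite gt0_powRD// powR_inv1 ?(ltW l0)// le_eqVlt; apply/orP; left; apply/eqP.
by rewrite -/g; field; rewrite !gt_eqF.
Qed.

(** The decaying factor is itself a Gamma integral of Gaussians with parameter [t s], so the bound
    reduces to [integral_power_gauss_le]. The remaining integral in [t] is [Gamma (q - e)], where
    [e = (d - p) / 2]. *)
Lemma integral_power_decay_le d (p q : R) : (0 < d)%N -> (0 < p)%R -> (p < d%:R)%R ->
  ((d%:R - p) / 2 < q)%R ->
  exists2 C : R, (0 <= C)%R & forall s : R, (0 < s)%R ->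
    \int[mu]_(x in [set: 'rV[R]_d])
      (enorm x `^ (- p) * (1 + s * enorm x ^+ 2) `^ (- q))%:E <=
    (C * s `^ (- ((d%:R - p) / 2)))%:E.
Proof.
move=> d0 p0 pd eq; pose e : R := ((d%:R - p) / 2)%R.
rewrite -/e in eq *.
have e0 : (0 < e)%R by rewrite divr_gt0 ?subr_gt0.
have q0 : (0 < q)%R by exact: lt_trans eq.
have qe0 : (0 < q - e)%R by rewrite subr_gt0.
have G0 := Gamma_gt0 q0; have G1 := Gamma_gt0 qe0.
have [C C0 hC] := integral_power_gauss_le d0 p0 pd.
rewrite -/e in hC.
exists ((Gamma q)^-1 * (C * Gamma (q - e)))%R; first by pos.
move=> s s0; rewrite -mulrA; apply: lee_cancel_mul => //.
pose F (z : R * 'rV[R]_d) : \bar R := (z.1 `^ (q - 1) * expR (- z.1) *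
  (enorm z.2 `^ (- p) * expR (- (z.1 * s * enorm z.2 ^+ 2))))%:E.
have mF : measurable_fun setT F by rewrite /F; meas.
have F0 z : 0 <= F z by rewrite /F; pos.
rewrite -ge0_integralkl; [|side..].
rewrite (_ : \int[mu]_x _ = \int[mu]_x \int[leb]_(t in `]0%R, +oo[) F (t, x)); last first.
  apply: eq_integral => x _.
  have sx0 : (0 < 1 + s * enorm x ^+ 2)%R.
    by rewrite ltr_pwDl// mulr_ge0 ?sqr_ge0// ltW.
  rewrite -EFinM mulrCA EFinM -gamma_integral_scale// -ge0_integralkl; [|side..].
  apply: eq_integral => t _; rewrite /F/= -EFinM; congr EFin.
  rewrite (_ : t * (1 + s * enorm x ^+ 2) = t + t * s * enorm x ^+ 2)%R; last by ring.
  by rewrite opprD expRD; ring.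
rewrite -tonelli_pos_rV//.
apply: (@le_trans _ _ (\int[leb]_(t in `]0%R, +oo[)
    ((C * s `^ (- e))%:E * (t `^ (q - e - 1) * expR (- t))%:E))).
  apply: ge0_le_integral => //.
  - by move=> t _; exact: integral_ge0.
  - by apply: measurable_funTS; exact: measurable_integral_rV.
  - by apply: measurable_funTS; meas.
  move=> t; rewrite /= in_itv/= andbT => t0.
  rewrite /F/=; under eq_integral do rewrite EFinM.
  rewrite ge0_integralkl; [|side..].
  apply: le_trans (lee_wpmul2l _ (hC _ (mulr_gt0 t0 s0))) _; first by pos.
  rewrite -!EFinM lee_fin (powRM (- e) (ltW t0) (ltW s0)).
  rewrite (_ : q - e - 1 = q - 1 + - e)%R; last by ring.
  rewrite (gt0_powRD (q - 1)%R (- e)%R t0).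
  by rewrite le_eqVlt; apply/orP; left; apply/eqP; ring.
rewrite ge0_integralkl; [|side..].
rewrite -/(gamma_integral _) gamma_integralE// -EFinM lee_fin.
by rewrite le_eqVlt; apply/orP; left; apply/eqP; ring.
Qed.

End power_estimates.

(** * The ground state representation *)

Section product_rV.
Context {R : realType} {d : nat}.
Local Open Scope ereal_scope.
Local Notation leb := (@lebesgue_measure R).
Local Notation mu := (@lebesgue_rV R d).
Local Notation V := 'rV[R]_d.
Implicit Types F G : V * V -> \bar R.

Lemma integral_rV2 F : measurable_fun setT F -> (forall z, 0 <= F z) ->
  \int[mu \x mu]_z F z = \int[mu]_x \int[mu]_y F (x, y).
Proof. by move=> mF F0; rewrite fubini_tonelli1. Qed.

Lemma eq_integral_rV2_neq0 F G : (0 < d)%N ->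
  measurable_fun setT F -> measurable_fun setT G ->
  (forall z, 0 <= F z) -> (forall z, 0 <= G z) ->
  (forall x y : V, x != 0%R -> y != 0%R -> F (x, y) = G (x, y)) ->
  \int[mu \x mu]_z F z = \int[mu \x mu]_z G z.
Proof.
move=> d0 mF mG F0 G0 FG; rewrite (integral_rV2 mF F0) (integral_rV2 mG G0).
apply: eq_integral_rV_neq0 => //; try exact: measurable_integral_rV.
- by move=> x; exact: integral_ge0.
- by move=> x; exact: integral_ge0.
by move=> x x0; apply: eq_integral_rV_neq0 => //; [meas|meas|move=> y; exact: FG].
Qed.

Lemma integral_rV2_swap F : measurable_fun setT F -> (forall z, 0 <= F z) ->
  \int[mu \x mu]_z F (z.2, z.1) = \int[mu \x mu]_z F z.
Proof.
move=> mF F0; have mFs : measurable_fun setT (fun z : V * V => F (z.2, z.1)).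
  by apply: measurableT_comp mF _; meas.
rewrite (integral_rV2 mF F0) (integral_rV2 mFs (fun z => F0 _)).
by rewrite tonelli_rV.
Qed.

Lemma measurable_integral_rV2 (d' : measure_display) (T : measurableType d')
    (F : T * (V * V) -> \bar R) :
  measurable_fun setT F -> (forall z, 0 <= F z) ->
  measurable_fun setT (fun t => \int[mu \x mu]_z F (t, z)).
Proof.
move=> mF F0.
rewrite (_ : (fun t => _) = fun t => \int[mu]_x \int[mu]_y F (t, (x, y))); last first.
  by apply/funext => t; rewrite integral_rV2//; meas.
apply: (@measurable_integral_rV R d _ T (fun z => \int[mu]_y F (z.1, (z.2, y)))).
  apply: (@measurable_integral_rV R d _ (T * V)%type (fun z => F (z.1.1, (z.1.2, z.2)))) => //.
  by meas.
by move=> z; exact: integral_ge0.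
Qed.

Lemma tonelli_pos_rV2 (F : R * (V * V) -> \bar R) :
  measurable_fun setT F -> (forall z, 0 <= F z) ->
  \int[leb]_(s in `]0%R, +oo[) \int[mu \x mu]_z F (s, z) =
  \int[mu \x mu]_z \int[leb]_(s in `]0%R, +oo[) F (s, z).
Proof.
move=> mF F0.
pose F1 (z : (R * V) * V) : \bar R := F (z.1.1, (z.1.2, z.2)).
have mF1 : measurable_fun setT F1.
  rewrite /F1; apply: measurableT_comp mF _.
  by meas.
pose F2 (z : R * V) : \bar R := \int[mu]_y F1 (z, y).
have mF2 : measurable_fun setT F2.
  by exact: (@measurable_integral_rV R d _ (R * V)%type F1 mF1 (fun=> F0 _)).
transitivity (\int[leb]_(s in `]0%R, +oo[) \int[mu]_x F2 (s, x)).
  by apply: eq_integral => s _; rewrite integral_rV2//; by meas.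
rewrite tonelli_pos_rV//; last by move=> z; rewrite /F2 /F1; pos.
rewrite integral_rV2; last 2 first.
- exact: (@measurable_integral2 _ _ (measurableTypeR R) (V * V)%type R
    leb `]0%R, +oo[%classic F).
- by move=> z; exact: integral_ge0.
apply: eq_integral => x _.
rewrite /F2 /F1/=.
rewrite (@tonelli_pos_rV _ _ (fun z => F (z.1, (x, z.2))))//.
by apply: measurableT_comp mF _; meas.
Qed.

End product_rV.

Lemma adde_cancelr (R : realType) (c x y : \bar R) :
  (c \is a fin_num -> x + c = y + c -> x = y)%E.
Proof. by move=> fc /(congr1 (fun z => z - c)%E); rewrite !addeK. Qed.

Lemma mule_dbl (R : realType) (c : R) (x : \bar R) : (0 <= c)%R ->
  ((2 * c)%:E * x = c%:E * x + c%:E * x)%E.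
Proof. by move=> c0; rewrite mulrDl mul1r EFinD ge0_muleDl ?lee_fin. Qed.

(** Over the reals this is [G] times the first identity plus twice the second. Here [n] is
    substituted rather than subtracted, and only the term known to be finite, [G m l], is
    cancelled. *)
Lemma adde_double_cancel (R : realType) (G m : R) (g e l n k1 k2 : \bar R) :
  (0 <= G)%R -> (0 <= m)%R ->
  (0 <= g -> 0 <= e -> 0 <= l -> 0 <= n ->
   (G * m)%:E * l \is a fin_num ->
   g + (2 * m)%:E * l = e + 2%:E * n ->
   G%:E * n + m%:E * k1 = (G * m)%:E * l + m%:E * k2 ->
   G%:E * g + (2 * m)%:E * k1 = G%:E * e + (2 * m)%:E * k2)%E.
Proof.
move=> G0 m0 g0 e0 l0 n0 fin; rewrite !(mule_dbl _ m0) -[2%R]mulr1 (mule_dbl _ ler01) mul1e.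
move=> h1 h2; have ml0 : (0 <= m%:E * l)%E by rewrite mule_ge0 ?lee_fin.
apply: (adde_cancelr fin); apply: (adde_cancelr fin).
transitivity (G%:E * (g + (m%:E * l + m%:E * l)) + (m%:E * k1 + m%:E * k1))%E.
  rewrite ge0_muleDr ?adde_ge0// ge0_muleDr// !muleA -!EFinM -!addeA.
  by congr (_ + _)%E; rewrite addeA [RHS]addeA addeC.
rewrite h1 ge0_muleDr ?adde_ge0// ge0_muleDr//.
transitivity (G%:E * e + ((G%:E * n + m%:E * k1) + (G%:E * n + m%:E * k1)))%E.
  by rewrite -!addeA; congr (_ + (_ + _))%E; rewrite addeCA.
rewrite h2 -!addeA; congr (_ + _)%E.
by rewrite addeA addeACA [RHS]addeA [RHS]addeC.
Qed.

Section ground_state.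
Context {R : realType} {d : nat}.
Variables a b : R.
Hypotheses (d0 : (0 < d)%N) (a0 : (0 < a)%R) (ab : (a < b)%R) (ba1 : (b - a < 1)%R).
Hypothesis dE : (d%:R / 2 = a + b)%R.
#[local] Opaque Gamma integral powR expR.
Local Open Scope ereal_scope.
Local Notation leb := (@lebesgue_measure R).
Local Notation mu := (@lebesgue_rV R d).
Local Notation V := 'rV[R]_d.

(** In the application [a = (d - alpha) / 4] and [b = (d + alpha) / 4]. Then [2 a] is delta-star,
    the energy kernel is [|x - y| ^ (- 4 b)] and the Hardy weight is [|x| ^ (- 2 (b - a))]. *)
Definition gphi (x : V) : R := (enorm x `^ (- (2 * a)))%R.
Local Notation phi := gphi.

Let b0 : (0 < b)%R. Proof. exact: lt_trans ab. Qed.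
Let g0 : (0 < b - a)%R. Proof. by rewrite subr_gt0. Qed.

Lemma measurable_gphi : measurable_fun setT phi.
Proof. by rewrite /gphi; meas. Qed.
Let mphi := measurable_gphi.

Lemma gphi_ge0 x : (0 <= phi x)%R.
Proof. exact: powR_ge0. Qed.
Let phi0 := gphi_ge0.

Lemma gphi_gt0 x : x != 0%R -> (0 < phi x)%R.
Proof. by move=> x0; rewrite powR_gt0// enorm_gt0. Qed.

Lemma gphiV x : ((phi x)^-1 = enorm x `^ (2 * a))%R.
Proof. by rewrite /gphi powRN invrK. Qed.

Lemma gphi_gamma x : x != 0%R ->
  \int[leb]_(t in `]0%R, +oo[) (t `^ (a - 1) * expR (- (t * enorm x ^+ 2)))%:E =
  (Gamma a * phi x)%:E.
Proof.
move=> x0; have := enorm_powR_gamma (mulr_gt0 (ltr0Sn R 1) a0) x0.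
by rewrite (_ : 2 * a / 2 = a)%R//; field.
Qed.

(** Up to constants the Gaussian average of [phi] at scale [s], as a superposition of Gaussians with
    parameters [r < s]. Without the factor [(1 - r / s) ^ (b - 1)] and with [r] unrestricted it
    would be the Gamma formula for [phi] itself. *)
Definition gpot (s : R) (x : V) : \bar R :=
  \int[leb]_(r in `]0%R, s[)
    (r `^ (a - 1) * (1 - r / s) `^ (b - 1) * expR (- (r * enorm x ^+ 2)))%:E.

(** [phi] is written as a Gamma integral over [t], each pair of Gaussians is convolved, and
    [r = s t / (s + t)] is substituted. The powers of [s] and [s + t] match because
    [d / 2 = a + b]. *)
Lemma gauss_potential (s : R) (x : V) : (0 < s)%R ->
  (Gamma a)%:E * \int[mu]_y (phi y * expR (- (s * enorm (x - y) ^+ 2)))%:E =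
  ((pi / s) `^ (d%:R / 2))%:E * gpot s x.
Proof.
move=> s0; have G0 := Gamma_gt0 a0.
pose F (z : R * V) : \bar R := (z.1 `^ (a - 1) *
  (expR (- (s * enorm (x - z.2)%R ^+ 2)) * expR (- (z.1 * enorm z.2 ^+ 2))))%:E.
have mF : measurable_fun setT F by rewrite /F; meas.
have F0 z : 0 <= F z by rewrite /F; pos.
rewrite -ge0_integralkl; [|side..].
transitivity (\int[mu]_y \int[leb]_(t in `]0%R, +oo[) F (t, y)).
  apply: (eq_integral_rV_neq0 d0).
  - by meas.
  - exact: measurable_integral_pos_rV.
  - by move=> y; pos.
  - by move=> y; exact: integral_ge0.
  move=> y y0; rewrite -EFinM mulrA EFinM -gphi_gamma//.
  rewrite -ge0_integralkr; [|side..].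
  apply: eq_integral => t _; rewrite /F/= -EFinM; congr EFin; ring.
rewrite -tonelli_pos_rV// /gpot.
pose h r : \bar R := (r `^ (a - 1) * (1 - r / s) `^ (b - 1) * expR (- (r * enorm x ^+ 2)))%:E.
rewrite -/h (@integral_harmonic _ _ h)//; last 2 first.
- by rewrite /h; meas.
- by move=> r; rewrite /h; pos.
rewrite -ge0_integralkl; last 4 first.
- by [].
- by rewrite /h; meas.
- by move=> r; rewrite /h; pos.
- by pos.
apply: eq_integral => t; rewrite inE/= in_itv/= andbT => t0.
have st0 : (0 < s + t)%R by rewrite addr_gt0.
rewrite /F/=; under eq_integral do rewrite EFinM.
rewrite ge0_integralkl; [|side..].
rewrite integral_rV_gauss_conv// /h -!EFinM; congr EFin.
rewrite (_ : 1 - s * t / (s + t) / s = s / (s + t))%R; last first.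
  by field; rewrite !gt_eqF.
have pos_st : (0 <= s * t)%R by rewrite mulr_ge0 ?(ltW s0) ?(ltW t0).
rewrite dE !powR_div ?pi_ge0 ?(ltW s0) ?(ltW t0) ?(ltW st0) ?pos_st//.
rewrite (powRM _ (ltW s0) (ltW t0)).
have E1 (z : R) : (0 < z)%R -> (z `^ (- (a - 1)) * z `^ (- (b - 1)) * (z ^+ 2)^-1 = z `^ (- (a + b)))%R.
  move=> z0; rewrite -powR_mulrn ?(ltW z0)// -powRN -!gt0_powRD//.
  by congr (_ `^ _)%R; ring.
have E2 : (s `^ (- (a + b)) * s `^ (a - 1) * s `^ (b - 1) * s ^+ 2 = 1)%R.
  rewrite -powR_mulrn ?(ltW s0)// -!gt0_powRD//.
  by rewrite (_ : _ + 2%:R = 0)%R ?powRr0//; ring.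
rewrite exprMn exprVn -E1//.
rewrite -[LHS]mul1r -[X in (X * _ = _)%R]E2.
ring.
Qed.

Definition gker (k : R -> R) (z : R * V) : \bar R :=
  \int[leb]_(r in `]0%R, +oo[)
    (r `^ (a - 1) * expR (- (r * enorm z.2 ^+ 2)) * k (r / z.1)%R)%:E.

Lemma measurable_gker (k : R -> R) : measurable_fun setT k -> (forall w, 0 <= k w)%R ->
  measurable_fun setT (gker k).
Proof.
move=> mk k0.
pose F (z : R * (R * V)) : \bar R :=
  (z.1 `^ (a - 1) * expR (- (z.1 * enorm z.2.2 ^+ 2)) * k (z.1 / z.2.1)%R)%:E.
apply: (@measurable_integral2 _ _ (measurableTypeR R) (R * V)%type R leb
  `]0%R, +oo[%classic F) => //.
- by rewrite /F; meas.
- by move=> z; rewrite /F; pos.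
Qed.

Lemma gker_ge0 (k : R -> R) (z : R * V) : (forall w, 0 <= k w)%R -> 0 <= gker k z.
Proof. by move=> k0; rewrite /gker; pos. Qed.

(** [kern12] at [w = r / s], integrated over [r]: it measures how far the Gaussian average [gpot] is
    from [phi], keeping both error terms nonnegative. *)
Lemma gker12 (s : R) (x : V) : (0 < s)%R -> x != 0%R ->
  (Gamma a * phi x)%:E + gker (kern2 b) (s, x) = gpot s x + gker (kern1 b) (s, x).
Proof.
move=> s0 x0; rewrite -gphi_gamma// /gker/=.
have k10 w := kern1_ge0 w b0; have k20 := kern2_ge0 b.
have mk1 := measurable_kern1 b; have mk2 := measurable_kern2 b.
rewrite /gpot -(@integral_indicr _ (measurableTypeR R) R leb R `]0%R, +oo[%classic
  `]0%R, s[%classic `]0%R, 1%R[%classic (fun r : R => r / s)%R)//; last first.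
  move=> r; rewrite /= !in_itv/= andbT ltr_pdivrMr// mul1r.
  split => [/andP[r0 rs]|[-> /andP[]//]].
  by rewrite r0 divr_gt0.
rewrite -ge0_integralD//=; last 4 first.
- by move=> t _; pos.
- by apply: measurable_funTS; meas.
- by move=> t _; pos.
- by apply: measurable_funTS; meas.
rewrite -ge0_integralD//=; last 4 first.
- by move=> t _; pos.
- by apply: measurable_funTS; meas.
- by move=> t _; pos.
- by apply: measurable_funTS; meas.
apply: eq_integral => r _; rewrite -EFinM -!EFinD; congr EFin.
have := kern12 (r / s) b0; set w := (r / s)%R => kE.
rewrite -[X in (X + _)%R]mulr1 -mulrDr kE; ring.
Qed.

(** Integrating over [s] first, [integral_ratio] splits off the Mellin integral of [k] and leaves
    [r ^ (b - a)]. This raises [r ^ (a - 1)] to [r ^ (b - 1)], so the Gamma formula now yields the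
    exponent [- 2 b]. *)
Lemma integral_gker (k : R -> R) (x : V) :
  measurable_fun setT k -> (forall w, 0 <= k w)%R -> x != 0%R ->
  \int[leb]_(s in `]0%R, +oo[) ((s `^ (b - a - 1))%:E * gker k (s, x)) =
  (\int[leb]_(w in `]0%R, +oo[) (w `^ (- (b - a) - 1) * k w)%:E) *
    (Gamma b * enorm x `^ (- (2 * b)))%:E.
Proof.
move=> mk k0 x0.
pose F (z : R * R) : \bar R := (z.1 `^ (b - a - 1) *
  (z.2 `^ (a - 1) * expR (- (z.2 * enorm x ^+ 2)) * k (z.2 / z.1)))%:E.
have mF : measurable_fun setT F by rewrite /F; meas.
have F0 z : 0 <= F z by rewrite /F; pos.
transitivity (\int[leb]_(s in `]0%R, +oo[) \int[leb]_(r in `]0%R, +oo[) F (s, r)).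
  apply: eq_integral => s _; rewrite /gker -ge0_integralkl; [|side..].
  by apply: eq_integral => r _; rewrite -EFinM.
rewrite tonelli_pos//.
transitivity (\int[leb]_(r in `]0%R, +oo[)
   ((\int[leb]_(w in `]0%R, +oo[) (w `^ (- (b - a) - 1) * k w)%:E) *
   (r `^ (b - 1) * expR (- (r * enorm x ^+ 2)))%:E)).
  apply: eq_integral => r; rewrite inE/= in_itv/= andbT => r0.
  transitivity (\int[leb]_(s in `]0%R, +oo[)
    ((r `^ (a - 1) * expR (- (r * enorm x ^+ 2)))%:E * (s `^ (b - a - 1) * k (r / s))%:E)).
    by apply: eq_integral => s _; rewrite /F/= -EFinM; congr EFin; ring.
  rewrite ge0_integralkl; [|side..].
  rewrite integral_ratio// muleA muleC; congr (_ * _).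
  rewrite -EFinM; congr EFin; rewrite mulrAC -gt0_powRD//.
  by congr (_ `^ _ * _)%R; ring.
rewrite ge0_integralkl; [|side..].
have := enorm_powR_gamma (mulr_gt0 (ltr0Sn R 1) b0) x0.
by rewrite (_ : 2 * b / 2 = b)%R; [move=> ->|field].
Qed.

Lemma square_phi_identity (u v p r : R) : (0 < p)%R -> (0 < r)%R ->
  ((u / p - v / r) ^+ 2 * (p * r) + u ^+ 2 + v ^+ 2 =
   (u - v) ^+ 2 + u ^+ 2 * p^-1 * r + v ^+ 2 * r^-1 * p)%R.
Proof. by move=> p0 r0; field; rewrite !gt_eqF. Qed.

Variable u : V -> R.
Hypothesis mu_ : measurable_fun setT u.

Definition dirichlet_sq (z : V * V) : R := ((u z.1 - u z.2) ^+ 2)%R.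
Definition ground_sq (z : V * V) : R :=
  ((u z.1 / phi z.1 - u z.2 / phi z.2) ^+ 2 * (phi z.1 * phi z.2))%R.
Local Notation gauss s z := (expR (- (s * enorm (z.1 - z.2) ^+ 2)))%R.
Local Notation M s := ((pi / s) `^ (d%:R / 2))%R.
Local Notation L := (\int[mu]_x (u x ^+ 2)%:E).

Let gauss_mass (s : R) : (0 < s)%R ->
  \int[mu \x mu]_z (u z.1 ^+ 2 * gauss s z)%:E = (M s)%:E * L.
Proof.
move=> s0; rewrite integral_rV2; [|by meas|by move=> z; pos].
rewrite muleC -ge0_integralkr; [|side..].
apply: eq_integral => x _/=.
rewrite -(integral_rV_gauss x s0) -ge0_integralkl; [|side..].
by apply: eq_integral => y _; rewrite -EFinM.
Qed.

Let gauss_weight (s : R) : (0 < s)%R ->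
  (Gamma a)%:E * \int[mu \x mu]_z (u z.1 ^+ 2 * (phi z.1)^-1 * phi z.2 * gauss s z)%:E =
  \int[mu]_x ((u x ^+ 2 * (phi x)^-1)%:E * ((M s)%:E * gpot s x)).
Proof.
move=> s0; have G0 := Gamma_gt0 a0.
rewrite integral_rV2; [|by meas|by move=> z; pos].
rewrite -ge0_integralkl; last 4 first.
- by [].
- apply: (@measurable_integral_rV R d _ V (fun z => (u z.1 ^+ 2 * (phi z.1)^-1 * phi z.2 * gauss s z)%:E)); last by move=> z; pos.
  by meas.
- by move=> x; pos.
- by pos.
apply: eq_integral => x _/=.
rewrite -gauss_potential// muleCA; congr (_ * _).
rewrite -ge0_integralkl; [|side..].
by apply: eq_integral => y _; rewrite -EFinM; congr EFin; ring.
Qed.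

Let kern_mass (k : R -> R) (s : R) : \bar R :=
  \int[mu]_x ((u x ^+ 2 * (phi x)^-1)%:E * gker k (s, x)).

Let mk1 := measurable_kern1 b.
Let mk2 := measurable_kern2 b.
Let k10 w : (0 <= kern1 b w)%R := kern1_ge0 w b0.
Let k20 w : (0 <= kern2 b w)%R := kern2_ge0 b w.

Let mkern (k : R -> R) (s : R) : measurable_fun setT k -> (forall w, 0 <= k w)%R ->
  measurable_fun setT (fun x => gker k (s, x)).
Proof. by move=> mk k0; have := measurable_gker mk k0 => mg; meas. Qed.

Hypothesis Lfin : L < +oo.

Let mass_fin (c : R) : (0 <= c)%R -> (c%:E * L) \is a fin_num.
Proof.
move=> c0; rewrite ge0_fin_numE; last by pos.
by rewrite lte_mul_pinfty.
Qed.

(** The representation for a single Gaussian kernel. Expanding both squares by [square_phi_identity]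
    leaves the mass [M s * L] and a cross term [N] ([eq1]). By [gauss_potential] and [gker12] the
    cross term equals that mass up to the two kernel terms ([eq2]), and the mass cancels because it
    is finite. *)
Lemma gauss_ground_state (s : R) : (0 < s)%R ->
  (Gamma a)%:E * \int[mu \x mu]_z (ground_sq z * gauss s z)%:E +
    (2 * M s)%:E * kern_mass (kern1 b) s =
  (Gamma a)%:E * \int[mu \x mu]_z (dirichlet_sq z * gauss s z)%:E +
    (2 * M s)%:E * kern_mass (kern2 b) s.
Proof.
move=> s0; have G0 := Gamma_gt0 a0.
have M0 : (0 <= M s)%R by pos.
set Gr := \int[mu \x mu]_z (ground_sq z * _)%:E.
set Di := \int[mu \x mu]_z (dirichlet_sq z * _)%:E.
pose N := \int[mu \x mu]_z (u z.1 ^+ 2 * (phi z.1)^-1 * phi z.2 * gauss s z)%:E.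
have Gr0 : 0 <= Gr by rewrite /Gr /ground_sq; pos.
have Di0 : 0 <= Di by rewrite /Di /dirichlet_sq; pos.
have N0 : 0 <= N by rewrite /N; pos.
have L0 : 0 <= L by pos.
have gauss_sym (x y : V) :
    (expR (- (s * enorm (x - y) ^+ 2)) = expR (- (s * enorm (y - x) ^+ 2)))%R.
  by rewrite -[in RHS]enormN opprB.
have eq1 : Gr + (2 * M s)%:E * L = Di + 2%:E * N.
  have mass2 : \int[mu \x mu]_z (u z.2 ^+ 2 * gauss s z)%:E = (M s)%:E * L.
    rewrite -(gauss_mass s0) -integral_rV2_swap; [|by meas|by move=> z; pos].
    by apply: eq_integral => z _; rewrite /= (gauss_sym z.1 z.2); exact: erefl.
  have N2 : \int[mu \x mu]_z (u z.2 ^+ 2 * (phi z.2)^-1 * phi z.1 * gauss s z)%:E = N.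
    rewrite /N -[RHS]integral_rV2_swap; [|by meas|by move=> z; pos].
    by apply: eq_integral => z _; rewrite /= (gauss_sym z.1 z.2); exact: erefl.
  rewrite (mule_dbl _ M0) addeA.
  rewrite -[X in _ + X + _](gauss_mass s0) -mass2.
  rewrite -ge0_integralDT; last 4 first.
  - by rewrite /ground_sq /dirichlet_sq; meas.
  - by meas.
  - by move=> z; rewrite -?EFinD /ground_sq /dirichlet_sq; pos.
  - by move=> z; pos.
  rewrite -ge0_integralDT; last 4 first.
  - by rewrite /ground_sq /dirichlet_sq; meas.
  - by meas.
  - by move=> z; rewrite -?EFinD /ground_sq /dirichlet_sq; pos.
  - by move=> z; pos.
  rewrite (_ : 2%:E * N = N + N); last first.
    by rewrite -[2%R]mulr1 (mule_dbl _ ler01) mul1e.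
  rewrite addeA -[X in _ + X]N2.
  rewrite -ge0_integralDT; last 4 first.
  - by rewrite /ground_sq /dirichlet_sq; meas.
  - by meas.
  - by move=> z; rewrite -?EFinD /ground_sq /dirichlet_sq; pos.
  - by move=> z; pos.
  rewrite -ge0_integralDT; last 4 first.
  - by rewrite /ground_sq /dirichlet_sq; meas.
  - by meas.
  - by move=> z; rewrite -?EFinD /ground_sq /dirichlet_sq; pos.
  - by move=> z; pos.
  apply: (eq_integral_rV2_neq0 d0).
  - by rewrite /ground_sq; meas.
  - by rewrite /dirichlet_sq; meas.
  - by move=> z; rewrite /ground_sq; pos.
  - by move=> z; rewrite /dirichlet_sq; pos.
  move=> x y x0 y0; rewrite -!EFinD /ground_sq /dirichlet_sq/=; congr EFin.
  have := square_phi_identity (u x) (u y) (gphi_gt0 x0) (gphi_gt0 y0) => h.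
  by rewrite -!mulrDl h.
have eq2 : (Gamma a)%:E * N + (M s)%:E * kern_mass (kern1 b) s =
    (Gamma a * M s)%:E * L + (M s)%:E * kern_mass (kern2 b) s.
  have mker1 := mkern s mk1 k10; have mker2 := mkern s mk2 k20.
  have ker10 x : 0 <= gker (kern1 b) (s, x) by exact: gker_ge0.
  have ker20 x : 0 <= gker (kern2 b) (s, x) by exact: gker_ge0.
  have mpot : measurable_fun setT (gpot s).
    apply: (@measurable_integral2 _ _ (measurableTypeR R) V R leb `]0%R, s[%classic
      (fun z => (z.1 `^ (a - 1) * (1 - z.1 / s) `^ (b - 1) *
                 expR (- (z.1 * enorm z.2 ^+ 2)))%:E)).
    - by [].
    - by meas.
    - by move=> z; pos.
  have pot0 x : 0 <= gpot s x by rewrite /gpot; pos.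
  rewrite (gauss_weight s0) /kern_mass.
  rewrite -!ge0_integralkl; last 12 first.
  - by [].
  - by meas.
  - by move=> x; pos.
  - by pos.
  - by [].
  - by meas.
  - by move=> x; pos.
  - by pos.
  - by [].
  - by meas.
  - by move=> x; pos.
  - by pos.
  rewrite -ge0_integralDT; last 4 first.
  - by meas.
  - by meas.
  - by move=> x; pos.
  - by move=> x; pos.
  rewrite -ge0_integralDT; last 4 first.
  - by meas.
  - by meas.
  - by move=> x; pos.
  - by move=> x; pos.
  apply: (eq_integral_rV_neq0 d0).
  - by meas.
  - by meas.
  - by move=> x; pos.
  - by move=> x; pos.
  move=> x x0; have h := gker12 s0 x0.
  have h1 := ker10 x; have h2 := ker20 x; have h3 := pot0 x.
  move: (gker (kern1 b) (s, x)) (gker (kern2 b) (s, x)) (gpot s x) h h1 h2 h3.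
  move=> k1 k2 p h h1 h2 h3.
  rewrite [X in _ + X = _]muleCA -ge0_muleDr ?mule_ge0 ?lee_fin//.
  rewrite -ge0_muleDr// -h !ge0_muleDr ?mule_ge0 ?lee_fin ?mulr_ge0 ?(ltW G0)//.
  rewrite [X in _ + X = _]muleCA; congr (_ + _).
  rewrite -!EFinM; congr EFin; field.
  by rewrite gt_eqF// gphi_gt0.
have fin := mass_fin (mulr_ge0 (ltW G0) M0).
exact: (adde_double_cancel (ltW G0) M0 Gr0 Di0 L0 N0 fin eq1 eq2).
Qed.

(** Off the diagonal this is the Gamma formula for the kernel. On the diagonal the power is 0 by
    default, but there [D] vanishes. *)
Lemma subordination (D : V * V -> R) : measurable_fun setT D ->
  (forall z, 0 <= D z)%R -> (forall x, D (x, x) = 0%R) ->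
  (Gamma (2 * b))%:E *
    \int[mu \x mu]_z (D z * enorm (z.1 - z.2)%R `^ (- (4 * b)))%:E =
  \int[leb]_(s in `]0%R, +oo[) ((s `^ (2 * b - 1))%:E *
    \int[mu \x mu]_z (D z * gauss s z)%:E).
Proof.
move=> mD D0 Dxx; have b20 : (0 < 2 * b)%R by rewrite mulr_gt0.
have G0 := Gamma_gt0 b20.
pose F (z : R * (V * V)) : \bar R := (z.1 `^ (2 * b - 1) * (D z.2 * gauss z.1 z.2))%:E.
have mF : measurable_fun setT F by rewrite /F; meas.
have F0 z : 0 <= F z by rewrite /F; pos.
transitivity (\int[leb]_(s in `]0%R, +oo[) \int[mu \x mu]_z F (s, z)); last first.
  apply: eq_integral => s _; rewrite -ge0_integralkl; [|side..].
  by apply: eq_integral => z _; rewrite -EFinM.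
rewrite tonelli_pos_rV2// -ge0_integralkl; [|side..].
apply: eq_integral => -[x y] _; rewrite /F/=.
have [<-|xy] := eqVneq x y.
  rewrite Dxx mul0r mule0 integral0_eq// => s _.
  by rewrite mul0r mulr0.
have xy0 : (x - y != 0)%R by rewrite subr_eq0.
have b40 : (0 < 4 * b)%R by rewrite mulr_gt0.
have bE : (4 * b / 2 = 2 * b)%R by field.
rewrite -EFinM mulrCA EFinM -[in Gamma _]bE -enorm_powR_gamma//.
rewrite bE -ge0_integralkl; [|side..].
by apply: eq_integral => s _; rewrite -EFinM mulrCA.
Qed.

Local Notation W := (\int[mu]_x (u x ^+ 2 * enorm x `^ (- (2 * (b - a))))%:E).

(** [M s] contributes [s ^ (- (a + b))], which turns the subordination weight [s ^ (2 b - 1)] into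
    the [s ^ (b - a - 1)] of [integral_gker]. Dividing by [phi] then turns [|x| ^ (- 2 b)] into the
    Hardy weight. *)
Let integral_kern_mass (k : R -> R) :
  measurable_fun setT k -> (forall w, 0 <= k w)%R ->
  \int[leb]_(s in `]0%R, +oo[) ((s `^ (2 * b - 1))%:E * ((2 * M s)%:E * kern_mass k s)) =
  (2 * pi `^ (a + b) * Gamma b)%:E *
    (\int[leb]_(w in `]0%R, +oo[) (w `^ (- (b - a) - 1) * k w)%:E) * W.
Proof.
move=> mk k0; have G0 := Gamma_gt0 b0; have mg := measurable_gker mk k0.
have ker0 z : 0 <= gker k z by exact: gker_ge0.
pose F (z : R * V) : \bar R :=
  (z.1 `^ (b - a - 1))%:E * ((u z.2 ^+ 2 / phi z.2)%:E * gker k z).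
have mF : measurable_fun setT F by rewrite /F; meas.
have F0 z : 0 <= F z by rewrite /F; pos.
transitivity ((2 * pi `^ (a + b))%:E *
   \int[leb]_(s in `]0%R, +oo[) \int[mu]_x F (s, x)).
  rewrite -ge0_integralkl; last 4 first.
  - by [].
  - exact: (@measurable_integral_rV R d _ (measurableTypeR R) F).
  - by move=> s; pos.
  - by pos.
  apply: eq_integral => s; rewrite inE/= in_itv/= andbT => s0.
  have mgs := mkern s mk k0.
  rewrite /F/= ge0_integralkl; [|side..].
  rewrite !muleA -!EFinM; congr (EFin _ * _).
  rewrite dE powR_div ?pi_ge0 ?(ltW s0)//.
  rewrite (_ : b - a - 1 = 2 * b - 1 + - (a + b))%R; last by ring.
  by rewrite (gt0_powRD (2 * b - 1) _ s0); ring.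
rewrite tonelli_pos_rV// !EFinM -!muleA; congr (_ * (_ * _)).
rewrite muleA -ge0_integralkl; [|side..].
apply: (eq_integral_rV_neq0 d0).
- exact: measurable_integral_pos_rV.
- by meas.
- by move=> x; pos.
- by move=> x; pos.
move=> x x0; rewrite /F/=.
transitivity ((u x ^+ 2 / phi x)%:E *
    \int[leb]_(s in `]0%R, +oo[) ((s `^ (b - a - 1))%:E * gker k (s, x))).
  rewrite -ge0_integralkl; [|side..].
  by apply: eq_integral => s _; rewrite muleCA.
rewrite integral_gker// muleCA [(Gamma b)%:E * _]muleC -muleA -!EFinM.
congr (_ * EFin _).
rewrite (_ : - (2 * (b - a)) = 2 * a + - (2 * b))%R; last by ring.
by rewrite gt0_powRD ?enorm_gt0// gphiV; ring.
Qed.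

Lemma ground_state_representation : W < +oo ->
  (\int[mu \x mu]_z (dirichlet_sq z * enorm (z.1 - z.2)%R `^ (- (4 * b)))%:E =
   \int[mu \x mu]_z (ground_sq z * enorm (z.1 - z.2)%R `^ (- (4 * b)))%:E +
   (2 * pi `^ (a + b) * Gamma b ^+ 2 * Gamma (1 - (b - a)) /
     (Gamma a ^+ 2 * Gamma (2 * b) * (b - a)))%:E * W).
Proof.
move=> Wfin; have Ga := Gamma_gt0 a0; have Gb := Gamma_gt0 b0.
have b20 : (0 < 2 * b)%R by rewrite mulr_gt0.
have G2b := Gamma_gt0 b20.
have g1 : (0 < 1 - (b - a))%R by rewrite subr_gt0.
have G1g := Gamma_gt0 g1.
set Di := \int[mu \x mu]_z (dirichlet_sq z * _)%:E.
set Gr := \int[mu \x mu]_z (ground_sq z * _)%:E.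
have Di0 : 0 <= Di by rewrite /Di /dirichlet_sq; pos.
have Gr0 : 0 <= Gr by rewrite /Gr /ground_sq; pos.
have W0 : 0 <= W by pos.
have mD : measurable_fun setT dirichlet_sq by rewrite /dirichlet_sq; meas.
have mG : measurable_fun setT ground_sq by rewrite /ground_sq; meas.
have D0 z : (0 <= dirichlet_sq z)%R by rewrite /dirichlet_sq; pos.
have GG0 z : (0 <= ground_sq z)%R by rewrite /ground_sq; pos.
have dirichlet_diag (x : V) : dirichlet_sq (x, x) = 0%R by rewrite /dirichlet_sq/= subrr expr0n.
have ground_diag (x : V) : ground_sq (x, x) = 0%R.
  by rewrite /ground_sq/= subrr expr0n; exact: mul0r.
have subD := subordination mD D0 dirichlet_diag.
have subG := subordination mG GG0 ground_diag.
rewrite -/Di in subD; rewrite -/Gr in subG.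
clearbody Di Gr.
pose C : R := (2 * pi `^ (a + b) * Gamma b)%R.
have C0 : (0 <= C)%R by rewrite /C; have := @pi_ge0 R; move=> ?; pos.
(* The value of the beta integral at [1 - (b - a)] and [b], whose sum is [a + 1]. Finiteness of the
   integral is part of what [BE] shows. *)
pose B : R := (Gamma (1 - (b - a)) * Gamma b / Gamma (a + 1))%R.
have Ga1 : (0 < Gamma (a + 1))%R by rewrite Gamma_gt0// addr_gt0.
have BE : beta_integral (1 - (b - a)) b = B%:E.
  have := beta_integral_Gamma g1 b0.
  rewrite (_ : 1 - (b - a) + b = a + 1)%R; last by ring.
  have : 0 <= beta_integral (1 - (b - a)) b by rewrite /beta_integral; pos.
  case: (beta_integral _ _) => [r _|_|//].
    by rewrite -EFinM => -[h]; rewrite /B -h mulrC mulKf// gt_eqF.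
  by rewrite gt0_muley.
have B0 : (0 <= B)%R by exact: ltW (divr_gt0 (mulr_gt0 G1g Gb) Ga1).
have k1E := integral_kern_mass mk1 k10.
have k2E := integral_kern_mass mk2 k20.
rewrite integral_kern1// BE in k1E; rewrite integral_kern2 BE in k2E.
rewrite -/C in k1E k2E.
(* The Gaussian identity integrated against [s ^ (2 b - 1)]. The two Hardy terms differ only by the
   factor [b / (b - a)]. *)
have key : (Gamma (2 * b) * Gamma a)%:E * Gr + (C * (b / (b - a) * B))%:E * W =
    (Gamma (2 * b) * Gamma a)%:E * Di + (C * B)%:E * W.
  rewrite [(Gamma (2 * b) * _)%R]mulrC [(Gamma a * _)%:E]EFinM -!(muleA (Gamma a)%:E).
  apply: (etrans (congr1 (fun t => (Gamma a)%:E * t + _) subG)); apply: esym.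
  apply: (etrans (congr1 (fun t => (Gamma a)%:E * t + _) subD)); apply: esym.
  have -> : (C * (b / (b - a) * B))%:E * W = C%:E * ((b / (b - a))%:E * B%:E) * W.
    by rewrite -!EFinM.
  rewrite [(C * B)%:E]EFinM -k1E -k2E.
  have mI (D : V * V -> R) : measurable_fun setT D -> (forall z, 0 <= D z)%R ->
      measurable_fun setT (fun s : R => \int[mu \x mu]_z (D z * gauss s z)%:E).
    move=> mD' D0'; apply: (@measurable_integral_rV2 R d _ (measurableTypeR R)
      (fun z => (D z.2 * gauss z.1 z.2)%:E)); last by move=> z; pos.
    by meas.
  have mK (k : R -> R) : measurable_fun setT k -> (forall w, 0 <= k w)%R ->
      measurable_fun setT (kern_mass k).
    move=> mk k0; apply: (@measurable_integral_rV R d _ (measurableTypeR R)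
      (fun z => (u z.2 ^+ 2 / phi z.2)%:E * gker k z)); last first.
      by move=> z; apply: mule_ge0; [pos|exact: gker_ge0].
    by have mg := measurable_gker mk k0; meas.
  have mDi := mI _ mD D0; have mGr := mI _ mG GG0.
  have mK1 := mK _ mk1 k10; have mK2 := mK _ mk2 k20.
  have mM : measurable_fun setT (fun s : R => (2 * M s)%:E) by meas.
  have K0 (k : R -> R) (s : R) : (forall w, 0 <= k w)%R -> 0 <= kern_mass k s.
    move=> k0; apply: integral_ge0 => x _.
    by apply: mule_ge0; [pos|exact: gker_ge0].
  have K10 s : 0 <= kern_mass (kern1 b) s by exact: K0.
  have K20 s : 0 <= kern_mass (kern2 b) s by exact: K0.
  have Gr0' s : 0 <= \int[mu \x mu]_z (ground_sq z * gauss s z)%:E by pos.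
  have Di0' s : 0 <= \int[mu \x mu]_z (dirichlet_sq z * gauss s z)%:E by pos.
  rewrite -!ge0_integralkl; [|side..].
  rewrite -ge0_integralD; last 5 first.
  - by [].
  - by move=> s _; pos.
  - by apply: measurable_funTS; meas.
  - by move=> s _; pos.
  - by apply: measurable_funTS; meas.
  rewrite -ge0_integralD; last 5 first.
  - by [].
  - by move=> s _; pos.
  - by apply: measurable_funTS; meas.
  - by move=> s _; pos.
  - by apply: measurable_funTS; meas.
  apply: eq_integral => s; rewrite inE/= in_itv/= andbT => s0.
  rewrite !(muleCA (Gamma a)%:E) -!ge0_muleDr; [|side..].
  by rewrite gauss_ground_state.
pose K : R := (Gamma (2 * b) * Gamma a)%R.
have K0 : (0 < K)%R by exact: mulr_gt0 G2b Ga.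
(* [b / (b - a) - 1 = a / (b - a)] is the coefficient that survives once [C B W] is cancelled, which
   is where [W < +oo] enters. *)
pose c : R := (C * B * (a / (b - a)))%R.
have c0 : (0 <= c)%R by rewrite /c; pos.
have CB0 : (0 <= C * B)%R by pos.
have finCB : (C * B)%:E * W \is a fin_num.
  by rewrite ge0_fin_numE ?mule_ge0 ?lee_fin//; exact: lte_mul_pinfty.
have key2 : K%:E * Gr + c%:E * W = K%:E * Di.
  apply: (adde_cancelr finCB); rewrite -key -addeA; congr (_ + _).
  rewrite -ge0_muleDl ?lee_fin// -EFinD; congr (EFin _ * _).
  by rewrite /c; field; rewrite gt_eqF.
have -> : Di = K^-1%:E * (K%:E * Di) by rewrite muleA -EFinM mulVf ?mul1e// gt_eqF.
rewrite -key2 ge0_muleDr ?mule_ge0 ?lee_fin ?(ltW K0)//.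
rewrite !muleA -!EFinM mulVf ?gt_eqF// mul1e; congr (_ + EFin _ * _).
(* [Gamma (a + 1) = a Gamma a] absorbs the factor [a] and supplies the second [Gamma a] in the
   denominator. *)
rewrite /c /K /B /C (Gamma_recr a0).
move: (Gamma a) (Gamma b) (Gamma (2 * b)) (Gamma (1 - (b - a))) (pi `^ (a + b))%R
  (lt0r_neq0 Ga) (lt0r_neq0 G2b) => A A1 A2 A3 A4 A_n0 A2_n0.
by field; rewrite A_n0 A2_n0 !lt0r_neq0.
Qed.

End ground_state.

(** * Square integrals and the Banach-Saks argument *)

Section fatou_bound.
Context d (T : measurableType d) (R : realType) (m : {measure set T -> \bar R}).
Local Open Scope ereal_scope.

Lemma measurable_fun_limn_einf (f : (T -> \bar R)^nat) :
  (forall n, measurable_fun setT (f n)) ->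
  measurable_fun setT (fun x => limn_einf (f ^~ x)).
Proof.
move=> mf; rewrite (_ : (fun _ => _) =
    fun x => - limn_esup ((fun n x => - f n x) ^~ x)).
  apply: measurableT_comp => //; apply: measurable_fun_limn_esup => n.
  exact: measurableT_comp.
by apply/funext => x; rewrite -(oppeK (limn_einf _)) -limn_esupN.
Qed.

Lemma le_integral_cvg_ae (f : (T -> \bar R)^nat) (g : T -> \bar R) (C : \bar R) :
  (forall n, measurable_fun setT (f n)) -> measurable_fun setT g ->
  (forall n x, 0 <= f n x) -> (forall x, 0 <= g x) ->
  {ae m, forall x, f n x @[n --> \oo] --> g x} ->
  (forall n, \int[m]_x f n x <= C) -> \int[m]_x g x <= C.
Proof.
move=> mf mg f0 g0 fg fC.
apply: (@le_trans _ _ (\int[m]_x limn_einf (f ^~ x))).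
  apply: ae_ge0_le_integral => //.
  - move=> x _; rewrite limn_einf_lim; apply: lime_ge; first exact: is_cvg_einfs.
    by apply: nearW => n; apply: le_ereal_inf_tmp => _ [k _ <-].
  - exact: measurable_fun_limn_einf.
  by apply: filterS fg => x fgx _; have [-> _] := cvg_limn_einf_sup fgx.
apply: (le_trans (fatou _ measurableT mf _)) => //.
rewrite limn_einf_lim; apply: lime_le; first exact: is_cvg_einfs.
apply: nearW => n; apply: (@le_trans _ _ (\int[m]_x f n x)) => //.
by apply: ereal_inf_lbound; exists n => /=.
Qed.

End fatou_bound.

(** * Squared L2 norms *)

Section square_integral.
Context d (T : measurableType d) (R : realType) (m : {measure set T -> \bar R}).
Implicit Types F G : T -> R.
Local Open Scope ereal_scope.

Definition sqint F : \bar R := \int[m]_z (F z ^+ 2)%:E.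

Lemma sqint_ge0 F : 0 <= sqint F.
Proof. by rewrite /sqint; pos. Qed.

Lemma sqintZ (k : R) F : measurable_fun setT F ->
  sqint (fun z => k * F z)%R = (k ^+ 2)%:E * sqint F.
Proof.
move=> mF; rewrite /sqint -ge0_integralkl; [|side..].
by apply: eq_integral => z _; rewrite exprMn EFinM.
Qed.

Lemma le_sqint F G : measurable_fun setT F -> measurable_fun setT G ->
  (forall z, `|F z| <= `|G z|)%R -> sqint F <= sqint G.
Proof.
move=> mF mG FG; apply: ge0_le_integralT; [by meas|by meas|by move=> z; pos|].
by move=> z; rewrite lee_fin -real_normK ?num_real// -[leRHS]real_normK ?num_real// lerXn2r ?nnegrE.
Qed.

Lemma sqint_mid F G : measurable_fun setT F -> measurable_fun setT G ->
  sqint (fun z => (F z + G z) / 2)%R + sqint (fun z => (F z - G z) / 2)%R =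
  2^-1%:E * (sqint F + sqint G).
Proof.
move=> mF mG; rewrite /sqint -!ge0_integralDT; [|side..].
rewrite -ge0_integralkl; [|side..].
by apply: eq_integral => z _; rewrite -!EFinD -EFinM; congr EFin; field.
Qed.

Lemma sqint_mid_le F G (C : \bar R) : measurable_fun setT F -> measurable_fun setT G ->
  sqint F <= C -> sqint G <= C -> sqint (fun z => (F z + G z) / 2)%R <= C.
Proof.
move=> mF mG FC GC; have C0 := le_trans (sqint_ge0 F) FC.
apply: (@le_trans _ _ (2^-1%:E * (sqint F + sqint G))).
  by rewrite -sqint_mid// leeDl// sqint_ge0.
apply: (@le_trans _ _ (2^-1%:E * (C + C))).
  by rewrite lee_wpmul2l ?lee_fin// leeD.
rewrite -[X in _ * (X + _)]mul1e -[X in _ * (_ + X)]mul1e -(mule_dbl _ ler01) muleA -EFinM.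
by rewrite mulr1 mulVf// mul1e.
Qed.

(** Young's inequality with a free parameter: the two sides differ by the integral of
    [t (F + (F - G) / t) ^ 2]. A small [t] gives convergence of norms, and [t = 1] gives
    finiteness. *)
Lemma sqint_absD_le (t : R) F G : (0 < t)%R ->
  measurable_fun setT F -> measurable_fun setT G ->
  sqint G <= (1 + t)%:E * sqint F + (1 + t^-1)%:E * sqint (fun z => F z - G z)%R.
Proof.
move=> t0 mF mG; have t10 : (0 <= 1 + t)%R by rewrite addr_ge0// ltW.
have t20 : (0 <= 1 + t^-1)%R by rewrite addr_ge0// invr_ge0 ltW.
rewrite /sqint -!ge0_integralkl; [|side..].
rewrite -ge0_integralDT; [|side..].
apply: ge0_le_integralT; [by meas|by meas|by move=> z; pos|].
move=> z; rewrite -!EFinM -EFinD lee_fin.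
rewrite -subr_ge0 (_ : (_ - _)%R = (t * (F z + t^-1 * (F z - G z)) ^+ 2)%R).
  by rewrite mulr_ge0 ?sqr_ge0// ltW.
by field; rewrite gt_eqF.
Qed.

Lemma sqint_add_le F G : measurable_fun setT F -> measurable_fun setT G ->
  sqint (fun z => F z + G z)%R <= 2%:E * (sqint F + sqint G).
Proof.
move=> mF mG; rewrite /sqint -ge0_integralDT; [|side..].
rewrite -ge0_integralkl; [|side..].
apply: ge0_le_integralT; [by meas|by meas|by move=> z; pos|].
move=> z; rewrite -EFinD -EFinM lee_fin -subr_ge0.
by rewrite (_ : (_ - _)%R = ((F z - G z) ^+ 2)%R) ?sqr_ge0//; ring.
Qed.

Lemma sqint_sub_le F G : measurable_fun setT F -> measurable_fun setT G ->
  sqint (fun z => F z - G z)%R <= 2%:E * (sqint F + sqint G).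
Proof.
move=> mF mG; rewrite (_ : sqint G = sqint (fun z => - G z)%R).
  by apply: sqint_add_le => //; meas.
by apply: eq_integral => z _; rewrite sqrrN.
Qed.

Lemma sqint_subC F G : sqint (fun z => F z - G z)%R = sqint (fun z => G z - F z)%R.
Proof. by apply: eq_integral => z _; rewrite -sqrrN opprB. Qed.

Lemma sqint_fatou (F_ : nat -> T -> R) F (C : \bar R) :
  (forall n, measurable_fun setT (F_ n)) -> measurable_fun setT F ->
  {ae m, forall z, F_ n z @[n --> \oo] --> F z} ->
  (forall n, sqint (F_ n) <= C) -> sqint F <= C.
Proof.
move=> mF_ mF F_F; apply: le_integral_cvg_ae.
- by move=> n; meas.
- by meas.
- by move=> n z; pos.
- by move=> z; pos.
apply: filterS F_F => z Fz; apply/fine_cvgP; split; first exact: nearW.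
by under eq_fun do rewrite /= expr2; rewrite expr2; exact: cvgM.
Qed.

(* Fatou turns a Cauchy sequence with an a.e. limit into a convergent one. *)
Lemma sqint_cauchy_cvg (F_ : nat -> T -> R) F (e : \bar R) (N : nat) :
  (forall n, measurable_fun setT (F_ n)) -> measurable_fun setT F ->
  {ae m, forall z, F_ n z @[n --> \oo] --> F z} ->
  (forall n k, (N <= n)%N -> (N <= k)%N -> sqint (fun z => F_ n z - F_ k z)%R <= e) ->
  forall n, (N <= n)%N -> sqint (fun z => F_ n z - F z)%R <= e.
Proof.
move=> mF_ mF F_F cF n Nn.
apply: (@sqint_fatou (fun k z => F_ n z - F_ (k + N)%N z)%R).
- by move=> k; have := mF_ n; have := mF_ (k + N)%N => ? ?; meas.
- by have := mF_ n => ?; meas.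
- apply: filterS F_F => z Fz; apply: cvgB; first exact: cvg_cst.
  by have := Fz; rewrite -(cvg_shiftn N).
- by move=> k; apply: cF => //; exact: leq_addl.
Qed.

Lemma sqint_cvg (F_ : nat -> T -> R) F :
  (forall n, measurable_fun setT (F_ n)) -> measurable_fun setT F ->
  sqint F < +oo ->
  (forall e : R, (0 < e)%R -> exists N, forall n, (N <= n)%N ->
     sqint (fun z => F_ n z - F z)%R <= e%:E) ->
  fine (sqint (F_ n)) @[n --> \oo] --> fine (sqint F).
Proof.
move=> mF_ mF Ffin cF; apply/cvgrPdist_le => e e0.
have Ff : sqint F \is a fin_num by rewrite ge0_fin_numE ?sqint_ge0.
pose a : R := fine (sqint F).
have a0 : (0 <= a)%R by rewrite fine_ge0 ?sqint_ge0.
have aE : sqint F = a%:E by rewrite fineK.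
(* Chosen so that [t = e / s] satisfies both [t <= 1] and [2 t a <= e / 2]; the distance [dn] is
   then made at most [e / 4] divided by [1 + 1 / t]. *)
pose s : R := (e + 4 * (a + 1))%R.
have s0 : (0 < s)%R by rewrite /s; nra.
pose t : R := (e / s)%R.
have t0 : (0 < t)%R by rewrite divr_gt0.
have t1 : (t <= 1)%R by rewrite ler_pdivrMr// mul1r /s; nra.
have ta : (2 * t * a <= e / 2)%R.
  rewrite /t (_ : 2 * (e / s) * a = e / 2 * ((4 * a) / s))%R; last by field; rewrite gt_eqF.
  by rewrite ler_piMr ?divr_ge0 ?(ltW e0)// ler_pdivrMr// mul1r /s; nra.
have T0 : (0 < 1 + t^-1)%R by rewrite addr_gt0// invr_gt0.
have [N hN] := cF _ (divr_gt0 (divr_gt0 e0 (ltr0Sn R 3)) T0).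
near=> n; have Nn : (N <= n)%N by near: n; exact: nbhs_infty_ge.
have := hN n Nn; set dn := sqint _ => dn_le.
have dn0 : 0 <= dn by exact: sqint_ge0.
have dnf : dn \is a fin_num by rewrite ge0_fin_numE// (le_lt_trans dn_le) ?ltry.
have le1 := sqint_absD_le t0 mF (mF_ n).
have le2 := sqint_absD_le t0 (mF_ n) mF.
rewrite sqint_subC -/dn aE -(fineK dnf) -!EFinM -EFinD in le1.
rewrite -/dn in le2.
have nf : sqint (F_ n) \is a fin_num.
  by rewrite ge0_fin_numE ?sqint_ge0// (le_lt_trans le1) ?ltry.
have n0 : (0 <= fine (sqint (F_ n)))%R by rewrite fine_ge0 ?sqint_ge0.
rewrite aE -(fineK dnf) -(fineK nf) -!EFinM -EFinD lee_fin in le2.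
rewrite -(fineK nf) lee_fin in le1.
rewrite -(fineK dnf) lee_fin ler_pdivlMr// mulrC in dn_le.
rewrite -/a; move: (fine (sqint (F_ n))) n0 le1 le2 => b b0 le1 le2.
move: dn_le le1 le2; set D := ((1 + t^-1) * fine dn)%R => D4 le1 le2.
rewrite ler_norml; apply/andP; split; first by nra.
have : (t * b <= t * (2 * a + D))%R by apply: ler_wpM2l; [exact: ltW|nra].
have D0 : (0 <= D)%R by rewrite mulr_ge0 ?(ltW T0) ?fine_ge0.
have : (t * D <= D)%R by rewrite ler_piMl.
by move=> h1 h2; nra.
Unshelve. all: by end_near. Qed.

(** The sum of the series has a finite integral, so it is finite a.e., and each term is bounded by a
    tail of a convergent series. *)
Lemma ae_cvg0_nneseries (f : nat -> T -> R) :
  (forall n, measurable_fun setT (f n)) -> (forall n z, (0 <= f n z)%R) ->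
  \sum_(n <oo) \int[m]_z (f n z)%:E < +oo ->
  {ae m, forall z, f n z @[n --> \oo] --> 0%R}.
Proof.
move=> mf f0 sumf.
have mS : measurable_fun setT (fun z => \sum_(n <oo) (f n z)%:E).
  by apply: ge0_emeasurable_sum => // [k z _ _|k _]; [pos|have := mf k => ?; meas].
have fin : m.-integrable setT (fun z => \sum_(n <oo) (f n z)%:E).
  apply/integrableP; split=> //.
  rewrite (eq_integral (fun z => \sum_(n <oo) (f n z)%:E)); last first.
    by move=> z _; rewrite gee0_abs// nneseries_ge0// => n _ _; pos.
  rewrite integral_nneseries//.
    by move=> n; have := mf n => ?; meas.
  by move=> n z _; pos.
apply: filterS (integrable_ae measurableT fin) => z /(_ I).
rewrite ge0_fin_numE; last by rewrite nneseries_ge0// => n _ _; pos.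
have f0E n : 0 <= (f n z)%:E by pos.
move=> Sfin; have tail := nneseries_tail_cvg Sfin.
apply/cvgrPdist_le => e e0; near=> n.
rewrite sub0r normrN ger0_norm// -lee_fin.
apply: (@le_trans _ _ (\sum_(n <= k <oo) (f k z)%:E)).
  apply: le_trans (nneseries_lim_ge n.+1 _); first by rewrite big_nat1.
  by move=> k _ _; pos.
apply: ltW; near: n.
have /fine_cvgP[fin_tail /cvgrPdist_lt/(_ _ e0)] := tail (fun k _ => f0E k).
move=> lt_tail; near=> n.
rewrite -(@fineK _ (\sum_(n <= k <oo) (f k z)%:E)); last by near: n.
rewrite lte_fin (le_lt_trans (ler_norm _))//.
by near: n; apply: filterS lt_tail => n; rewrite /= sub0r normrN.
Unshelve. all: by end_near. Qed.

(** Indices with squared distance at most [2 ^ (- (n + 1))] make the squared differences summable.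
    The bound [n <= k n] serves to pass the Cauchy property on to the chosen terms. *)
Lemma sqint_cvg_subseq (F_ : nat -> T -> R) F :
  (forall n, measurable_fun setT (F_ n)) -> measurable_fun setT F ->
  (forall e : R, (0 < e)%R -> exists N, forall n, (N <= n)%N ->
     sqint (fun z => F_ n z - F z)%R <= e%:E) ->
  exists2 k : nat -> nat, (forall n, (n <= k n)%N) &
    {ae m, forall z, F_ (k n) z @[n --> \oo] --> F z}.
Proof.
move=> mF_ mF cF.
have /choice[k hk] n : exists k, (n <= k)%N /\
    sqint (fun z => F_ k z - F z)%R <= (1 / (2 ^ n.+1)%:R)%:E.
  have [N hN] : exists N, forall k, (N <= k)%N ->
     sqint (fun z => F_ k z - F z)%R <= (1 / (2 ^ n.+1)%:R)%:E.
    by apply: cF; rewrite divr_gt0// ltr0n expn_gt0.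
  exists (maxn N n); split; first exact: leq_maxr.
  by apply: hN; exact: leq_maxl.
exists k; first by move=> n; have [] := hk n.
have : {ae m, forall z, ((F_ (k n) z - F z) ^+ 2)%R @[n --> \oo] --> 0%R}.
  apply: ae_cvg0_nneseries.
  - by move=> n; have := mF_ (k n) => ?; meas.
  - by move=> n z; rewrite sqr_ge0.
  apply: (@le_lt_trans _ _ (\sum_(n <oo) (1 / (2 ^ n.+1)%:R)%:E)).
    apply: lee_nneseries => [n _ _|n _]; first exact: sqint_ge0.
    by have [] := hk n.
  by apply: le_lt_trans (epsilon_trick0 _ ler01) _; rewrite ltry.
apply: filterS => z; move=> /cvgrPdist_le sq; apply/cvgrPdist_le => e e0.
have := sq _ (exprn_gt0 2 e0); apply: filterS => n.
rewrite sub0r normrN normrX ler_pXn2r ?nnegrE ?(ltW e0)//.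
by rewrite distrC.
Qed.

End square_integral.

Section ae_product.
Context d1 d2 (T1 : measurableType d1) (T2 : measurableType d2) (R : realType).
Variables (m1 : {sigma_finite_measure set T1 -> \bar R})
          (m2 : {sigma_finite_measure set T2 -> \bar R}).
Local Open Scope ereal_scope.

Lemma ae_product_fst (P : T1 -> Prop) : {ae m1, forall x, P x} ->
  {ae (m1 \x m2), forall z, P z.1}.
Proof.
move=> [N [mN N0 PN]]; exists (N `*` setT); split.
- exact: measurableX.
- by rewrite product_measure1E//; move: N0 => /= ->; rewrite mul0e.
- by move=> z /= nP; split => //; exact: PN.
Qed.

Lemma ae_product_snd (P : T2 -> Prop) : {ae m2, forall x, P x} ->
  {ae (m1 \x m2), forall z, P z.2}.
Proof.
move=> [N [mN N0 PN]]; exists (setT `*` N); split.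
- exact: measurableX.
- by rewrite product_measure1E//; move: N0 => /= ->; rewrite mule0.
- by move=> z /= nP; split => //; exact: PN.
Qed.

End ae_product.

(** * Banach-Saks for midpoint hulls *)

Section banach_saks.
Context (R : realType) (X : Type).
Implicit Types (u : nat -> X -> R) (v w : X -> R) (n : nat).

Definition midpoint v w : X -> R := fun x => (v x + w x) / 2.

(** Closure under midpoints replaces the convex hull: the parallelogram identity involves nothing
    else, and bounds, pointwise limits and membership in a form domain pass to the hull by
    induction. *)
Inductive tail_hull u n : (X -> R) -> Prop :=
| tail_hull_seq k : (n <= k)%N -> tail_hull u n (u k)
| tail_hull_mid v w : tail_hull u n v -> tail_hull u n w ->
    tail_hull u n (midpoint v w).

Lemma tail_hull_le u n k v : (n <= k)%N -> tail_hull u k v -> tail_hull u n v.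
Proof.
move=> nk; elim => [l kl|v1 v2 _ h1 _ h2]; last exact: tail_hull_mid.
by apply: tail_hull_seq; exact: leq_trans kl.
Qed.

Lemma tail_hull_dist_le u n x (l e : R) v :
  (forall k, (n <= k)%N -> `|u k x - l| <= e) -> tail_hull u n v -> `|v x - l| <= e.
Proof.
move=> ue; elim => [k nk|v1 v2 _ h1 _ h2]; first exact: ue.
rewrite /midpoint (_ : _ - l = ((v1 x - l) + (v2 x - l)) / 2); last by field.
rewrite normrM [`|2^-1|]ger0_norm ?invr_ge0// ler_pdivrMr//.
by rewrite (le_trans (ler_normD _ _))// mulr_natr mulr2n lerD.
Qed.

Lemma tail_hull_cvg u (w_ : nat -> X -> R) x (l : R) :
  (forall n, tail_hull u n (w_ n)) ->
  u n x @[n --> \oo] --> l -> w_ n x @[n --> \oo] --> l.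
Proof.
move=> hw /cvgrPdist_le ul; apply/cvgrPdist_le => e e0.
have [N _ hN] := ul _ e0; exists N => // n Nn.
rewrite distrC; apply: (@tail_hull_dist_le u n) (hw n) => k nk.
by rewrite distrC; apply: hN => /=; exact: leq_trans nk.
Qed.

(* A minimizing sequence of a quadratic functional over the decreasing tail
   hulls is Cauchy, by the parallelogram identity. *)
Lemma banach_saks u (q : (X -> R) -> R) (C : R) :
  (forall v, tail_hull u 0 v -> 0 <= q v) ->
  (forall n, q (u n) <= C) ->
  (forall v w, tail_hull u 0 v -> tail_hull u 0 w ->
     q (midpoint v w) + q (fun x => v x - w x) / 4 = (q v + q w) / 2) ->
  exists2 w_, (forall n, tail_hull u n (w_ n)) &
    forall e, 0 < e -> exists N, forall n k, (N <= n)%N -> (N <= k)%N ->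
      q (fun x => w_ n x - w_ k x) <= e.
Proof.
move=> q0 qC par.
pose A n := [set q v | v in tail_hull u n].
have Alb n : has_lbound (A n).
  by exists 0 => _ [v hv <-]; apply: q0; exact: tail_hull_le hv.
have An0 n : A n !=set0 by exists (q (u n)), (u n) => //; exact: tail_hull_seq.
pose D n := inf (A n).
have Dle n v : tail_hull u n v -> D n <= q v.
  by move=> hv; apply: ge_inf => //; exists v.
have DC n : D n <= C by apply: le_trans (qC n); apply: Dle; exact: tail_hull_seq.
have Dnd : nondecreasing_seq D.
  move=> n k nk; apply: lb_le_inf => // _ [v hv <-].
  by apply: Dle; exact: tail_hull_le hv.
have Dub : has_ubound (range D) by exists C => _ [n _ <-].
have Dcvg := nondecreasing_cvgn Dnd Dub.
set L := sup (range D) in Dcvg.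
have DL n : D n <= L by apply: ub_le_sup => //; exists n.
have /choice[w_ hw] n : exists w, tail_hull u n w /\ q w < D n + n.+1%:R^-1.
  have n0 : 0 < n.+1%:R^-1 :> R by rewrite invr_gt0.
  have [_ [w hw <-] wlt] := inf_adherent n0 (conj (An0 n) (Alb n)).
  by exists w.
exists w_; first by move=> n; have [] := hw n.
move=> e e0.
(* The value of [q] at the midpoint is at least [D n], so the parallelogram identity gives
   [q (w_n - w_k) / 4 <= (D k - D n) / 2] plus the mean of the two errors. With each contribution at
   most [e / 8] this is at most [3 e / 16]. *)
have /cvgrPdist_le/(_ _ (divr_gt0 e0 (ltr0Sn R 7)))[N1 _ hN1] := Dcvg.
have /cvgrPdist_le/(_ _ (divr_gt0 e0 (ltr0Sn R 7)))[N2 _ hN2] := @cvg_harmonic R.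
exists (maxn N1 N2).
have main n k : (maxn N1 N2 <= n)%N -> (n <= k)%N -> q (fun x => w_ n x - w_ k x) <= e.
  rewrite geq_max => /andP[N1n N2n] nk.
  have [hn qn] := hw n; have [hk qk] := hw k.
  have hk' := tail_hull_le nk hk.
  have := Dle n _ (tail_hull_mid hn hk').
  have := par _ _ (tail_hull_le (leq0n n) hn) (tail_hull_le (leq0n k) hk).
  have := hN1 _ N1n; rewrite /= ger0_norm ?subr_ge0// => D1.
  have := hN2 _ N2n; rewrite /= sub0r normrN ger0_norm ?invr_ge0//.
  have k1 : (k.+1%:R^-1 <= n.+1%:R^-1 :> R) by rewrite lef_pV2 ?posrE// ler_nat ltnS.
  have := DL k; set h := n.+1%:R^-1 in k1 qn *.
  move: k1 qn qk D1; rewrite /harmonic/= -/h; move: (k.+1%:R^-1) => h'.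
  by lra.
move=> n k Nn Nk; have [nk|/ltnW kn] := leqP n k; first exact: main.
have := main k n Nk kn; have [hn _] := hw n; have [hk _] := hw k.
have hn0 := tail_hull_le (leq0n n) hn; have hk0 := tail_hull_le (leq0n k) hk.
(* [q] is an abstract functional, so its symmetry on differences is read off from two parallelogram
   identities with the same midpoint. *)
have := par _ _ hn0 hk0; have := par _ _ hk0 hn0.
rewrite (_ : midpoint (w_ n) (w_ k) = midpoint (w_ k) (w_ n)).
  by lra.
by apply/funext => x; rewrite /midpoint addrC.
Qed.

End banach_saks.

(** * The energy and ground state forms *)

Section pair_form.
Context {R : realType} {d : nat}.
Local Open Scope ereal_scope.
Local Notation mu := (@lebesgue_rV R d).
Local Notation V := 'rV[R]_d.
Variables (p : V -> R) (k : V * V -> R).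
Hypotheses (mp : measurable_fun setT p) (mk : measurable_fun setT k).
Implicit Types u v w : V -> R.

(** Linear in [u], with the square root of the kernel absorbed in [k]. With [p = 1] its squared L2
    norm is the energy, and with [p = 1 / phi] it is [G]; the L2 theory therefore serves both forms
    at once. *)
Definition pair_diff u (z : V * V) : R := ((u z.1 * p z.1 - u z.2 * p z.2) * k z)%R.

Definition pform u : \bar R := sqint (mu \x mu) (pair_diff u).

Lemma measurable_pair_diff u : measurable_fun setT u -> measurable_fun setT (pair_diff u).
Proof. by move=> mu_; rewrite /pair_diff; meas. Qed.

Lemma pform_ge0 u : 0 <= pform u.
Proof. exact: sqint_ge0. Qed.

Lemma pair_diffB u v : pair_diff (fun x => u x - v x)%R = (fun z => pair_diff u z - pair_diff v z)%R.
Proof. by apply/funext => z; rewrite /pair_diff; ring. Qed.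

Lemma pair_diff_mid u v :
  pair_diff (midpoint u v) = (fun z => (pair_diff u z + pair_diff v z) / 2)%R.
Proof. by apply/funext => z; rewrite /pair_diff /midpoint; field. Qed.

Lemma pformZ (c : R) u : measurable_fun setT u ->
  pform (fun x => c * u x)%R = (c ^+ 2)%:E * pform u.
Proof.
move=> mu_; rewrite /pform -sqintZ; last exact: measurable_pair_diff.
by congr sqint; apply/funext => z; rewrite /pair_diff; ring.
Qed.

Lemma pform_sub_le u v : measurable_fun setT u -> measurable_fun setT v ->
  pform (fun x => u x - v x)%R <= 2%:E * (pform u + pform v).
Proof.
by move=> mu_ mv; rewrite /pform pair_diffB; apply: sqint_sub_le; exact: measurable_pair_diff.
Qed.

Lemma pform_mid_le u v (C : \bar R) : measurable_fun setT u -> measurable_fun setT v ->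
  pform u <= C -> pform v <= C -> pform (midpoint u v) <= C.
Proof.
by move=> mu_ mv; rewrite /pform pair_diff_mid; apply: sqint_mid_le; exact: measurable_pair_diff.
Qed.

Lemma pform_mid u v : measurable_fun setT u -> measurable_fun setT v ->
  pform (midpoint u v) + 4^-1%:E * pform (fun x => u x - v x)%R =
  2^-1%:E * (pform u + pform v).
Proof.
move=> mu_ mv; have mU := measurable_pair_diff mu_; have mV := measurable_pair_diff mv.
rewrite /pform pair_diff_mid pair_diffB -(sqint_mid _ mU mV); congr (_ + _).
rewrite (_ : 4^-1 = (2^-1 : R) ^+ 2)%R; last by field.
rewrite -sqintZ; last by meas.
by congr sqint; apply/funext => z; rewrite mulrC.
Qed.

Lemma pair_diff_cvg (u_ : nat -> V -> R) u :
  {ae mu, forall x, u_ n x @[n --> \oo] --> u x} ->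
  {ae (mu \x mu), forall z, pair_diff (u_ n) z @[n --> \oo] --> pair_diff u z}.
Proof.
move=> cu; have h1 := ae_product_fst (@lebesgue_rV R d) cu.
have h2 := ae_product_snd (@lebesgue_rV R d) cu.
apply: (@filterS2 _ _ (ae_filter_ringOfSetsType (lebesgue_rV \x lebesgue_rV)) _ _ _ _ h1 h2) => z c1 c2.
rewrite /pair_diff.
apply: cvgM; last exact: cvg_cst.
by apply: cvgB; apply: cvgM; [exact: c1|exact: cvg_cst|exact: c2|exact: cvg_cst].
Qed.

Lemma pform_fatou (u_ : nat -> V -> R) u (C : \bar R) :
  (forall n, measurable_fun setT (u_ n)) -> measurable_fun setT u ->
  {ae mu, forall x, u_ n x @[n --> \oo] --> u x} ->
  (forall n, pform (u_ n) <= C) -> pform u <= C.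
Proof.
move=> mu_ mu cu; apply: sqint_fatou.
- by move=> n; exact: measurable_pair_diff.
- exact: measurable_pair_diff.
- exact: pair_diff_cvg.
Qed.

(** A form-Cauchy sequence with an a.e. limit converges to it in the form: pair differences inherit
    the a.e. convergence on the product space, and [sqint_cauchy_cvg] applies there. *)
Lemma pform_cauchy (u_ : nat -> V -> R) u :
  (forall n, measurable_fun setT (u_ n)) -> measurable_fun setT u ->
  (forall n, pform (u_ n) < +oo) ->
  {ae mu, forall x, u_ n x @[n --> \oo] --> u x} ->
  (forall e : R, (0 < e)%R -> exists N, forall n k, (N <= n)%N -> (N <= k)%N ->
     pform (fun x => u_ n x - u_ k x)%R <= e%:E) ->
  [/\ pform u < +oo,
      (forall e : R, (0 < e)%R -> exists N, forall n, (N <= n)%N ->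
         pform (fun x => u_ n x - u x)%R <= e%:E) &
      fine (pform (u_ n)) @[n --> \oo] --> fine (pform u)].
Proof.
move=> mu_ mu ufin cu cF.
have mU n := measurable_pair_diff (mu_ n); have mU' := measurable_pair_diff mu.
have cvgF e : (0 < e)%R -> exists N, forall n, (N <= n)%N ->
    sqint (lebesgue_rV \x lebesgue_rV) (fun z => pair_diff (u_ n) z - pair_diff u z)%R <= e%:E.
  move=> e0; have [N hN] := cF _ e0; exists N => n Nn.
  apply: (sqint_cauchy_cvg mU mU' (pair_diff_cvg cu)) Nn => i j Ni Nj.
  by rewrite -pair_diffB; exact: hN.
have uf : pform u < +oo.
  have [N hN] := cvgF _ ltr01.
  have := @sqint_absD_le _ _ _ (lebesgue_rV \x lebesgue_rV) _ _ _ ltr01 (mU N) mU'.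
  move=> /le_lt_trans; apply.
  apply: lte_add_pinfty; apply: lte_mul_pinfty => //; first exact: ufin.
  by apply: le_lt_trans (hN _ (leqnn _)) _; rewrite ltry.
split => //; last exact: sqint_cvg.
move=> e e0; have [N hN] := cvgF _ e0; exists N => n Nn.
by rewrite /pform pair_diffB; exact: hN.
Qed.

End pair_form.

Section hardy_identity.
Context {R : realType} {d : nat} (alpha : R).
Hypotheses (alpha_gt0 : (0 < alpha)%R) (alpha_lt2 : (alpha < 2)%R).
Hypotheses (d0 : (0 < d)%N) (alpha_ltd : (alpha < d%:R)%R).
#[local] Opaque Gamma.
Local Open Scope ereal_scope.
Local Notation mu := (@lebesgue_rV R d).
Local Notation V := 'rV[R]_d.
Local Notation a := ((d%:R - alpha) / 4 : R)%R.
Local Notation b := ((d%:R + alpha) / 4 : R)%R.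
Local Notation A := (stable_const d alpha).
Local Notation kappa := (kappa_star d alpha).
Implicit Types u v w : V -> R.

Let a0 : (0 < a)%R. Proof. by rewrite divr_gt0// subr_gt0. Qed.
Let b0 : (0 < b)%R. Proof. by rewrite divr_gt0// addr_gt0// ltr0n. Qed.
Let ab : (a < b)%R. Proof. by rewrite -subr_gt0 (_ : b - a = alpha / 2)%R ?divr_gt0//; field. Qed.
Let ba1 : (b - a < 1)%R.
Proof. by rewrite (_ : b - a = alpha / 2)%R ?ltr_pdivrMr// ?mul1r//; field. Qed.
Let dE : (d%:R / 2 = a + b)%R. Proof. by field. Qed.

Definition phi (x : V) : R := gphi a x.

Lemma phiE x : phi x = (enorm x `^ (- delta_star d alpha))%R.
Proof. by rewrite /phi /gphi; congr (_ `^ (- _))%R; rewrite /delta_star; field. Qed.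

Lemma measurable_phi : measurable_fun setT phi.
Proof. exact: measurable_gphi. Qed.

Lemma phi_ge0 x : (0 <= phi x)%R. Proof. exact: powR_ge0. Qed.

Lemma phi_gt0 x : x != 0%R -> (0 < phi x)%R.
Proof. exact: gphi_gt0. Qed.

Definition one_weight (x : V) : R := 1%R.
Definition energy_kernel (z : V * V) : R :=
  (Num.sqrt (A / 2) * enorm (z.1 - z.2) `^ (- (2 * b)))%R.
Definition inv_phi (x : V) : R := ((phi x)^-1)%R.
(** The square root makes the squared pair difference the integrand of [G]. At the origin [phi],
    [inv_phi] and this kernel are all 0 by default. *)
Definition ground_kernel (z : V * V) : R :=
  (Num.sqrt (phi z.1 * phi z.2) * energy_kernel z)%R.

Lemma measurable_energy_kernel : measurable_fun setT energy_kernel.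
Proof. by rewrite /energy_kernel; meas. Qed.

Lemma measurable_ground_kernel : measurable_fun setT ground_kernel.
Proof.
have := measurable_energy_kernel; have := measurable_phi => mp mk.
rewrite /ground_kernel; apply: measurable_funM => //.
apply: measurableT_comp; first exact: (continuous_measurable_fun (@sqrt_continuous R)).
by meas.
Qed.

Lemma measurable_inv_phi : measurable_fun setT inv_phi.
Proof. by have := measurable_phi => mp; rewrite /inv_phi; meas. Qed.

Definition energy u : \bar R := pform one_weight energy_kernel u.
Definition gform u : \bar R := pform inv_phi ground_kernel u.
Definition hardy_mass u : \bar R := \int[mu]_x (u x ^+ 2 * enorm x `^ (- alpha))%:E.
Local Notation L := (sqint mu).
Local Notation W := hardy_mass.

Lemma stable_const_gt0 : (0 < A)%R.
Proof.
have G1 : (0 < Gamma ((alpha + d%:R) / 2))%R.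
  by apply: Gamma_gt0; rewrite divr_gt0// addr_gt0// ltr0n.
have G2 : (0 < Gamma (1 - alpha / 2))%R.
  by apply: Gamma_gt0; rewrite subr_gt0 ltr_pdivrMr// mul1r.
rewrite /stable_const; apply: divr_gt0.
  exact: mulr_gt0 (mulr_gt0 alpha_gt0 (powR_gt0 _ (ltr0Sn _ 1))) G1.
exact: mulr_gt0 (powR_gt0 _ (pi_gt0 R)) G2.
Qed.

Lemma kappa_gt0 : (0 < kappa)%R.
Proof.
have Ga := Gamma_gt0 a0; have Gb := Gamma_gt0 b0.
rewrite /kappa_star.
exact: divr_gt0 (mulr_gt0 (powR_gt0 _ (ltr0Sn _ 1)) (exprn_gt0 2 Gb)) (exprn_gt0 2 Ga).
Qed.

Lemma energy_kernel_sqr z :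
  (energy_kernel z ^+ 2 = A / 2 * enorm (z.1 - z.2) `^ (- (4 * b)))%R.
Proof.
rewrite /energy_kernel exprMn sqr_sqrtr; last by rewrite divr_ge0// ltW// stable_const_gt0.
rewrite -powR_mulrn ?powR_ge0// -powRrM; congr (_ * _ `^ _)%R; ring.
Qed.

Lemma energyE u : measurable_fun setT u ->
  energy u = (A / 2)%:E * \int[mu \x mu]_z
    (dirichlet_sq u z * enorm (z.1 - z.2)%R `^ (- (4 * b)))%:E.
Proof.
move=> mu_; have A0 := stable_const_gt0.
have A20 : (0 <= A / 2)%R by rewrite divr_ge0// ltW.
rewrite -ge0_integralkl; last 4 first.
- by [].
- by rewrite /dirichlet_sq; meas.
- by move=> z; rewrite /dirichlet_sq; pos.
- by pos.
apply: eq_integral => z _; rewrite -EFinM /pair_diff exprMn energy_kernel_sqr; congr EFin.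
by rewrite /one_weight /dirichlet_sq; ring.
Qed.

Lemma gformE u : measurable_fun setT u ->
  gform u = (A / 2)%:E * \int[mu \x mu]_z
    (ground_sq a u z * enorm (z.1 - z.2)%R `^ (- (4 * b)))%:E.
Proof.
move=> mu_; have A0 := stable_const_gt0; have mp := measurable_phi.
have A20 : (0 <= A / 2)%R by rewrite divr_ge0// ltW.
have mphi : measurable_fun setT (@gphi R d a) := mp.
have phi0 := @gphi_ge0 R d a.
rewrite -ge0_integralkl; last 4 first.
- by [].
- by rewrite /ground_sq; meas.
- by move=> z; rewrite /ground_sq; pos.
- by pos.
apply: eq_integral => z _; rewrite -EFinM /pair_diff exprMn [(ground_kernel z ^+ 2)%R]exprMn.
rewrite energy_kernel_sqr sqr_sqrtr ?mulr_ge0 ?phi_ge0//; congr EFin.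
rewrite /inv_phi /ground_sq /phi.
by move: (gphi a z.1) (gphi a z.2) (enorm _ `^ _)%R => x y e; ring.
Qed.

Lemma stable_energyE u : measurable_fun setT u -> stable_energy alpha u = energy u.
Proof.
move=> mu_; rewrite energyE// /stable_energy; congr (_ * _).
rewrite integral_mkcond; apply: eq_integral => -[x y] _; rewrite patchE /dirichlet_sq/=.
rewrite (_ : 4 * b = d%:R + alpha)%R; last by field.
case: ifPn => [_|]; first by rewrite powRN.
by rewrite notin_setE/= => /negP/negPn/eqP ->; rewrite subrr expr0n mul0r.
Qed.

Lemma ground_state_identity u : measurable_fun setT u -> L u < +oo -> W u < +oo ->
  energy u = gform u + kappa%:E * W u.
Proof.
move=> mu_ Lfin Wfin; rewrite energyE// gformE//.
have alphaE : (2 * (b - a) = alpha)%R by field.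
have Wfin' : \int[mu]_x (u x ^+ 2 * enorm x `^ (- (2 * (b - a))))%:E < +oo.
  by rewrite alphaE.
rewrite (ground_state_representation d0 a0 ab ba1 dE mu_ Lfin Wfin').
have A0 := stable_const_gt0.
have Ga := Gamma_gt0 a0.
have G2b : (0 < Gamma (2 * b))%R by apply: Gamma_gt0; rewrite mulr_gt0.
have G1 : (0 < Gamma (1 - alpha / 2))%R.
  by apply: Gamma_gt0; rewrite subr_gt0 ltr_pdivrMr// mul1r.
have baE : (b - a = alpha / 2)%R by field.
rewrite alphaE baE ge0_muleDr; last 2 first.
- apply: integral_ge0 => z _; rewrite lee_fin.
  exact: mulr_ge0 (mulr_ge0 (sqr_ge0 _) (mulr_ge0 (gphi_ge0 _ _) (gphi_ge0 _ _))) (powR_ge0 _ _).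
- apply: mule_ge0; last by rewrite /hardy_mass; pos.
  rewrite lee_fin; apply/ltW/divr_gt0.
    exact: mulr_gt0 (mulr_gt0 (mulr_gt0 (ltr0Sn _ 1) (powR_gt0 _ (pi_gt0 R))) (exprn_gt0 2 (Gamma_gt0 b0))) G1.
  exact: mulr_gt0 (mulr_gt0 (exprn_gt0 2 Ga) G2b) (divr_gt0 alpha_gt0 (ltr0Sn _ 1)).
congr (_ + _); rewrite muleA -EFinM; congr (EFin _ * _).
(* The factors [Gamma (2 b)], [pi ^ (d / 2)] and [Gamma (1 - alpha / 2)] cancel against
   [stable_const], and [2 ^ (alpha - 1)] divided by [1 / 2] leaves the [2 ^ alpha] of
   [kappa_star]. *)
rewrite /stable_const /kappa_star -dE (_ : (alpha + d%:R) / 2 = 2 * b)%R; last by field.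
rewrite (gt0_powRD alpha (-1) (ltr0Sn R 1)) powR_inv1//.
have pn0 : (pi `^ (d%:R / 2) != 0 :> R)%R by rewrite gt_eqF// powR_gt0// pi_gt0.
move: (Gamma a) (Gamma b) (Gamma (2 * b)) (Gamma (1 - alpha / 2)) (pi `^ (d%:R / 2))%R
  (2 `^ alpha)%R (lt0r_neq0 Ga) (lt0r_neq0 G2b) (lt0r_neq0 G1) pn0 => x1 x2 x3 x4 x5 x6 h1 h3 h4 h5.
by field; rewrite h1 h3 h4 h5 !gt_eqF.
Qed.

End hardy_identity.

(** * Hardy's inequality *)

Section Lnorm2.
Context d (T : measurableType d) (R : realType) (m : {measure set T -> \bar R}).
Implicit Types f : T -> R.
Local Open Scope ereal_scope.

Lemma Lnorm2E f : Lnorm m 2%:E (EFin \o f) = sqint m f `^ 2^-1.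
Proof.
rewrite unlock; congr (_ `^ _); apply: eq_integral => x _.
transitivity ((`|f x|%R)%:E `^ 2); first by [].
by rewrite poweR_EFin powR_mulrn ?normr_ge0// real_normK ?num_real.
Qed.

Lemma finite_norm2 f : finite_norm m 2%:E f <-> sqint m f < +oo.
Proof.
rewrite /finite_norm Lnorm2E; have := sqint_ge0 m f.
case: (sqint m f) => [r r0|_|//].
  by rewrite poweR_EFin !ltry.
by rewrite poweRyr// invr_eq0.
Qed.

Lemma Lnorm2_cvg0 (f_ : nat -> T -> R) :
  Lnorm m 2%:E (EFin \o f_ n) @[n --> \oo] --> 0 <->
  (forall e : R, (0 < e)%R -> exists N, forall n, (N <= n)%N -> sqint m (f_ n) <= e%:E).
Proof.
split.
  move=> /fine_cvgP[fin /cvgrPdist_le cv] e e0.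
  have s0 : (0 < Num.sqrt e)%R by rewrite sqrtr_gt0.
  have [N _ hN] := filterI fin (cv _ s0); exists N => n Nn.
  have [/= nf] := hN _ Nn; rewrite sub0r normrN.
  move: nf; rewrite Lnorm2E; have := sqint_ge0 m (f_ n).
  case: (sqint m (f_ n)) => [r|_|//]; last by rewrite poweRyr// invr_eq0.
  rewrite !lee_fin => r0 _; rewrite poweR_EFin/= powR12_sqrt// ger0_norm ?sqrtr_ge0//.
  by rewrite ler_sqrt// ltW.
move=> h; apply/fine_cvgP.
have fin n r : sqint m (f_ n) <= r%:E ->
    [/\ Lnorm m 2%:E (EFin \o f_ n) = (Num.sqrt (fine (sqint m (f_ n))))%:E &
        (fine (sqint m (f_ n)) <= r)%R].
  rewrite Lnorm2E; have := sqint_ge0 m (f_ n).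
  case: (sqint m (f_ n)) => [s|//|//].
  by rewrite !lee_fin => s0 sr; rewrite poweR_EFin powR12_sqrt.
split.
  have [N hN] := h _ ltr01; exists N => // n Nn /=.
  by have [-> _] := fin _ _ (hN _ Nn).
apply/cvgrPdist_le => e e0; have [N hN] := h _ (exprn_gt0 2 e0); exists N => // n Nn /=.
have [-> le] := fin _ _ (hN _ Nn).
rewrite /= sub0r normrN ger0_norm ?sqrtr_ge0//.
apply: (@le_trans _ _ (Num.sqrt (e ^+ 2))); first exact: ler_wsqrtr.
by rewrite sqrtr_sqr ger0_norm// ltW.
Qed.

End Lnorm2.

Section truncation.
Context {R : realType}.
Implicit Types s t : R.
Local Open Scope ring_scope.

(** A contraction fixing 0, so it increases neither the energy nor the L2 norm, while boundedness
    makes the Hardy mass finite. *)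
Definition trunc (n : nat) (s : R) : R := Num.max (- n%:R) (Num.min s n%:R).

Lemma trunc_le n s : `|trunc n s| <= n%:R.
Proof.
have n0 : 0 <= n%:R :> R by [].
rewrite /trunc ler_norml; apply/andP; split; first by rewrite le_max lexx.
by rewrite ge_max ge_min lexx orbT andbT (le_trans _ n0)// oppr_le0.
Qed.

Lemma max_dist_le c s t : `|Num.max c s - Num.max c t| <= `|s - t|.
Proof.
have h1 := ler_norm (s - t); have h2 := ler_norm (t - s); rewrite distrC in h2.
by case: (leP c s) => cs; case: (leP c t) => ct; rewrite ler_norml; apply/andP; split; lra.
Qed.

Lemma min_dist_le c s t : `|Num.min s c - Num.min t c| <= `|s - t|.
Proof.
have h1 := ler_norm (s - t); have h2 := ler_norm (t - s); rewrite distrC in h2.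
by case: (leP s c) => cs; case: (leP t c) => ct; rewrite ler_norml; apply/andP; split; lra.
Qed.

Lemma trunc_dist_le n s t : `|trunc n s - trunc n t| <= `|s - t|.
Proof.
apply: le_trans (max_dist_le _ _ _) _; exact: min_dist_le.
Qed.

Lemma trunc0 n : trunc n 0 = 0.
Proof.
have n0 : 0 <= n%:R :> R by [].
by rewrite /trunc min_l// max_r// oppr_le0.
Qed.

Lemma trunc_norm_le n s : `|trunc n s| <= `|s|.
Proof. by have := trunc_dist_le n s 0; rewrite trunc0 !subr0. Qed.

Lemma trunc_cvg s : trunc n s @[n --> \oo] --> s.
Proof.
apply/cvgrPdist_le => e e0; near=> n.
have ns : `|s| <= n%:R by near: n; exact: nbhs_infty_ger.
rewrite /trunc; move: ns; rewrite ler_norml => /andP[ns sn].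
by rewrite min_l// max_r// subrr normr0 ltW.
Unshelve. all: by end_near. Qed.

End truncation.

Section hardy_inequality.
Context {R : realType} {d : nat} (alpha : R).
Hypotheses (alpha_gt0 : (0 < alpha)%R) (alpha_lt2 : (alpha < 2)%R).
Hypotheses (d0 : (0 < d)%N) (alpha_ltd : (alpha < d%:R)%R).
#[local] Opaque Gamma.
Local Open Scope ereal_scope.
Local Notation mu := (@lebesgue_rV R d).
Local Notation V := 'rV[R]_d.
Local Notation kappa := (kappa_star d alpha).
Local Notation L := (sqint mu).
Local Notation W := (hardy_mass alpha).
Local Notation energy := (energy alpha).
Local Notation gform := (gform alpha).
Implicit Types u v w : V -> R.

Let gsi := ground_state_identity alpha_gt0 alpha_lt2 d0 alpha_ltd.
Let kappa0 : (0 < kappa)%R := kappa_gt0 alpha_gt0 d0 alpha_ltd.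

Definition mass_map u (x : V) : R := (u x * enorm x `^ (- (alpha / 2)))%R.

Lemma measurable_mass_map u : measurable_fun setT u -> measurable_fun setT (mass_map u).
Proof. by move=> mu_; rewrite /mass_map; meas. Qed.

Lemma hardy_massE u : W u = sqint mu (mass_map u).
Proof.
apply: eq_integral => x _; congr EFin; rewrite /mass_map exprMn; congr (_ * _)%R.
by rewrite -powR_mulrn ?powR_ge0// -powRrM; congr (_ `^ _)%R; field.
Qed.

Lemma hardy_mass_ge0 u : 0 <= W u.
Proof. by rewrite hardy_massE sqint_ge0. Qed.

Lemma le_energy u v : measurable_fun setT u -> measurable_fun setT v ->
  (forall x y, `|v x - v y| <= `|u x - u y|)%R -> energy v <= energy u.
Proof.
move=> mu_ mv h; have mk := @measurable_energy_kernel R d alpha.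
have m1 : measurable_fun setT (@one_weight R d) by rewrite /one_weight; meas.
apply: le_sqint; try exact: measurable_pair_diff.
by move=> z; rewrite /pair_diff /one_weight !mulr1 !normrM ler_wpM2r.
Qed.

(** Near the origin the weight is integrable because [alpha < d]; away from it the weight is at most
    1 and [L u] takes over. *)
Lemma hardy_mass_bounded u (n : nat) : measurable_fun setT u -> L u < +oo ->
  (forall x, `|u x| <= n%:R)%R -> W u < +oo.
Proof.
move=> mu_ Lfin un.
have [C C0 hC] := integral_power_gauss_le d0 alpha_gt0 alpha_ltd.
(* The factor [expR 1] offsets the Gaussian in [h], which is at least [exp (- 1)] on the unit
   ball. *)
pose c : R := (n%:R ^+ 2 * expR 1)%R.
have c0 : (0 <= c)%R by rewrite /c; pos.
pose h (x : V) : R := (enorm x `^ (- alpha) * expR (- (1 * enorm x ^+ 2)))%R.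
have mh : measurable_fun setT h by rewrite /h; meas.
have h0 x : (0 <= h x)%R by rewrite /h; pos.
apply: (@le_lt_trans _ _ (c%:E * (\int[mu]_x (h x)%:E) + L u)); last first.
  apply: lte_add_pinfty => //; apply: lte_mul_pinfty => //.
  by apply: le_lt_trans (hC _ ltr01) _; rewrite ltry.
rewrite /sqint -ge0_integralkl; [|side..].
rewrite -ge0_integralDT; [|side..].
apply: ge0_le_integralT; [by meas|by meas|by move=> x; pos|].
move=> x; rewrite -EFinM -EFinD lee_fin.
have un2 : (u x ^+ 2 <= n%:R ^+ 2)%R.
  by rewrite -real_normK ?num_real// lerXn2r ?nnegrE.
have p0 := powR_ge0 (enorm x) (- alpha).
have [x1|x1] := leP (enorm x) 1%R.
  apply: ler_wpDr; first exact: sqr_ge0.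
  have key : (1 <= expR 1 * expR (- (1 * enorm x ^+ 2)) :> R)%R.
    rewrite -expRD -[leLHS]expR0 ler_expR mul1r subr_ge0.
    by rewrite expr_le1// enorm_ge0.
  rewrite /c /h (_ : (_ * _ * (_ * _) = n%:R ^+ 2 * enorm x `^ (- alpha) *
    (expR 1 * expR (- (1 * enorm x ^+ 2))))%R); last by ring.
  apply: (le_trans (ler_wpM2r p0 un2)); apply: ler_peMr => //.
  by rewrite mulr_ge0// sqr_ge0.
apply: ler_wpDl; first by rewrite mulr_ge0.
apply: ler_piMr; first exact: sqr_ge0.
have := @ge0_ler_powR R alpha (ltW alpha_gt0) 1%R (enorm x).
rewrite !nnegrE powR1 => /(_ ler01 (enorm_ge0 _) (ltW x1)) h1.
by rewrite powRN invf_le1// (lt_le_trans ltr01).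
Qed.

(** The ground state identity needs a finite Hardy mass. It is applied to truncations, where
    [G >= 0] gives the inequality; their energies do not exceed that of [u], and Fatou's lemma
    removes the truncation. *)
Lemma hardy_inequality u : measurable_fun setT u -> L u < +oo -> kappa%:E * W u <= energy u.
Proof.
move=> mu_ Lfin; rewrite -lee_pdivlMl// hardy_massE.
pose v n x := trunc n (u x).
have mv n : measurable_fun setT (v n) by rewrite /v /trunc; meas.
apply: (@sqint_fatou _ _ _ mu (fun n => mass_map (v n))).
- by move=> n; exact: measurable_mass_map.
- exact: measurable_mass_map.
- apply: nearW => x; apply: cvgM; last exact: cvg_cst.
  exact: trunc_cvg.
move=> n; rewrite -hardy_massE lee_pdivlMl//.
have Lv : L (v n) < +oo.
  by apply: le_lt_trans Lfin; apply: le_sqint => // x; exact: trunc_norm_le.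
have Wv : W (v n) < +oo by apply: (@hardy_mass_bounded _ n) => // x; exact: trunc_le.
apply: (@le_trans _ _ (energy (v n))).
  by rewrite gsi// leeDr// pform_ge0.
by apply: le_energy => // x y; exact: trunc_dist_le.
Qed.

Lemma hardy_mass_fin u : measurable_fun setT u -> L u < +oo -> energy u < +oo -> W u < +oo.
Proof.
move=> mu_ Lfin Efin; have := le_lt_trans (hardy_inequality mu_ Lfin) Efin.
have := hardy_mass_ge0 u; case: (W u) => [r _ _|_|//]; first by rewrite ltry.
by rewrite gt0_muley.
Qed.

Lemma gform_le_energy u : measurable_fun setT u -> L u < +oo -> energy u < +oo ->
  gform u <= energy u.
Proof.
move=> mu_ Lfin Efin; have Wfin := hardy_mass_fin mu_ Lfin Efin.
by rewrite (gsi mu_ Lfin Wfin) leeDl// mule_ge0 ?hardy_mass_ge0// lee_fin ltW.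
Qed.

Lemma fine_gform u : measurable_fun setT u -> L u < +oo -> energy u < +oo ->
  fine (gform u) = (fine (energy u) - kappa * fine (W u))%R.
Proof.
move=> mu_ Lfin Efin; have Wfin := hardy_mass_fin mu_ Lfin Efin.
have Gfin := le_lt_trans (gform_le_energy mu_ Lfin Efin) Efin.
rewrite (gsi mu_ Lfin Wfin).
have -> : gform u = (fine (gform u))%:E.
  by rewrite fineK// ge0_fin_numE// pform_ge0.
have -> : W u = (fine (W u))%:E by rewrite fineK// ge0_fin_numE// hardy_mass_ge0.
by rewrite -EFinM -EFinD/= addrK.
Qed.

End hardy_inequality.

(** * Closures and extended spaces of represented forms *)

Lemma near_infty2P (P : nat -> nat -> Prop) :
  (\forall n & m \near \oo, P n m) <->
  exists N, forall n m, (N <= n)%N -> (N <= m)%N -> P n m.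
Proof.
split.
  move=> [[/= A B]] [[N1 _ hN1] [N2 _ hN2]] AB.
  exists (maxn N1 N2) => n m; rewrite !geq_max => /andP[n1 _] /andP[_ m2].
  by apply: (AB (n, m)); split; [exact: hN1|exact: hN2].
move=> [N hN]; exists ([set n | (N <= n)%N], [set n | (N <= n)%N]) => /=.
  by split; exists N.
by move=> [n m] /= [Nn Nm]; exact: hN.
Qed.

Section represented_form.
Context {R : realType} {d : nat}.
Local Open Scope ereal_scope.
Local Notation mu := (@lebesgue_rV R d).
Local Notation V := 'rV[R]_d.
Local Notation L := (sqint mu).
Variables (p : V -> R) (k : V * V -> R).
Hypotheses (mp : measurable_fun setT p) (mk : measurable_fun setT k).
Local Notation F := (pform p k).
Implicit Types (a : qform V R) (u v : V -> R).

Definition seq_cauchy (u_ : nat -> V -> R) :=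
  forall e : R, (0 < e)%R -> exists N, forall n m, (N <= n)%N -> (N <= m)%N ->
    F (fun x => u_ n x - u_ m x)%R <= e%:E.

Definition L2_cvg (u_ : nat -> V -> R) u :=
  forall e : R, (0 < e)%R -> exists N, forall n, (N <= n)%N ->
    L (fun x => u_ n x - u x)%R <= e%:E.

(** The form is the restriction of a functional [F] defined on all measurable functions, so limits
    can be identified outside the domain. It will cover the stable form, the Hardy form on C0
    functions and its closure. *)
Definition represented a :=
  [/\ forall u, qdom a u -> [/\ measurable_fun setT u, L u < +oo & F u < +oo],
      forall u, qdom a u -> a u = fine (F u) &
      forall u v, qdom a u -> qdom a v -> qdom a (fun x => u x - v x)%R].

Lemma represented_cauchyP a (u_ : nat -> V -> R) : represented a -> (forall n, qdom a (u_ n)) ->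
  form_cauchy a u_ <-> seq_cauchy u_.
Proof.
move=> [fin val sub] du.
have valE n m : `|a (fun x => u_ n x - u_ m x)|%R = fine (F (fun x => u_ n x - u_ m x)%R).
  by rewrite val; [rewrite ger0_norm// fine_ge0// pform_ge0|exact: sub].
have finE n m : F (fun x => u_ n x - u_ m x)%R \is a fin_num.
  by rewrite ge0_fin_numE ?pform_ge0//; have [] := fin _ (sub _ _ (du n) (du m)).
split=> h e e0.
  have /near_infty2P[N hN] := h _ e0; exists N => n m Nn Nm.
  by rewrite -(fineK (finE n m)) lee_fin -valE ltW// hN.
have [N hN] := h _ (divr_gt0 e0 (ltr0Sn R 1)).
apply/near_infty2P; exists N => n m Nn Nm; rewrite valE.
have := hN n m Nn Nm; rewrite -(fineK (finE n m)) lee_fin => /le_lt_trans; apply.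
by rewrite ltr_pdivrMr// ltr_pMr// ltr1n.
Qed.

Lemma get_unique_real (A : set R) (l : R) : A l -> (forall l', A l' -> l' = l) -> get A = l.
Proof. by move=> Al h; apply: h; apply: getPex; exists l. Qed.

Section extended.
Variables (a : qform V R) (ra : represented a) (u : V -> \bar R).
Hypotheses (mu_ : measurable_fun setT u) (ufin : {ae mu, forall x, `|u x| < +oo}).

Lemma ext_approx_cvg (u_ : nat -> V -> R) : ext_approx mu a u_ u ->
  [/\ {ae mu, forall x, u_ n x @[n --> \oo] --> fine (u x)},
      F (fine \o u) < +oo,
      (forall e : R, (0 < e)%R -> exists N, forall n, (N <= n)%N ->
         F (fun x => u_ n x - fine (u x))%R <= e%:E) &
      a (u_ n) @[n --> \oo] --> fine (F (fine \o u))].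
Proof.
move=> [du /(represented_cauchyP ra du) cu uu].
have [fin val sub] := ra.
have cvu : {ae mu, forall x, u_ n x @[n --> \oo] --> fine (u x)}.
  apply: filterS2 ufin uu => x; rewrite -fin_num_abs => ux.
  by rewrite -(fineK ux) => /fine_cvgP[].
have mfu : measurable_fun setT (fine \o u) by exact: measurableT_comp.
have mu_n n : measurable_fun setT (u_ n) by have [] := fin _ (du n).
have Fn n : F (u_ n) < +oo by have [] := fin _ (du n).
have [h1 h2 h3] := pform_cauchy mp mk mu_n mfu Fn cvu cu.
split => //; rewrite (_ : (fun n => a (u_ n)) = (fun n => fine (F (u_ n)))) //.
by apply/funext => n; rewrite val.
Qed.

(** Every approximating sequence gives the same limit, the value of [F] at the real part of [u];
    this makes the choice by [get] legitimate. *)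
Lemma ext_valE : ext_dom mu a u -> ext_val mu a u = fine (F (fine \o u)).
Proof.
move=> [_ _ [u_ hu]]; apply: get_unique_real.
  by exists u_; split => //; have [] := ext_approx_cvg hu.
move=> l [v_ [hv cv]]; have [_ _ _ cv'] := ext_approx_cvg hv.
exact: (cvg_unique _ cv cv').
Qed.

End extended.

Lemma ext_dom_intro a (u_ : nat -> V -> R) u : represented a -> measurable_fun setT u ->
  (forall n, qdom a (u_ n)) -> seq_cauchy u_ ->
  {ae mu, forall x, u_ n x @[n --> \oo] --> u x} ->
  ext_dom mu a (EFin \o u).
Proof.
move=> ra mu_ du cu uu; split.
- exact/measurable_EFinP.
- by apply: nearW => x /=; rewrite ltry.
exists u_; split => //; first exact/represented_cauchyP.
apply: filterS uu => x ux; apply/fine_cvgP; split; first exact: nearW.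
exact: ux.
Qed.

Section closure.
Variables (a : qform V R) (ra : represented a).

Let fin := let: And3 h _ _ := ra in h.
Let val := let: And3 _ h _ := ra in h.
Let sub := let: And3 _ _ h := ra in h.

(** Closability in substance: the limit is [F u] whatever the sequence. L2 convergence gives an a.e.
    convergent selection, which controls [F u]. *)
Lemma closure_approx_cvg (u_ : nat -> V -> R) u : measurable_fun setT u -> closure_approx mu a u_ u ->
  [/\ F u < +oo,
      (forall e : R, (0 < e)%R -> exists N, forall n, (N <= n)%N ->
         F (fun x => u_ n x - u x)%R <= e%:E) &
      a (u_ n) @[n --> \oo] --> fine (F u)].
Proof.
move=> mu_ [du /(represented_cauchyP ra du) cu /Lnorm2_cvg0 Lu].
have mu_n n : measurable_fun setT (u_ n) by have [] := fin (du n).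
have Fn n : F (u_ n) < +oo by have [] := fin (du n).
have [j jn ju] := sqint_cvg_subseq mu_n mu_ Lu.
have cuj : seq_cauchy (fun n => u_ (j n)).
  move=> e e0; have [N hN] := cu _ e0; exists N => n m Nn Nm.
  by apply: hN; [exact: leq_trans (jn _)|exact: leq_trans (jn _)].
have [h1 h2 _] := pform_cauchy mp mk (fun n => mu_n (j n)) mu_ (fun n => Fn (j n)) ju cuj.
(* Back from the selected indices to the whole sequence: [u_ n] is kept fixed and Fatou's lemma is
   applied along [u_ (j i)]. *)
have h3 e : (0 < e)%R -> exists N, forall n, (N <= n)%N ->
    F (fun x => u_ n x - u x)%R <= e%:E.
  move=> e0; have [N hN] := cu _ e0; exists N => n Nn.
  apply: (@pform_fatou _ _ _ _ mp mk (fun i x => u_ n x - u_ (j (i + N)%N) x)%R).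
  - by move=> i; have := mu_n n; have := mu_n (j (i + N)%N) => ? ?; meas.
  - by have := mu_n n => ?; meas.
  - apply: filterS ju => x ux; apply: cvgB; first exact: cvg_cst.
    by have := ux; rewrite -(cvg_shiftn N).
  move=> i; apply: hN => //; apply: leq_trans (jn _); exact: leq_addl.
split => //; rewrite (_ : (fun n => a (u_ n)) = (fun n => fine (F (u_ n)))); last first.
  by apply/funext => n; rewrite val.
apply: sqint_cvg => //.
- by move=> n; exact: measurable_pair_diff.
- exact: measurable_pair_diff.
- by move=> e e0; have [N hN] := h3 _ e0; exists N => n Nn; rewrite -pair_diffB; exact: hN.
Qed.

Lemma closure_valE u : qdom (form_closure mu a) u ->
  form_closure mu a u = fine (F u).
Proof.
move=> [mu_ _ [u_ hu]]; apply: get_unique_real.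
  by exists u_; split => //; have [] := closure_approx_cvg mu_ hu.
move=> l [v_ [hv cv]]; have [_ _ cv'] := closure_approx_cvg mu_ hv.
exact: (cvg_unique _ cv cv').
Qed.

Lemma closure_intro (u_ : nat -> V -> R) u : measurable_fun setT u -> L u < +oo ->
  (forall n, qdom a (u_ n)) -> seq_cauchy u_ -> L2_cvg u_ u ->
  qdom (form_closure mu a) u.
Proof.
move=> mu_ Lu du cu Luu; split => //; first exact/finite_norm2.
exists u_; split => //; first exact/represented_cauchyP.
exact/Lnorm2_cvg0.
Qed.

Lemma sub_closure u : qdom a u -> qdom (form_closure mu a) u.
Proof.
move=> du; have [mu_ Lu Fu] := fin du.
have z0 (G : (V -> R) -> \bar R) : G (fun x => 0)%R = 0 ->
    forall e : R, (0 < e)%R -> G (fun x => u x - u x)%R <= e%:E.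
  move=> G0 e e0; rewrite (_ : (fun x => _) = (fun=> 0%R)); last first.
    by apply/funext => x; rewrite subrr.
  by rewrite G0 lee_fin ltW.
apply: (@closure_intro (fun=> u)) => // e e0; exists 0%N => *; apply: z0 => //.
- rewrite /pform /sqint integral0_eq// => z _.
  by rewrite /pair_diff !mul0r subrr mul0r expr0n.
- by rewrite /sqint integral0_eq// => z _; rewrite expr0n.
Qed.

Lemma closure_represented : represented (form_closure mu a).
Proof.
split=> [u [mu_ Lu [u_ hu]]|u|u v].
- have [Fu _ _] := closure_approx_cvg mu_ hu.
  by split => //; exact/finite_norm2.
- exact: closure_valE.
move=> [mu_ /finite_norm2 Lu [u_ [du cu uu]]] [mv /finite_norm2 Lv [v_ [dv cv vv]]].
have mB : measurable_fun setT (fun x => u x - v x)%R by meas.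
have mu_n n : measurable_fun setT (u_ n) by have [] := fin (du n).
have mv_n n : measurable_fun setT (v_ n) by have [] := fin (dv n).
have half e : (0 < e)%R -> (0 < e / 4 :> R)%R by move=> e0; rewrite divr_gt0.
have quarter (e : R) (x y : \bar R) : x <= (e / 4)%:E -> y <= (e / 4)%:E ->
    2%:E * (x + y) <= e%:E.
  move=> xe ye; apply: (@le_trans _ _ (2%:E * ((e / 4)%:E + (e / 4)%:E))).
    by rewrite lee_wpmul2l ?lee_fin// leeD.
  by rewrite -EFinD -EFinM lee_fin le_eqVlt; apply/orP; left; apply/eqP; field.
apply: (@closure_intro (fun n x => u_ n x - v_ n x)%R) => //.
- apply: le_lt_trans (sqint_sub_le _ mu_ mv) _.
  by rewrite lte_mul_pinfty ?lee_fin// lte_add_pinfty.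
- by move=> n; exact: sub.
- move=> e e0.
  have /(represented_cauchyP ra du)/(_ _ (half _ e0))[N1 h1] := cu.
  have /(represented_cauchyP ra dv)/(_ _ (half _ e0))[N2 h2] := cv.
  exists (maxn N1 N2) => n m; rewrite !geq_max => /andP[n1 n2] /andP[m1 m2].
  rewrite (_ : (fun x => _) = (fun x => (u_ n x - u_ m x) - (v_ n x - v_ m x))%R); last first.
    by apply/funext => x; ring.
  have := mu_n n; have := mu_n m; have := mv_n n; have := mv_n m => ? ? ? ?.
  apply: le_trans (pform_sub_le mp mk _ _) _; [by meas|by meas|].
  by apply: quarter; [exact: h1|exact: h2].
- move=> e e0.
  have /Lnorm2_cvg0/(_ _ (half _ e0))[N1 h1] := uu.
  have /Lnorm2_cvg0/(_ _ (half _ e0))[N2 h2] := vv.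
  exists (maxn N1 N2) => n; rewrite !geq_max => /andP[n1 n2].
  rewrite (_ : (fun x => _) = (fun x => (u_ n x - u x) - (v_ n x - v x))%R); last first.
    by apply/funext => x; ring.
  have := mu_n n; have := mv_n n => ? ?.
  apply: le_trans (sqint_sub_le _ _ _) _; [by meas|by meas|].
  by apply: quarter; [exact: h1|exact: h2].
Qed.

End closure.

End represented_form.

(** * Cutoff functions *)

Section C0_functions.
Context {R : realType} {d : nat}.
Local Notation V := 'rV[R]_d.
Implicit Types u v : V -> R.

(** Closed bounded sets are compact in finite dimension, so compact support means vanishing outside
    a ball. *)
Lemma C0P u : C0 u <->
  continuous u /\ exists r : R, forall x, r < `|x| -> u x = 0.
Proof.
split=> -[cu h]; split=> //.
  have [M [Mr hM]] := compact_bounded h; exists (M + 1) => x Mx.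
  apply/eqP/negPn/negP => ux; move: Mx; rewrite ltNge => /negP; apply.
  by apply: hM; [rewrite ltrDl|exact: subset_closure].
have [r hr] := h.
have sub : closure [set x | u x != 0] `<=` [set x : V | `|x| <= r].
  rewrite [X in _ `<=` X](closure_id _).1; last first.
    exact: (closed_comp (fun x _ => @norm_continuous _ _ x) (@closed_le R r)).
  apply: closure_subset => x /= ux; rewrite leNgt; apply/negP => rx.
  by move: ux; rewrite hr// eqxx.
apply: bounded_closed_compact; last exact: closed_closure.
exists r; split; first exact: num_real.
by move=> M rM x /sub /le_trans; apply; exact: ltW.
Qed.

Lemma C0_lin (c e : R) u v : C0 u -> C0 v -> C0 (fun x => c * u x + e * v x).
Proof.
move=> /C0P[cu [r hr]] /C0P[cv [s hs]]; apply/C0P; split.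
  move=> x; have FF := nbhs_filter x.
  by apply: (@cvgD _ _ _ _ FF); apply: (@cvgM _ _ _ FF); try exact: cvg_cst; [exact: cu|exact: cv].
by exists (Num.max r s) => x; rewrite gt_max => /andP[rx sx]; rewrite hr// hs// !mulr0 addr0.
Qed.

End C0_functions.

Section cutoff.
Context {R : realType} {d : nat}.
Local Notation V := 'rV[R]_d.
Implicit Types (r : R) (x y : V).

(** Built on the sup norm, whose balls are boxes of known volume; comparison with [enorm] costs a
    factor [sqrt d]. It is 1 for [|x| <= r] and 0 for [|x| >= 2 r]. *)
Definition cutoff r x : R := Num.min (Num.max 0 (2 - `|x| / r)) 1.

Lemma cutoff_ge0 r x : 0 <= cutoff r x.
Proof. by rewrite /cutoff le_min le_max lexx ler01. Qed.

Lemma cutoff_le1 r x : cutoff r x <= 1.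
Proof. by rewrite /cutoff ge_min lexx orbT. Qed.

Lemma cutoff_norm_le1 r x : `|cutoff r x| <= 1.
Proof. by rewrite ger0_norm ?cutoff_ge0 ?cutoff_le1. Qed.

Lemma cutoff_eq1 r x : 0 < r -> `|x| <= r -> cutoff r x = 1.
Proof.
move=> r0 xr; have : `|x| / r <= 1 by rewrite ler_pdivrMr// mul1r.
by move=> h; rewrite /cutoff min_r// le_max; apply/orP; right; lra.
Qed.

Lemma cutoff_eq0 r x : 0 < r -> 2 * r <= `|x| -> cutoff r x = 0.
Proof.
move=> r0 xr; have : 2 <= `|x| / r by rewrite ler_pdivlMr.
by move=> h; rewrite /cutoff max_l ?min_l//; lra.
Qed.

Lemma cutoff_lip r x y : 0 < r -> `|cutoff r x - cutoff r y| <= `|x - y| / r.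
Proof.
move=> r0; apply: le_trans (min_dist_le _ _ _) _.
apply: le_trans (max_dist_le _ _ _) _.
rewrite (_ : _ - _ = (`|y| - `|x|) / r); last by ring.
rewrite normrM [`|r^-1|]gtr0_norm ?invr_gt0// ler_pM2r ?invr_gt0//.
by rewrite distrC; exact: ler_dist_dist.
Qed.

Lemma measurable_cutoff r : measurable_fun setT (cutoff r).
Proof. by rewrite /cutoff; meas. Qed.

Lemma lip_continuous (u : V -> R) (c : R) :
  (forall x y, `|u x - u y| <= c * `|x - y|) -> continuous u.
Proof.
move=> h x; have FF := nbhs_filter x.
apply/(@cvgrPdist_le _ _ _ _ FF) => e e0; near=> y.
apply: (le_trans (h x y)).
have c1 : 0 < `|c| + 1 by rewrite ltr_wpDl.
apply: (@le_trans _ _ ((`|c| + 1) * `|x - y|)).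
  by rewrite ler_wpM2r// (le_trans (ler_norm _))// lerDl.
rewrite mulrC -ler_pdivlMr//; near: y.
by apply: cvgr_dist_le; [exact: cvg_id|exact: divr_gt0].
Unshelve. all: by end_near. Qed.

Lemma continuous_cutoff r : 0 < r -> continuous (cutoff r).
Proof. by move=> r0; apply: (@lip_continuous _ r^-1) => x y; rewrite mulrC cutoff_lip. Qed.

(** The Lipschitz bound and the bound by 1 give at most [min (1, t)], and [exp (- t) (1 + t) <= 1]
    gives [min (1, t) <= 2 (1 - exp (- t))]. This is the form required by [integral_levy_le]. *)
Lemma cutoff_sqr_dist_le r x y : 0 < r -> (cutoff r x - cutoff r y) ^+ 2 <=
  2 * (1 - expR (- (r ^- 2 * enorm (x - y) ^+ 2))).
Proof.
move=> r0; set t := r ^- 2 * enorm (x - y) ^+ 2.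
have t0 : 0 <= t by rewrite mulr_ge0 ?sqr_ge0// invr_ge0 sqr_ge0.
have le1 : (cutoff r x - cutoff r y) ^+ 2 <= 1.
  rewrite -real_normK ?num_real// expr_le1// ler_norml.
  have := cutoff_ge0 r x; have := cutoff_le1 r x; have := cutoff_ge0 r y; have := cutoff_le1 r y.
  by move=> *; apply/andP; split; lra.
have let_ : (cutoff r x - cutoff r y) ^+ 2 <= t.
  rewrite -real_normK ?num_real// /t -exprVn -exprMn lerXn2r ?nnegrE//.
    by rewrite mulr_ge0 ?enorm_ge0// invr_ge0 ltW.
  apply: (le_trans (cutoff_lip x y r0)).
  by rewrite mulrC ler_pM2l ?invr_gt0// norm_le_enorm.
have e1 : expR (- t) * (1 + t) <= 1.
  by rewrite expRN mulrC ler_pdivrMr ?expR_gt0// mul1r expR_ge1Dx.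
have e0 := expR_ge0 (- t).
have [t1|t1] := leP t 1; nra.
Qed.

End cutoff.

Section cutoff_energy.
Context {R : realType} {d : nat} (q : R).
Hypotheses (d0 : (0 < d)%N) (q_gt : d%:R / 2 < q) (q_lt : q < d%:R / 2 + 1).
Local Open Scope ereal_scope.
Local Notation mu := (@lebesgue_rV R d).
Local Notation V := 'rV[R]_d.

Let q0 : (0 < q)%R.
Proof. by apply: le_lt_trans q_gt; rewrite divr_ge0. Qed.

Lemma cutoff_sqr_le_gauss (r : R) (y : V) : (0 < r)%R ->
  (cutoff r y ^+ 2 <= expR (4 * d%:R) * expR (- (r ^- 2 * enorm y ^+ 2)))%R.
Proof.
move=> r0; have [yr|yr] := leP (2 * r)%R `|y|%R.
  by rewrite cutoff_eq0// expr0n/= mulr_ge0 ?expR_ge0.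
apply: (@le_trans _ _ 1%R).
  by rewrite expr_le1// ?cutoff_ge0 ?cutoff_le1.
rewrite -expRD -[leLHS]expR0 ler_expR subr_ge0 mulrC ler_pdivrMr ?exprn_gt0//.
have h := enorm_le_norm y; have h0 := enorm_ge0 y.
have n0 : (0 <= `|y|)%R by [].
apply: (@le_trans _ _ ((Num.sqrt d%:R * (2 * r)) ^+ 2)%R).
  rewrite lerXn2r ?nnegrE// ?mulr_ge0 ?sqrtr_ge0 ?(ltW r0)//.
  by apply: (le_trans h); rewrite ler_wpM2l ?sqrtr_ge0// ltW.
by rewrite exprMn sqr_sqrtr// le_eqVlt; apply/orP; left; apply/eqP; ring.
Qed.

(** A bound on the carre du champ of a cutoff. The decay in [x] matters because [phi ^ 2], against
    which it will be integrated, is not integrable at infinity. *)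
Lemma cutoff_carre_le : exists2 C : R, (0 <= C)%R & forall (r : R) (x : V), (0 < r)%R ->
  \int[mu]_y ((cutoff r x - cutoff r y) ^+ 2 * enorm (x - y)%R `^ (- (2 * q)))%:E <=
  (C * (r `^ (d%:R - 2 * q) * (1 + r ^- 2 * enorm x ^+ 2) `^ (- q)))%:E.
Proof.
have [C1 C10 hC1] := @integral_levy_le R d q d0 q_gt q_lt.
pose K1 : R := (2 * C1 * (1 + 16 * d%:R) `^ q)%R.
pose K2 : R := (expR (4 * d%:R) * pi `^ (d%:R / 2) * (2 * Num.sqrt d%:R) `^ (2 * q) * 2 `^ q)%R.
have K10 : (0 <= K1)%R by rewrite /K1; pos.
have K20 : (0 <= K2)%R by rewrite /K2; pos.
exists (K1 + K2)%R; first exact: addr_ge0.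
move=> r x r0; have r2 : (0 < r ^- 2)%R by rewrite invr_gt0 exprn_gt0.
have B0 : (0 < 1 + r ^- 2 * enorm x ^+ 2)%R.
  by rewrite ltr_wpDr// mulr_ge0 ?sqr_ge0// ltW.
have rE e : ((r ^- 2) `^ e = r `^ (- (2 * e)))%R.
  by rewrite powRV ?sqr_ge0// -powR_mulrn ?(ltW r0)// -powRrM; congr (_ `^ _)%R; ring.
have rE' : (- (2 * (q - d%:R / 2)) = d%:R - 2 * q)%R by field.
have mb := @measurable_cutoff R d r.
(* For [|x| <= 4 r] the decay factor is at least [(1 + 16 d) ^ (- q)], so [integral_levy_le] with
   [l = r ^ -2] is enough. *)
have [xr|xr] := leP `|x|%R (4 * r)%R.
  apply: (@le_trans _ _ (K1 * (r `^ (d%:R - 2 * q) * (1 + r ^- 2 * enorm x ^+ 2) `^ (- q)))%:E); last first.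
    by rewrite lee_fin ler_wpM2r ?mulr_ge0 ?powR_ge0// lerDl.
  apply: (@le_trans _ _ (2%:E * \int[mu]_y ((1 - expR (- (r ^- 2 * enorm (x - y)%R ^+ 2))) *
                enorm (x - y)%R `^ (- (2 * q)))%:E)).
    have k0 (y : V) : (0 <= 1 - expR (- (r ^- 2 * enorm (x - y) ^+ 2)))%R.
      by rewrite subr_ge0 -expR0 ler_expR oppr_le0 mulr_ge0 ?sqr_ge0// ltW.
    rewrite -ge0_integralkl; last 4 first.
    - by [].
    - by meas.
    - by move=> y; rewrite lee_fin mulr_ge0 ?powR_ge0.
    - by [].
    apply: ge0_le_integralT; [by meas|by meas|by move=> y; pos|].
    by move=> y; rewrite -EFinM lee_fin mulrA ler_wpM2r ?powR_ge0// cutoff_sqr_dist_le.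
  apply: le_trans (lee_wpmul2l _ (hC1 _ x r2)) _; first by [].
  rewrite -EFinM lee_fin /K1 mulrA rE rE' -!mulrA ler_wpM2l// ler_wpM2l//.
  rewrite mulrCA ler_peMr ?powR_ge0// powRN ler_pdivlMr ?powR_gt0// mul1r.
  rewrite ge0_ler_powR ?(ltW q0) ?nnegrE ?(ltW B0) ?addr_ge0 ?mulr_ge0// lerD2l.
  rewrite mulrC ler_pdivrMr ?exprn_gt0//.
  have h := enorm_le_norm x.
  apply: (@le_trans _ _ ((Num.sqrt d%:R * (4 * r)) ^+ 2)%R).
    rewrite lerXn2r ?nnegrE ?enorm_ge0 ?mulr_ge0 ?sqrtr_ge0 ?(ltW r0)//.
    by apply: (le_trans h); rewrite ler_wpM2l ?sqrtr_ge0.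
  by rewrite exprMn sqr_sqrtr// le_eqVlt; apply/orP; left; apply/eqP; ring.
apply: (@le_trans _ _ (K2 * (r `^ (d%:R - 2 * q) * (1 + r ^- 2 * enorm x ^+ 2) `^ (- q)))%:E); last first.
  by rewrite lee_fin ler_wpM2r ?mulr_ge0 ?powR_ge0// lerDr.
have x0 : (0 < enorm x)%R.
  by apply: lt_le_trans (norm_le_enorm x); apply: lt_trans xr; rewrite mulr_gt0.
have sd0 : (0 < Num.sqrt d%:R :> R)%R by rewrite sqrtr_gt0 ltr0n.
(* Far away [cutoff r x = 0] and only [|y| < 2 r] contributes. There [|x - y| >= |x| / 2] in the sup
   norm, hence [enorm (x - y) >= c]. *)
pose c : R := (enorm x / (2 * Num.sqrt d%:R))%R.
have c0 : (0 < c)%R by rewrite /c divr_gt0// mulr_gt0.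
apply: (@le_trans _ _ ((c `^ (- (2 * q)) * expR (4 * d%:R))%:E *
    \int[mu]_(y in [set: V]) (expR (- (r ^- 2 * enorm y ^+ 2)))%:E)).
  rewrite -ge0_integralkl; [|side..].
  apply: ge0_le_integralT; [by meas|by meas|by move=> y; pos|].
  move=> y; rewrite -EFinM lee_fin (cutoff_eq0 r0); last first.
    by apply: le_trans (ltW xr); rewrite ler_pM2r// ler_nat.
  rewrite sub0r sqrrN.
  have [yr|yr] := leP (2 * r)%R `|y|%R.
    by rewrite cutoff_eq0// expr0n/= mul0r; pos.
  rewrite mulrC -mulrA ler_pM ?powR_ge0 ?sqr_ge0//; last exact: cutoff_sqr_le_gauss.
  have cxy : (c <= enorm (x - y))%R.
    apply: le_trans (norm_le_enorm _); rewrite /c ler_pdivrMr ?mulr_gt0//.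
    apply: (le_trans (enorm_le_norm x)); rewrite [leRHS]mulrC -mulrA mulrCA ler_pM2l//.
    move: (lerB_dist x y) xr yr.
    by move: (`|x - y|)%R (`|x|)%R (`|y|)%R => w X Y; lra.
  rewrite !powRN lef_pV2 ?posrE ?powR_gt0 ?(lt_le_trans c0)//.
  by rewrite ge0_ler_powR ?nnegrE ?mulr_ge0 ?(ltW q0) ?(ltW c0) ?enorm_ge0.
rewrite integral_rV_gauss0// -EFinM lee_fin /K2 powR_div ?pi_ge0 ?(ltW r2)// rE.
have -> : (- (2 * - (d%:R / 2)) = d%:R :> R)%R by field.
rewrite /c powR_div ?enorm_ge0 ?mulr_ge0 ?sqrtr_ge0// opprK.
rewrite (gt0_powRD d%:R (- (2 * q)) r0).
have -> : (enorm x `^ (- (2 * q)) = r `^ (- (2 * q)) * (r ^- 2 * enorm x ^+ 2) `^ (- q))%R.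
  rewrite powRM ?(ltW r2) ?sqr_ge0// rE mulrA -gt0_powRD//.
  rewrite (_ : - (2 * q) + - (2 * - q) = 0)%R; last by ring.
  rewrite powRr0 mul1r -powR_mulrn ?enorm_ge0// -powRrM; congr (_ `^ _)%R; ring.
set X := (r ^- 2 * enorm x ^+ 2)%R in B0 *.
have X1 : (1 <= X)%R.
  rewrite /X mulrC ler_pdivlMr ?exprn_gt0// mul1r lerXn2r ?nnegrE ?(ltW r0) ?(ltW x0)//.
  apply: le_trans (norm_le_enorm x); apply: le_trans (ltW xr).
  by rewrite ler_peMl ?(ltW r0)// ler1n.
have X0 : (0 < X)%R by exact: lt_le_trans X1.
have key : (X `^ (- q) <= 2 `^ q * (1 + X) `^ (- q))%R.
  rewrite !powRN ler_pdivlMr ?powR_gt0// mulrC ler_pdivrMr ?powR_gt0//.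
  rewrite -powRM ?(ltW X0)//; apply: ge0_ler_powR; rewrite ?nnegrE ?(ltW q0) ?(ltW B0)//.
    by rewrite mulr_ge0// ltW.
  by lra.
pose Y : R := (r `^ (- (2 * q)) * (2 * Num.sqrt d%:R) `^ (2 * q) * expR (4 * d%:R) * (pi `^ (d%:R / 2) * r `^ d%:R))%R.
have Y0 : (0 <= Y)%R by rewrite /Y; pos.
rewrite [leLHS](_ : _ = Y * X `^ (- q))%R; last by rewrite /Y; ring.
rewrite [leRHS](_ : _ = Y * (2 `^ q * (1 + X) `^ (- q)))%R; last by rewrite /Y; ring.
exact: ler_wpM2l.
Qed.

End cutoff_energy.

(** * Test functions *)

Lemma continuous_enorm (R : realType) (d : nat) : continuous (@enorm R d).
Proof.
move=> x; have FF := nbhs_filter x.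
apply: (@continuous_cvg _ _ _ _ FF); first exact: sqrt_continuous.
elim: (index_enum _) => [|i s IHs].
  rewrite big_nil; under eq_fun do rewrite big_nil.
  exact: cvg_cst.
rewrite big_cons; under eq_fun do rewrite big_cons.
apply: (@cvgD _ _ _ _ FF) => //.
apply: (@continuous_cvg _ _ _ _ FF _ (fun t : R => t ^+ 2)).
  exact: exprn_continuous.
exact: coord_continuous.
Qed.

Lemma continuous_max_enorm (R : realType) (d : nat) (c : R) :
  continuous (fun x : 'rV[R]_d => Num.max (enorm x) c).
Proof.
apply: max_fun_continuous; first exact: continuous_enorm.
by move=> x; exact: cst_continuous.
Qed.

Lemma integral_rV2_sym (R : realType) (d : nat) (F : 'rV[R]_d * 'rV[R]_d -> \bar R) :
  measurable_fun setT F -> (forall z, 0 <= F z)%E ->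
  (\int[lebesgue_rV \x lebesgue_rV]_z (F z + F (z.2, z.1)) =
   \int[lebesgue_rV]_x \int[lebesgue_rV]_y F (x, y) +
   \int[lebesgue_rV]_x \int[lebesgue_rV]_y F (x, y))%E.
Proof.
move=> mF F0; rewrite ge0_integralDT; last 4 first.
- exact: mF.
- by apply: measurableT_comp mF _; meas.
- exact: F0.
- by move=> z; exact: F0.
by rewrite (integral_rV2_swap mF F0) (integral_rV2 mF F0).
Qed.

Section test_functions.
Context {R : realType} {d : nat} (alpha : R).
Hypotheses (alpha_gt0 : (0 < alpha)%R) (alpha_lt2 : (alpha < 2)%R).
Hypotheses (d0 : (0 < d)%N) (alpha_ltd : (alpha < d%:R)%R).
#[local] Opaque Gamma.
Local Open Scope ereal_scope.
Local Notation mu := (@lebesgue_rV R d).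
Local Notation V := 'rV[R]_d.
Local Notation a := ((d%:R - alpha) / 4 : R)%R.
Local Notation b := ((d%:R + alpha) / 4 : R)%R.
Local Notation A := (stable_const d alpha).
Local Notation kappa := (kappa_star d alpha).
Local Notation L := (sqint mu).
Local Notation W := (hardy_mass alpha).
Local Notation energy := (energy alpha).
Local Notation gform := (gform alpha).
Local Notation phi := (phi alpha).
Implicit Types u v w : V -> R.

Let gsi := ground_state_identity alpha_gt0 alpha_lt2 d0 alpha_ltd.
Let kappa0 : (0 < kappa)%R := kappa_gt0 alpha_gt0 d0 alpha_ltd.
Let A0 : (0 < A)%R := stable_const_gt0 alpha_gt0 alpha_lt2 d0.
Let a0 : (0 < a)%R. Proof. by rewrite divr_gt0// subr_gt0. Qed.
Let mphi := @measurable_phi R d alpha.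

Lemma phi_at0 : phi (0 : V) = 0%R.
Proof.
rewrite /phi /gphi (_ : enorm 0 = 0)%R; last by apply/eqP; rewrite enorm_eq0.
by rewrite powR0// oppr_eq0 mulf_neq0// gt_eqF.
Qed.

(** Dividing by [phi] leaves [h], and [phi (x) phi (y)] is at most the mean of the squares. This
    decouples the variables, so that one of them can be integrated out by [cutoff_carre_le]. *)
Lemma ground_sq_phiM (h : V -> R) (z : V * V) :
  (ground_sq a (fun x => phi x * h x) z <=
   (h z.1 - h z.2) ^+ 2 * ((phi z.1 ^+ 2 + phi z.2 ^+ 2) / 2))%R.
Proof.
rewrite /ground_sq -/(phi _) -/(phi _).
have := @phi_ge0 R d alpha z.1; have := @phi_ge0 R d alpha z.2.
move: (phi z.1) (phi z.2) (h z.1) (h z.2) => s t p q t0 s0.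
have [->|n1] := eqVneq s 0%R; first by rewrite !mul0r mulr0 mulr_ge0 ?sqr_ge0// divr_ge0// addr_ge0 ?sqr_ge0.
have [->|n2] := eqVneq t 0%R; first by rewrite !(mul0r, mulr0) mulr_ge0 ?sqr_ge0// divr_ge0// addr_ge0 ?sqr_ge0.
rewrite ![(s * p)%R]mulrC ![(t * q)%R]mulrC (mulfK n1) (mulfK n2).
apply: ler_wpM2l; first exact: sqr_ge0.
rewrite -subr_ge0.
by rewrite (_ : _ - _ = (s - t) ^+ 2 / 2)%R ?divr_ge0 ?sqr_ge0//; field.
Qed.

(** Uniformity in [r] reflects scale invariance: the carre du champ contributes [r ^ (- alpha)], and
    the integral of [phi ^ 2] against its decay contributes [r ^ alpha]. *)
Lemma gform_cutoff_le : exists2 C : R, (0 <= C)%R & forall r : R, (0 < r)%R ->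
  gform (fun x : V => phi x * cutoff r x)%R <= C%:E.
Proof.
have q1 : (d%:R / 2 < 2 * b)%R by rewrite (_ : 2 * b = (d%:R + alpha) / 2)%R; [rewrite ltr_pM2r// ltrDl|field].
have q2 : (2 * b < d%:R / 2 + 1)%R.
  by rewrite -subr_gt0 (_ : _ - _ = (2 - alpha) / 2)%R; [rewrite divr_gt0// subr_gt0|field].
have [C1 C10 hC1] := cutoff_carre_le d0 q1 q2.
have p0 : (0 < 4 * a)%R by rewrite mulr_gt0.
have pd : (4 * a < d%:R)%R by rewrite (_ : 4 * a = d%:R - alpha)%R; [rewrite ltrBlDr ltrDl|field].
have dp : ((d%:R - 4 * a) / 2 = alpha / 2)%R by field.
have pq : ((d%:R - 4 * a) / 2 < 2 * b)%R.
  rewrite dp -subr_gt0 (_ : _ - _ = d%:R / 2)%R; last by field.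
  by rewrite divr_gt0// ltr0n.
have [C2 C20 hC2] := integral_power_decay_le d0 p0 pd pq.
exists (A / 2 * (C1 * C2))%R; first by pos.
move=> r r0; have mb := @measurable_cutoff R d r.
rewrite gformE//; last by meas.
rewrite [(A / 2 * _)%:E]EFinM.
apply: lee_wpmul2l; first by rewrite lee_fin; exact: divr_ge0 (ltW A0) (ler0n _ 2).
have mgphi : measurable_fun setT (@gphi R d a) := mphi.
have phi2 x : (0 <= phi x ^+ 2)%R by exact: sqr_ge0.
pose F (z : V * V) : \bar R :=
  (2^-1 * phi z.1 ^+ 2 * ((cutoff r z.1 - cutoff r z.2) ^+ 2 * enorm (z.1 - z.2) `^ (- (4 * b))))%:E.
have mF : measurable_fun setT F by rewrite /F; meas.
have F0 z : 0 <= F z by rewrite /F; pos.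
have msw : measurable_fun setT (fun z : V * V => (z.2, z.1)) by meas.
have mFs : measurable_fun setT (fun z => F (z.2, z.1)) := measurableT_comp mF msw.
have Fsw z : F (z.2, z.1) = (2^-1 * phi z.2 ^+ 2 *
    ((cutoff r z.1 - cutoff r z.2) ^+ 2 * enorm (z.1 - z.2) `^ (- (4 * b))))%:E.
  by rewrite /F/= enormB; congr EFin; ring.
have := @ge0_le_integralT _ _ _ (lebesgue_rV \x lebesgue_rV)
  (fun z => (ground_sq a (fun x => phi x * cutoff r x) z * enorm (z.1 - z.2) `^ (- (4 * b)))%:E)
  (fun z => F z + F (z.2, z.1)).
rewrite (integral_rV2_sym mF F0) => FF.
apply: (le_trans (FF _ _ _ _)).
  - by rewrite /ground_sq; meas.
  - exact: emeasurable_funD mF mFs.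
  - move=> z; rewrite lee_fin.
    exact: mulr_ge0 (mulr_ge0 (sqr_ge0 _) (mulr_ge0 (gphi_ge0 _ _) (gphi_ge0 _ _))) (powR_ge0 _ _).
  move=> z; rewrite Fsw /F -EFinD lee_fin.
  apply: le_trans (ler_wpM2r (powR_ge0 _ _) (ground_sq_phiM _ z)) _.
  rewrite le_eqVlt; apply/orP; left; apply/eqP.
  move: (cutoff r z.1) (cutoff r z.2) (phi z.1) (phi z.2) (enorm _ `^ _)%R => c1 c2 p1 p2 w.
  by field.
pose K : R := (2^-1 * (C1 * r `^ (- alpha)))%R.
have K0 : (0 <= K)%R by rewrite /K; pos.
pose D (x : V) : R := (enorm x `^ (- (4 * a)) * (1 + r ^- 2 * enorm x ^+ 2) `^ (- (2 * b)))%R.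
have mD : measurable_fun setT D by rewrite /D; meas.
have D0 x : (0 <= D x)%R by rewrite /D; pos.
have bE : (2 * (2 * b) = 4 * b)%R by ring.
have FD : \int[mu]_x \int[mu]_y F (x, y) <= K%:E * \int[mu]_x (D x)%:E.
  rewrite -ge0_integralkl; [|side..].
  apply: ge0_le_integralT; [exact: (@measurable_integral_rV R d _ V F mF F0)|by meas|by move=> x; pos|].
  move=> x; rewrite /F/=; under eq_integral do rewrite EFinM.
  rewrite ge0_integralkl; [|side..].
  have := hC1 r x r0; rewrite bE => /(lee_wpmul2l _) h.
  apply: le_trans (h _ _) _; first by pos.
  rewrite -!EFinM lee_fin (_ : d%:R - 4 * b = - alpha)%R; last by field.
  rewrite (_ : phi x ^+ 2 = enorm x `^ (- (4 * a)))%R; last first.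
    rewrite /phi /gphi -powR_mulrn ?powR_ge0// -powRrM; congr (_ `^ _)%R; ring.
  by rewrite le_eqVlt /K /D; apply/orP; left; apply/eqP; ring.
have r2 : (0 < r ^- 2)%R by rewrite invr_gt0 exprn_gt0.
have KD : K%:E * \int[mu]_x (D x)%:E <= (2^-1 * (C1 * C2))%:E.
  apply: le_trans (lee_wpmul2l _ (hC2 _ r2)) _; first by rewrite lee_fin.
  rewrite -EFinM lee_fin dp powRV ?sqr_ge0// -powR_mulrn ?(ltW r0)// -powRrM.
  rewrite (_ : 2%:R * - - (alpha / 2) = alpha)%R; last by field.
  rewrite /K powRN le_eqVlt; apply/orP; left; apply/eqP; field.
  by rewrite gt_eqF// powR_gt0.
have FC := le_trans FD KD.
apply: (le_trans (leeD FC FC)).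
by rewrite -EFinD lee_fin le_eqVlt; apply/orP; left; apply/eqP; field.
Qed.

(** A difference of two cutoffs of [phi], one large and one small, so that [gform_cutoff_le] bounds
    its form without a separate estimate near the origin. *)
Definition test_fun (n : nat) (x : V) : R :=
  (phi x * cutoff n.+1%:R x - phi x * cutoff n.+1%:R^-1 x)%R.

Lemma test_fun_le n x : (`|test_fun n x| <= phi x)%R.
Proof.
rewrite /test_fun -mulrBr normrM ger0_norm ?phi_ge0// -[leRHS]mulr1.
apply: ler_wpM2l; rewrite ?phi_ge0// ler_norml.
have := @cutoff_ge0 R d n.+1%:R x; have := @cutoff_le1 R d n.+1%:R x.
have := @cutoff_ge0 R d n.+1%:R^-1%R x; have := @cutoff_le1 R d n.+1%:R^-1%R x.
by lra.
Qed.

Lemma measurable_test_fun n : measurable_fun setT (test_fun n).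
Proof.
have m1 := @measurable_cutoff R d n.+1%:R; have m2 := @measurable_cutoff R d n.+1%:R^-1%R.
by rewrite /test_fun; meas.
Qed.

Lemma gform_test_le : exists2 C : R, (0 <= C)%R & forall n, gform (test_fun n) <= C%:E.
Proof.
have [C C0 hC] := gform_cutoff_le; exists (2 * (C + C))%R.
  by rewrite mulr_ge0// addr_ge0.
move=> n; have m1 := @measurable_cutoff R d n.+1%:R.
have m2 := @measurable_cutoff R d n.+1%:R^-1%R.
apply: le_trans (pform_sub_le _ _ _ _) _.
- exact: measurable_inv_phi.
- exact: measurable_ground_kernel.
- by meas.
- by meas.
rewrite EFinM [(C + C)%:E]EFinD; apply: lee_wpmul2l; first by rewrite lee_fin.
by apply: leeD; apply: hC; rewrite ?invr_gt0.
Qed.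

Lemma test_fun_cvg x : test_fun n x @[n --> \oo] --> phi x.
Proof.
have [->|x0] := eqVneq x 0%R.
  rewrite phi_at0 (_ : test_fun^~ _ = fun=> 0%R); first exact: cvg_cst.
  by apply/funext => n; rewrite /test_fun phi_at0 !mul0r subrr.
apply/cvgrPdist_le => e e0; near=> n.
have nx0 : (0 < `|x|)%R by rewrite normr_gt0.
have n1 : (`|x| <= n.+1%:R)%R.
  apply: (@le_trans _ _ n%:R); last by rewrite ler_nat.
  by near: n; exact: nbhs_infty_ger.
have n2 : (2 * n.+1%:R^-1 <= `|x|)%R.
  rewrite ler_pdivrMr// -ler_pdivrMl//; apply: (@le_trans _ _ n%:R); last by rewrite ler_nat.
  by near: n; exact: nbhs_infty_ger.
rewrite /test_fun cutoff_eq1// [cutoff n.+1%:R^-1 x]cutoff_eq0 ?invr_gt0//.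
by rewrite mulr1 mulr0 subr0 subrr normr0 ltW.
Unshelve. all: by end_near. Qed.

Lemma test_fun_small n x : (`|x| <= n.+1%:R^-1)%R -> test_fun n x = 0%R.
Proof.
move=> xn; have n1 : (n.+1%:R^-1 <= n.+1%:R :> R)%R.
  by apply: (@le_trans _ _ 1%R); rewrite ?invf_le1// ler1n.
by rewrite /test_fun !cutoff_eq1 ?invr_gt0// ?subrr// (le_trans xn).
Qed.

Lemma test_fun_large n x : (2 * n.+1%:R <= `|x|)%R -> test_fun n x = 0%R.
Proof.
move=> xn; have n1 : (n.+1%:R^-1 <= n.+1%:R :> R)%R.
  by apply: (@le_trans _ _ 1%R); rewrite ?invf_le1// ler1n.
rewrite /test_fun !cutoff_eq0 ?invr_gt0// ?mulr0 ?subrr//.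
by apply: le_trans xn; rewrite ler_pM2l.
Qed.

Lemma test_fun_bounded n x : (`|test_fun n x| <= n.+1%:R `^ (2 * a))%R.
Proof.
have [xn|xn] := leP `|x|%R n.+1%:R^-1%R.
  by rewrite test_fun_small// normr0 powR_ge0.
rewrite /test_fun -mulrBr normrM -[leRHS]mulr1; apply: ler_pM => //.
  rewrite ger0_norm ?phi_ge0// /phi /gphi powRN invf_ple ?posrE ?powR_gt0//; last first.
    by rewrite enorm_gt0; apply/eqP => x0; move: xn; rewrite x0 normr0 ltNge invr_ge0 ler0n.
  rewrite -powRN -powRV//; apply: ge0_ler_powR; rewrite ?nnegrE ?invr_ge0 ?enorm_ge0//.
    by rewrite mulr_ge0// ltW.
  by apply: le_trans (ltW xn) (norm_le_enorm x).
have := @cutoff_ge0 R d n.+1%:R x; have := @cutoff_le1 R d n.+1%:R x.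
have := @cutoff_ge0 R d n.+1%:R^-1%R x; have := @cutoff_le1 R d n.+1%:R^-1%R x.
by move=> *; rewrite ler_norml; apply/andP; split; lra.
Qed.

Lemma sqint_fin_cutoff u (M r : R) : (0 < r)%R -> measurable_fun setT u ->
  (forall x, `|u x| <= M * cutoff r x)%R -> L u < +oo.
Proof.
move=> r0 mu_ hu; have r2 : (0 < r ^- 2)%R by rewrite invr_gt0 exprn_gt0.
apply: (@le_lt_trans _ _ ((M ^+ 2 * expR (4 * d%:R))%:E *
   \int[mu]_(x in [set: V]) (expR (- (r ^- 2 * enorm x ^+ 2)))%:E)); last first.
  by rewrite integral_rV_gauss0// -EFinM ltry.
rewrite -ge0_integralkl; [|side..].
apply: ge0_le_integralT; [by meas|by meas|by move=> x; pos|].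
move=> x; rewrite -EFinM lee_fin -mulrA.
apply: (@le_trans _ _ ((M * cutoff r x) ^+ 2)%R).
  rewrite -real_normK ?num_real// lerXn2r ?nnegrE// (le_trans _ (hu x))//.
by rewrite exprMn ler_wpM2l ?sqr_ge0// cutoff_sqr_le_gauss.
Qed.

Lemma sqint_test_fun n : L (test_fun n) < +oo.
Proof.
apply: (@sqint_fin_cutoff _ (n.+1%:R `^ (2 * a))%R (2 * n.+1%:R)%R).
- by rewrite mulr_gt0.
- exact: measurable_test_fun.
move=> x; have [xn|xn] := leP (2 * n.+1%:R)%R `|x|%R.
  by rewrite test_fun_large// normr0 mulr_ge0 ?powR_ge0 ?cutoff_ge0.
by rewrite cutoff_eq1 ?mulr_gt0 ?(ltW xn)// mulr1; exact: test_fun_bounded.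
Qed.

Lemma hardy_mass_test_fun n : W (test_fun n) < +oo.
Proof.
pose k := Num.truncn (n.+1%:R `^ (2 * a) : R)%R.
apply: (@hardy_mass_bounded _ _ _ alpha_gt0 d0 alpha_ltd _ k.+1).
- exact: measurable_test_fun.
- exact: sqint_test_fun.
move=> x; apply: le_trans (test_fun_bounded n x) _.
by apply: ltW; rewrite /k truncnS_gt.
Qed.

(** Finite energy is read off from the ground state identity: [G] is bounded and the Hardy mass of a
    bounded L2 function is finite. *)
Lemma energy_test_fun n : energy (test_fun n) < +oo.
Proof.
have [C _ hC] := gform_test_le; have hW := hardy_mass_test_fun n.
rewrite gsi//; [|exact: measurable_test_fun|exact: sqint_test_fun].
apply: lte_add_pinfty; first by apply: le_lt_trans (hC n) _; rewrite ltry.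
apply: lte_mul_pinfty; [rewrite lee_fin; exact: ltW kappa0|exact: isT|exact: hW].
Qed.

Lemma test_fun_C0 n : C0 (test_fun n).
Proof.
apply/C0P; split; last first.
  by exists (2 * n.+1%:R)%R => x /ltW; exact: test_fun_large.
have n0 : (0 < n.+1%:R^-1 :> R)%R by rewrite invr_gt0.
(* Where the two cutoffs differ, [enorm x] is at least [1 / (n + 1)], so [m] may replace it; the
   power of [m] is continuous everywhere, unlike [phi]. *)
pose m (x : V) : R := Num.max (enorm x) (n.+1%:R^-1)%R.
have m0 x : (0 < m x)%R by rewrite /m lt_max n0 orbT.
rewrite (_ : test_fun n = fun x => (expR (- (2 * a) * ln (m x)) *
   (cutoff n.+1%:R x - cutoff n.+1%:R^-1 x))%R); last first.
  apply/funext => x; have [xn|xn] := leP `|x|%R n.+1%:R^-1%R.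
    have n1 : (n.+1%:R^-1 <= n.+1%:R :> R)%R.
      by apply: (@le_trans _ _ 1%R); rewrite ?invf_le1// ler1n.
    by rewrite test_fun_small// !cutoff_eq1 ?invr_gt0// ?subrr ?mulr0// (le_trans xn).
  have ex : (n.+1%:R^-1 <= enorm x)%R := le_trans (ltW xn) (norm_le_enorm x).
  rewrite /test_fun -mulrBr /m max_l//; congr (_ * _)%R.
  by rewrite /phi /gphi /powR gt_eqF// (lt_le_trans n0).
move=> x; have FF := nbhs_filter x.
apply: (@cvgM _ _ _ FF).
  apply: (@continuous_cvg _ _ _ _ FF); first exact: continuous_expR.
  apply: (@cvgM _ _ _ FF); first exact: cvg_cst.
  apply: (@continuous_cvg _ _ _ _ FF); first exact: continuous_ln.
  exact: continuous_max_enorm.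
by apply: (@cvgB _ _ _ _ FF); apply: continuous_cutoff.
Qed.

End test_functions.

(** * Mollification *)

Lemma sqint_dominated d (T : measurableType d) (R : realType)
    (m : {measure set T -> \bar R}) (F_ : nat -> T -> R) (G : T -> R) :
  (forall n, measurable_fun setT (F_ n)) -> measurable_fun setT G ->
  (forall x, F_ n x @[n --> \oo] --> 0) ->
  (forall n x, `|F_ n x| <= `|G x|) -> (sqint m G < +oo)%E ->
  forall e : R, 0 < e -> exists N, forall n, (N <= n)%N -> (sqint m (F_ n) <= e%:E)%E.
Proof.
move=> mF mG F0 FG Gfin e e0.
have mf n : measurable_fun setT (fun x => (F_ n x ^+ 2)%:E) by have := mF n => ?; meas.
have mg : measurable_fun setT (fun x => (G x ^+ 2)%:E) by meas.
have ig : m.-integrable setT (fun x => (G x ^+ 2)%:E).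
  apply/integrableP; split => //; rewrite (eq_integral (fun x => (G x ^+ 2)%:E))//.
  by move=> x _; rewrite gee0_abs ?lee_fin ?sqr_ge0.
have [] := @dominated_convergence _ _ _ m setT measurableT (fun n x => (F_ n x ^+ 2)%:E)
  (fun=> 0%E) (fun x => (G x ^+ 2)%:E) mf _ _ ig _.
- exact: measurable_cst.
- apply: nearW => x _; apply/fine_cvgP; split; first exact: nearW.
  have h := cvgM (F0 x) (F0 x); rewrite mulr0 in h.
  have h2 : (fun n => F_ n x ^+ 2) @ \oo --> (0 : R).
    rewrite (_ : (fun n => _) = F_^~ x \* F_^~ x); first exact: h.
    by apply/funext => n; rewrite expr2.
  exact: h2.
- apply: nearW => x n _; rewrite gee0_abs ?lee_fin ?sqr_ge0//.
  by rewrite -real_normK ?num_real// -[leRHS]real_normK ?num_real// lerXn2r ?nnegrE.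
move=> _ _; rewrite integral0 => /fine_cvgP[fin /cvgrPdist_le/(_ _ e0) le].
have [N _ hN] := filterI fin le; exists N => n Nn.
have [/= nf] := hN _ Nn; rewrite sub0r normrN => ne.
by rewrite /sqint -(fineK nf) lee_fin (le_trans (ler_norm _)).
Qed.

Section jensen.
Context d (T : measurableType d) (R : realType) (m : {measure set T -> \bar R}).
Local Open Scope ereal_scope.

(** With [t = p - q >= 0], the inequality [rho (f - g - t) ^ 2 >= 0] is arranged so that all terms
    on both sides are nonnegative and then integrated. The order [q <= p] is arranged by symmetry to
    keep the coefficients nonnegative. *)
Lemma jensen_sqr_dist (rho f g : T -> R) (p q : R) :
  measurable_fun setT rho -> measurable_fun setT f -> measurable_fun setT g ->
  (forall x, 0 <= rho x)%R -> (forall x, 0 <= f x)%R -> (forall x, 0 <= g x)%R ->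
  \int[m]_x (rho x)%:E = 1 ->
  \int[m]_x (rho x * f x)%:E = p%:E -> \int[m]_x (rho x * g x)%:E = q%:E ->
  ((p - q) ^+ 2)%:E <= \int[m]_x (rho x * (f x - g x) ^+ 2)%:E.
Proof.
wlog qp : f g p q / (q <= p)%R.
  move=> H; have [qp|/ltW pq] := leP q p; first exact: H.
  move=> mr mf mg r0 f0 g0 I1 If Ig.
  rewrite -sqrrN opprB (_ : \int[m]_x _ = \int[m]_x (rho x * (g x - f x) ^+ 2)%:E).
    exact: H.
  by apply: eq_integral => x _; rewrite -sqrrN opprB.
move=> mr mf mg r0 f0 g0 I1 If Ig.
pose t := (p - q)%R; have t0 : (0 <= t)%R by rewrite subr_ge0.
have : \int[m]_x ((2 * t)%:E * (rho x * f x)%:E) <=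
    \int[m]_x ((rho x * (f x - g x) ^+ 2)%:E +
      ((t ^+ 2)%:E * (rho x)%:E + (2 * t)%:E * (rho x * g x)%:E)).
  apply: ge0_le_integralT; [by meas|by meas|by move=> x; pos|].
  move=> x; rewrite -!EFinM -!EFinD lee_fin -subr_ge0.
  rewrite (_ : _ - _ = rho x * (f x - g x - t) ^+ 2)%R; last by ring.
  by rewrite mulr_ge0 ?sqr_ge0.
rewrite ge0_integralkl; [|side..].
rewrite ge0_integralDT; [|side..].
rewrite ge0_integralDT; [|side..].
rewrite !ge0_integralkl; [|side..].
rewrite I1 If Ig mule1 -!EFinM -EFinD.
have : 0 <= \int[m]_x (rho x * (f x - g x) ^+ 2)%:E by pos.
case: (\int[m]_x _) => [r _|_ _|//]; last by rewrite leey.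
rewrite -EFinD !lee_fin -/t => h.
have tE : (p - q = t)%R by [].
by nra.
Qed.

End jensen.

Section tonelli_rV_rV2.
Context {R : realType} {d : nat}.
Local Open Scope ereal_scope.
Local Notation mu := (@lebesgue_rV R d).
Local Notation V := 'rV[R]_d.

Lemma tonelli_rV_rV2 (F : V * (V * V) -> \bar R) :
  measurable_fun setT F -> (forall z, 0 <= F z) ->
  \int[mu]_h \int[mu \x mu]_z F (h, z) = \int[mu \x mu]_z \int[mu]_h F (h, z).
Proof.
move=> mF F0.
pose F1 (z : (V * V) * V) : \bar R := F (z.1.1, (z.1.2, z.2)).
have mF1 : measurable_fun setT F1.
  by rewrite /F1; apply: measurableT_comp mF _; meas.
pose F2 (z : V * V) : \bar R := \int[mu]_y F1 (z, y).
have mF2 : measurable_fun setT F2.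
  by exact: (@measurable_integral_rV R d _ (V * V)%type F1 mF1 (fun=> F0 _)).
transitivity (\int[mu]_h \int[mu]_x F2 (h, x)).
  by apply: eq_integral => h _; rewrite integral_rV2//; by meas.
rewrite tonelli_rV//; last by move=> z; rewrite /F2 /F1; pos.
have msw : measurable_fun setT (fun z : (V * V) * V => (z.2, z.1)) by meas.
have mFs : measurable_fun setT (fun z : (V * V) * V => F (z.2, z.1)) := measurableT_comp mF msw.
rewrite integral_rV2; last 2 first.
- exact: (@measurable_integral_rV R d _ (V * V)%type (fun z => F (z.2, z.1)) mFs (fun=> F0 _)).
- by move=> z; exact: integral_ge0.
apply: eq_integral => x _.
rewrite /F2 /F1/=.
rewrite (@tonelli_rV _ _ _ (fun z => F (z.1, (x, z.2))))//.
by apply: measurableT_comp mF _; meas.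
Qed.

Lemma integral_pair_translate (h : V) (v : V -> R) (k : V -> R) :
  measurable_fun setT v -> measurable_fun setT k -> (forall x, 0 <= k x)%R ->
  \int[mu \x mu]_z ((v (z.1 + h) - v (z.2 + h)) ^+ 2 * k (z.1 - z.2))%:E =
  \int[mu \x mu]_z ((v z.1 - v z.2) ^+ 2 * k (z.1 - z.2))%:E.
Proof.
move=> mv mk k0.
rewrite !integral_rV2; last 4 first.
- by meas.
- by move=> z; pos.
- by meas.
- by move=> z; pos.
pose G (z : V * V) : \bar R := ((v z.1 - v z.2) ^+ 2 * k (z.1 - z.2))%:E.
have mG : measurable_fun setT G by rewrite /G; meas.
have G0 z : 0 <= G z by rewrite /G; pos.
transitivity (\int[mu]_x \int[mu]_y G (x + h, y)%R); last first.
  rewrite (@integral_rV_translate _ _ h (fun x => \int[mu]_y G (x, y)))//.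
    exact: (@measurable_integral_rV R d _ V G).
  by move=> x; exact: integral_ge0.
apply: eq_integral => x _.
rewrite -[RHS](@integral_rV_translate _ _ h (fun y => G (x + h, y)%R)).
- by apply: eq_integral => y _; rewrite /G/= opprD addrACA subrr addr0.
- by apply: measurableT_comp mG _; meas.
- by move=> y.
Qed.

End tonelli_rV_rV2.

Section mollifier.
Context {R : realType} {d : nat} (alpha : R).
Hypotheses (alpha_gt0 : (0 < alpha)%R) (alpha_lt2 : (alpha < 2)%R).
Hypotheses (d0 : (0 < d)%N) (alpha_ltd : (alpha < d%:R)%R).
#[local] Opaque Gamma.
Local Open Scope ereal_scope.
Local Notation mu := (@lebesgue_rV R d).
Local Notation V := 'rV[R]_d.
Local Notation b := ((d%:R + alpha) / 4 : R)%R.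
Local Notation A := (stable_const d alpha).
Local Notation L := (sqint mu).
Local Notation energy := (energy alpha).
Implicit Types (u v w : V -> R) (r : R).

Let A0 : (0 < A)%R := stable_const_gt0 alpha_gt0 alpha_lt2 d0.
Let mcut r := @measurable_cutoff R d r.
Let cut0 r := @cutoff_ge0 R d r.

Lemma cutoff_le_sqr r (x : V) : (0 < r)%R -> (cutoff r x <= cutoff (2 * r) x ^+ 2)%R.
Proof.
move=> r0; have [xr|xr] := leP (2 * r)%R `|x|%R.
  by rewrite cutoff_eq0 ?sqr_ge0.
by rewrite [X in (_ <= X ^+ 2)%R]cutoff_eq1 ?mulr_gt0 ?(ltW xr)// expr1n cutoff_le1.
Qed.

Lemma integral_cutoff_lty r : (0 < r)%R -> \int[mu]_x (cutoff r x)%:E < +oo.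
Proof.
move=> r0; have r20 : (0 < 2 * r)%R by rewrite mulr_gt0.
have mr := mcut r; have mr2 := mcut (2 * r)%R.
have := @sqint_fin_cutoff R d (@cutoff R d (2 * r)) 1 (2 * r)%R r20 (mcut _).
move=> /(_ _)/(le_lt_trans _); apply; last first.
  by move=> x; rewrite mul1r ger0_norm ?cutoff_ge0.
apply: ge0_le_integralT; [by meas|by meas|by move=> x; rewrite lee_fin cutoff_ge0|].
by move=> x; rewrite lee_fin cutoff_le_sqr.
Qed.

Definition cutoff_mass r : R := fine (\int[mu]_x (cutoff r x)%:E).

Lemma cutoff_massE r : (0 < r)%R -> \int[mu]_x (cutoff r x)%:E = (cutoff_mass r)%:E.
Proof.
move=> r0; rewrite fineK// ge0_fin_numE ?integral_cutoff_lty//.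
by apply: integral_ge0 => x _; rewrite lee_fin cutoff_ge0.
Qed.

Lemma cutoff_mass_ge r : (0 < r)%R -> ((2 * r) ^+ d <= cutoff_mass r)%R.
Proof.
move=> r0; rewrite -lee_fin -cutoff_massE//.
pose I : set R := `[(- r)%R, r]%classic.
pose B := [set x : V | forall i, I (x ord0 i)].
have mI (i : 'I_d) : measurable I by rewrite /I; exact: measurable_itv.
have BE : mu B = ((2 * r) ^+ d)%:E.
  rewrite /B (@lebesgue_rV_box R d (fun=> I) mI).
  rewrite (eq_bigr (fun=> (2 * r)%:E)); last first.
    move=> i _; rewrite /I lebesgue_measure_itv/= lte_fin (_ : (- r < r)%R); last by lra.
    by rewrite -EFinD opprK; congr EFin; ring.
  by rewrite prodEFin prodr_const card_ord.
have mB : measurable B.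
  rewrite (_ : B = \bigcap_(i in [set: 'I_d]) (@rV_coord R d i @^-1` I)).
    apply: fin_bigcap_measurable => // i _.
    by rewrite -[X in measurable X]setTI; exact: (measurable_rV_coord i measurableT (mI i)).
  by apply/seteqP; split => x /= h i; [move=> _|]; exact: h.
rewrite -BE -[X in mu X]setIT -(integral_indic mu measurableT mB).
have mr := mcut r.
apply: ge0_le_integralT; [exact/measurable_EFinP|by meas|by move=> x; pos|].
move=> x; rewrite lee_fin indicE; case: (boolP (x \in B)) => [|_]; last exact: cutoff_ge0.
rewrite inE => xB; rewrite cutoff_eq1//.
rewrite /Num.Def.normr/= mx_normrE; apply: bigmax_le; first exact: ltW.
move=> [i j] _ /=; rewrite (ord1 i) ler_norml.
by have := xB j; rewrite /I/= in_itv.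
Qed.

Lemma cutoff_mass_gt0 r : (0 < r)%R -> (0 < cutoff_mass r)%R.
Proof. by move=> r0; apply: lt_le_trans (cutoff_mass_ge r0); rewrite exprn_gt0// mulr_gt0. Qed.

Definition mollifier r (h : V) : R := (cutoff r h / cutoff_mass r)%R.

Lemma mollifier_ge0 r h : (0 < r)%R -> (0 <= mollifier r h)%R.
Proof. by move=> r0; rewrite divr_ge0 ?cutoff_ge0// ltW// cutoff_mass_gt0. Qed.

Lemma measurable_mollifier r : measurable_fun setT (mollifier r).
Proof. by have := mcut r => mr; rewrite /mollifier; meas. Qed.
Let mmol := measurable_mollifier.

Lemma integral_mollifier r : (0 < r)%R -> \int[mu]_h (mollifier r h)%:E = 1.
Proof.
move=> r0; have c0 := cutoff_mass_gt0 r0; have mr := mcut r; have cr := cut0 r.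
rewrite (eq_integral (fun h => (cutoff_mass r)^-1%:E * (cutoff r h)%:E)); last first.
  by move=> h _; rewrite -EFinM mulrC.
rewrite ge0_integralkl; [|side..].
by rewrite cutoff_massE// -EFinM mulVf// gt_eqF.
Qed.

(** On its support the mollifier is at most [(2 r) ^ (- d)], and [4 b = d + alpha] lets [|z| < 2 r]
    trade this for [r ^ alpha |z| ^ (- 4 b)]. The mollification error is thus controlled by the
    energy, with a factor tending to 0. *)
Lemma mollifier_le_kernel : exists2 K : R, (0 <= K)%R & forall r (z : V), (0 < r)%R ->
  z != 0%R -> (mollifier r z <= K * r `^ alpha * enorm z `^ (- (4 * b)))%R.
Proof.
exists (2 ^- d * (2 * Num.sqrt d%:R) `^ (4 * b))%R.
  by rewrite mulr_ge0 ?powR_ge0// invr_ge0 exprn_ge0.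
move=> r z r0 z0; have c0 := cutoff_mass_gt0 r0.
have z1 : (0 < enorm z)%R by rewrite enorm_gt0.
have [zr|zr] := leP (2 * r)%R `|z|%R.
  by rewrite /mollifier cutoff_eq0// mul0r !mulr_ge0 ?powR_ge0 ?invr_ge0 ?exprn_ge0.
apply: (@le_trans _ _ ((2 * r) ^- d)%R).
  rewrite /mollifier ler_pdivrMr// -ler_pdivrMl ?invr_gt0 ?exprn_gt0 ?mulr_gt0//.
  rewrite invrK; apply: le_trans (cutoff_mass_ge r0).
  by rewrite ler_piMr ?cutoff_le1// exprn_ge0// mulr_ge0// ltW.
have sd0 : (0 < Num.sqrt d%:R :> R)%R by rewrite sqrtr_gt0 ltr0n.
have le1 : (enorm z `^ (4 * b) <= (2 * Num.sqrt d%:R) `^ (4 * b) * (r `^ alpha * r ^+ d))%R.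
  rewrite -[(r ^+ d)%R]powR_mulrn ?(ltW r0)// -gt0_powRD//.
  rewrite (_ : alpha + d%:R = 4 * b)%R; last by field.
  rewrite -powRM ?(ltW r0) ?mulr_ge0 ?sqrtr_ge0//; apply: ge0_ler_powR.
  - by rewrite mulr_ge0// divr_ge0// addr_ge0// ltW.
  - by rewrite nnegrE ltW.
  - by rewrite nnegrE !mulr_ge0 ?sqrtr_ge0// ltW.
  apply: (le_trans (enorm_le_norm z)); rewrite [leRHS](_ : _ = Num.sqrt d%:R * (2 * r))%R; last by ring.
  by rewrite ler_pM2l// ltW.
rewrite powRN ler_pdivlMr ?powR_gt0// mulrC exprMn invfM.
rewrite [leLHS](_ : _ = 2 ^- d * (enorm z `^ (4 * b) / r ^+ d))%R; last by ring.
rewrite -!mulrA ler_pM2l ?invr_gt0 ?exprn_gt0//.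
by rewrite ler_pdivrMr ?exprn_gt0// -mulrA.
Qed.

Definition mollify r v (x : V) : R := fine (\int[mu]_h (mollifier r h * v (h + x)%R)%:E).

Section nonneg.
Variables (r : R) (v : V -> R).
Hypotheses (r0 : (0 < r)%R) (mv : measurable_fun setT v) (v0 : forall x, (0 <= v x)%R).
Hypothesis Lv : L v < +oo.
Let mol0 h : (0 <= mollifier r h)%R := mollifier_ge0 h r0.
Let mm := mmol r.

(** From [t <= 1 + t ^ 2]: the constant integrates to 1 against the mollifier, and the square is
    controlled by [L v]. *)
Lemma mollify_fin x : \int[mu]_h (mollifier r h * v (h + x)%R)%:E = (mollify r v x)%:E.
Proof.
rewrite fineK// ge0_fin_numE; last by pos.
have c0 := cutoff_mass_gt0 r0.
pose G (h : V) : \bar R := (v h ^+ 2)%:E.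
have mG : measurable_fun setT G by rewrite /G; meas.
apply: (@le_lt_trans _ _ (\int[mu]_h (mollifier r h)%:E +
    (cutoff_mass r)^-1%:E * \int[mu]_h G (h + x)%R)); last first.
  rewrite integral_mollifier// integral_rV_translate//; last by move=> h; rewrite /G; pos.
  by apply: lte_add_pinfty; [rewrite ltry|apply: lte_mul_pinfty; rewrite ?lee_fin ?invr_ge0 ?(ltW c0)].
have mGx : measurable_fun setT (fun h : V => G (h + x)%R) by rewrite /G; meas.
rewrite -ge0_integralkl; last 4 first.
- by [].
- exact: mGx.
- by move=> h; rewrite /G; pos.
- by rewrite lee_fin invr_ge0 ltW.
rewrite -ge0_integralDT; last 4 first.
- by meas.
- by rewrite /G; meas.
- by move=> h; pos.
- by move=> h; rewrite /G -EFinM lee_fin mulr_ge0 ?sqr_ge0// invr_ge0 ltW.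
apply: ge0_le_integralT; [by meas|by rewrite /G; meas|by move=> h; pos|].
move=> h; rewrite /G -EFinM -EFinD lee_fin.
have m1 : (mollifier r h <= (cutoff_mass r)^-1)%R.
  by rewrite /mollifier ler_piMl ?invr_ge0 ?(ltW c0)// cutoff_le1.
have := v0 (h + x)%R; move: (v (h + x)%R) => t t0.
have mt : (mollifier r h * t ^+ 2 <= (cutoff_mass r)^-1 * t ^+ 2)%R.
  by rewrite ler_wpM2r ?sqr_ge0.
apply: le_trans (lerD (lexx _) mt).
rewrite -[X in (_ <= X + _)%R]mulr1 -mulrDr ler_wpM2l//.
by have := sqr_ge0 (t - 1)%R; nra.
Qed.

Lemma mollifyE x : (mollify r v x)%:E = \int[mu]_y (mollifier r (y - x)%R * v y)%:E.
Proof.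
rewrite -mollify_fin -[RHS](@integral_rV_translate _ _ x (fun y => (mollifier r (y - x)%R * v y)%:E)).
- by apply: eq_integral => h _; rewrite addrK.
- by meas.
- by move=> y; pos.
Qed.

Lemma measurable_mollify : measurable_fun setT (mollify r v).
Proof.
apply: measurableT_comp => //.
apply: (@measurable_integral_rV R d _ V (fun z => (mollifier r z.2 * v (z.2 + z.1)%R)%:E)).
  by meas.
by move=> z; pos.
Qed.
Let mmv := measurable_mollify.

(** The difference of two averages is the average of a difference; Jensen's inequality and
    translation invariance of the energy integral then suffice. *)
Lemma energy_mollify_le : energy (mollify r v) <= energy v.
Proof.
rewrite !energyE//; apply: lee_wpmul2l; first by rewrite lee_fin divr_ge0// ltW.
pose k (x : V) : R := (enorm x `^ (- (4 * b)))%R.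
have mk : measurable_fun setT k by rewrite /k; meas.
have k0 x : (0 <= k x)%R by rewrite /k; pos.
pose F (z : V * (V * V)) : \bar R :=
  (mollifier r z.1 * ((v (z.2.1 + z.1) - v (z.2.2 + z.1)) ^+ 2 * k (z.2.1 - z.2.2)))%:E.
have mF : measurable_fun setT F by rewrite /F; meas.
have F0 z : 0 <= F z by rewrite /F; pos.
have msw : measurable_fun setT (fun z : (V * V) * V => (z.2, z.1)) by meas.
have mFs : measurable_fun setT (fun z : (V * V) * V => F (z.2, z.1)) := measurableT_comp mF msw.
pose J := \int[mu \x mu]_z ((v z.1 - v z.2) ^+ 2 * k (z.1 - z.2))%:E.
have J0 : 0 <= J by rewrite /J; pos.
have FJ : \int[mu \x mu]_z \int[mu]_h F (h, z) = J.
  rewrite -tonelli_rV_rV2//.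
  rewrite (eq_integral (fun h => J * (mollifier r h)%:E)); last first.
    move=> h _; rewrite /F/=; under eq_integral do rewrite EFinM.
    rewrite ge0_integralkl; [|side..].
    by rewrite integral_pair_translate// muleC.
  by rewrite ge0_integralkl; [rewrite integral_mollifier// mule1|side..].
rewrite -[leRHS]/J -FJ; apply: ge0_le_integralT.
- by rewrite /dirichlet_sq; meas.
- exact: (@measurable_integral_rV R d _ (V * V)%type (fun z => F (z.2, z.1)) mFs (fun=> F0 _)).
- by move=> z; rewrite lee_fin mulr_ge0 ?sqr_ge0 ?powR_ge0.
move=> z; rewrite /F/= (eq_integral (fun h => (k (z.1 - z.2))%:E *
    (mollifier r h * (v (h + z.1)%R - v (h + z.2)%R) ^+ 2)%:E)); last first.
  by move=> h _; rewrite -EFinM ![(h + _)%R]addrC; congr EFin; ring.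
rewrite ge0_integralkl; [|side..].
rewrite /dirichlet_sq EFinM muleC; apply: lee_wpmul2l; first by rewrite lee_fin k0.
apply: (@jensen_sqr_dist _ _ _ mu (mollifier r) (fun h => v (h + z.1)) (fun h => v (h + z.2))) => //.
- by meas.
- by meas.
- exact: integral_mollifier.
- exact: mollify_fin.
- exact: mollify_fin.
Qed.

(** Jensen's inequality against the constant [v x] bounds the error by a double integral with the
    mollifier as kernel, which [hK] compares with the energy kernel. The factor [2 / A] undoes the
    constant in the energy. *)
Lemma sqint_mollify_sub (K : R) : (0 <= K)%R ->
  (forall z : V, z != 0%R -> mollifier r z <= K * enorm z `^ (- (4 * b)))%R ->
  L (fun x => mollify r v x - v x)%R <= (K * (2 / A))%:E * energy v.
Proof.
move=> K0 hK; rewrite energyE// muleA -EFinM.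
rewrite (_ : K * (2 / A) * (A / 2) = K)%R; last by field; rewrite gt_eqF.
pose k (x : V) : R := (enorm x `^ (- (4 * b)))%R.
have mk : measurable_fun setT k by rewrite /k; meas.
rewrite -ge0_integralkl; last 4 first.
- by [].
- by rewrite /dirichlet_sq; meas.
- by move=> z; rewrite lee_fin mulr_ge0 ?sqr_ge0 ?powR_ge0.
- by rewrite lee_fin.
rewrite integral_rV2; last 2 first.
- by rewrite /dirichlet_sq; meas.
- by move=> z; apply: mule_ge0; rewrite lee_fin//; apply: mulr_ge0; [exact: sqr_ge0|exact: powR_ge0].
apply: ge0_le_integralT.
- by meas.
- apply: (@measurable_integral_rV R d _ V (fun z => K%:E * (dirichlet_sq v z * enorm (z.1 - z.2) `^ (- (4 * b)))%:E)).
    by rewrite /dirichlet_sq; meas.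
  by move=> z; apply: mule_ge0; rewrite lee_fin//; apply: mulr_ge0; [exact: sqr_ge0|exact: powR_ge0].
- by move=> x; pos.
move=> x; apply: (@le_trans _ _ (\int[mu]_h (mollifier r h * (v (h + x) - v x) ^+ 2)%:E)).
  apply: (@jensen_sqr_dist _ _ _ mu (mollifier r) (fun h => v (h + x)) (fun=> v x)) => //.
  - by meas.
  - exact: integral_mollifier.
  - exact: mollify_fin.
  under eq_integral do rewrite EFinM muleC.
  by rewrite ge0_integralkl; [rewrite integral_mollifier// mule1|side..].
rewrite (_ : \int[mu]_h _ = \int[mu]_y (mollifier r (y - x) * (v y - v x) ^+ 2)%:E); last first.
  rewrite -[RHS](@integral_rV_translate _ _ x (fun y => (mollifier r (y - x)%R * (v y - v x) ^+ 2)%:E)).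
  - by apply: eq_integral => h _; rewrite addrK.
  - by meas.
  - by move=> y; pos.
apply: ge0_le_integralT; [by meas|by rewrite /dirichlet_sq; meas|by move=> y; pos|].
move=> y; rewrite -EFinM lee_fin /dirichlet_sq/=.
have [->|xy] := eqVneq x y; first by rewrite !subrr expr0n !(mulr0, mul0r).
have := hK (y - x)%R; rewrite subr_eq0 eq_sym xy => /(_ isT) h.
rewrite -sqrrN opprB [leRHS](_ : _ = K * enorm (y - x) `^ (- (4 * b)) * (v x - v y) ^+ 2)%R;
  last by rewrite enormB; ring.
by apply: ler_wpM2r; [exact: sqr_ge0|exact: h].
Qed.

Section compact_support.
Variable s : R.
Hypotheses (s0 : (0 < s)%R) (vs : forall x, (s < `|x|)%R -> v x = 0%R).

Lemma integral_compact_lty : \int[mu]_x (v x)%:E < +oo.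
Proof.
have mc := mcut s; have cc := cut0 s.
apply: (@le_lt_trans _ _ (\int[mu]_x (cutoff s x)%:E + L v)).
  rewrite /sqint -ge0_integralDT; [|side..].
  apply: ge0_le_integralT; [by meas|by meas|by move=> x; pos|].
  move=> x; rewrite -EFinD lee_fin; have [xs|xs] := leP `|x|%R s.
    by rewrite cutoff_eq1//; have := sqr_ge0 (v x - 1)%R; have := v0 x; nra.
  by rewrite vs// expr0n addr0.
by apply: lte_add_pinfty => //; exact: integral_cutoff_lty.
Qed.

(** The difference falls on the mollifier, which inherits the Lipschitz bound of the cutoff. It is
    stated as an inequality of sums before integrating, to avoid subtraction. *)
Lemma mollify_lip x y : (mollify r v x - mollify r v y <=
  ((cutoff_mass r)^-1 / r * fine (\int[mu]_z (v z)%:E)) * `|x - y|)%R.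
Proof.
have c0 := cutoff_mass_gt0 r0.
rewrite lerBlDl -lee_fin EFinD !mollifyE.
set M := fine _.
have ME : M%:E = \int[mu]_z (v z)%:E.
  by rewrite fineK// ge0_fin_numE ?integral_compact_lty//; pos.
rewrite (_ : (_ * `|x - y|)%R = ((cutoff_mass r)^-1 / r * `|x - y|) * M)%R; last by ring.
rewrite EFinM ME -ge0_integralkl; last 4 first.
- by [].
- by meas.
- by move=> z; pos.
- by rewrite lee_fin !mulr_ge0 ?invr_ge0// ltW.
rewrite -ge0_integralDT; last 4 first.
- by meas.
- by meas.
- by move=> z; pos.
- by move=> z; rewrite -EFinM lee_fin !mulr_ge0 ?invr_ge0// ltW.
apply: ge0_le_integralT; [by meas|by meas|by move=> z; pos|].
move=> z; rewrite -EFinM -EFinD lee_fin -mulrDl ler_wpM2r//.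
have := cutoff_lip (z - x) (z - y) r0.
rewrite (_ : z - x - (z - y) = y - x)%R; last by rewrite opprB addrC addrA subrK.
rewrite (distrC y x) => /(le_trans (ler_norm _)) h.
rewrite /mollifier -subr_ge0 (_ : _ - _ =
  (cutoff_mass r)^-1 * (`|x - y| / r - (cutoff r (z - x) - cutoff r (z - y))))%R; last by ring.
by rewrite mulr_ge0 ?invr_ge0 ?(ltW c0)// subr_ge0.
Qed.

Lemma mollify_C0 : C0 (mollify r v).
Proof.
apply/C0P; split.
  apply: (@lip_continuous _ _ _ ((cutoff_mass r)^-1 / r * fine (\int[mu]_z (v z)%:E))%R).
  move=> x y; rewrite ler_norml; apply/andP; split; last exact: mollify_lip.
  by rewrite lerNl opprB distrC; exact: mollify_lip.
exists (s + 2 * r)%R => x xs; apply: EFin_inj; rewrite -mollify_fin.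
rewrite integral0_eq// => h _.
have [hr|hr] := leP (2 * r)%R `|h|%R.
  by rewrite /mollifier cutoff_eq0// !mul0r.
rewrite vs ?mulr0//.
apply: (@lt_le_trans _ _ (`|x| - `|h|)%R); last by rewrite (addrC h x) lerB_normD.
by rewrite ltrBrDr; apply: lt_trans xs; rewrite ltrD2l.
Qed.

End compact_support.
End nonneg.

End mollifier.

(** * Density of C0 in the form domain *)

Section density.
Context {R : realType} {d : nat} (alpha : R).
Hypotheses (alpha_gt0 : (0 < alpha)%R) (alpha_lt2 : (alpha < 2)%R).
Hypotheses (d0 : (0 < d)%N) (alpha_ltd : (alpha < d%:R)%R).
#[local] Opaque Gamma.
Local Open Scope ereal_scope.
Local Notation mu := (@lebesgue_rV R d).
Local Notation V := 'rV[R]_d.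
Local Notation b := ((d%:R + alpha) / 4 : R)%R.
Local Notation A := (stable_const d alpha).
Local Notation L := (sqint mu).
Local Notation energy := (energy alpha).
Local Notation gform := (gform alpha).
Implicit Types (u v w : V -> R) (r : R).

Let A0 : (0 < A)%R := stable_const_gt0 alpha_gt0 alpha_lt2 d0.
Let mone : measurable_fun setT (@one_weight R d).
Proof. by rewrite /one_weight; meas. Qed.
Let mek := @measurable_energy_kernel R d alpha.
Let mip := @measurable_inv_phi R d alpha.
Let mgk := @measurable_ground_kernel R d alpha.

(** A product rule: the increment of [cutoff * u] splits into an increment of [u] and one of the
    cutoff. The second is estimated by [cutoff_carre_le], whose bound is uniform for [r >= 1]. *)
Lemma energy_cutoff_le : exists2 C : R, (0 <= C)%R & forall r u, (1 <= r)%R ->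
  measurable_fun setT u ->
  energy (fun x => cutoff r x * u x)%R <= 2%:E * energy u + C%:E * L u.
Proof.
have q1 : (d%:R / 2 < 2 * b)%R by rewrite (_ : 2 * b = (d%:R + alpha) / 2)%R; [rewrite ltr_pM2r// ltrDl|field].
have q2 : (2 * b < d%:R / 2 + 1)%R.
  by rewrite -subr_gt0 (_ : _ - _ = (2 - alpha) / 2)%R; [rewrite divr_gt0// subr_gt0|field].
have [C C0 hC] := cutoff_carre_le d0 q1 q2.
exists (A * C)%R; first by rewrite mulr_ge0// ltW.
move=> r u r1 mu_; have r0 := lt_le_trans ltr01 r1.
have mc := @measurable_cutoff R d r.
pose k (x : V) : R := (enorm x `^ (- (4 * b)))%R.
have mk : measurable_fun setT k by rewrite /k; meas.
have k0 x : (0 <= k x)%R by rewrite /k; pos.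
have A20 : (0 <= A / 2)%R by rewrite divr_ge0// ltW.
have A1 : (0 <= A)%R by exact: ltW.
pose F (z : V * V) : \bar R := (u z.1 ^+ 2 * ((cutoff r z.1 - cutoff r z.2) ^+ 2 * k (z.1 - z.2)))%:E.
have mF : measurable_fun setT F by rewrite /F; meas.
have F0 z : 0 <= F z by rewrite /F; pos.
have FL : \int[mu \x mu]_z F z <= C%:E * L u.
  rewrite (integral_rV2 mF F0) /sqint -ge0_integralkl; [|side..].
  apply: ge0_le_integralT; [exact: (@measurable_integral_rV R d _ V F mF F0)|by meas|by move=> x; pos|].
  move=> x; rewrite /F/=; under eq_integral do rewrite EFinM.
  rewrite ge0_integralkl; [|side..].
  have := hC r x r0; rewrite (_ : 2 * (2 * b) = 4 * b)%R; last by ring.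
  move=> h; rewrite muleC; apply: lee_wpmul2r; first by rewrite lee_fin sqr_ge0.
  apply: (le_trans h); rewrite lee_fin -[leRHS]mulr1 ler_wpM2l//.
  apply: mulr_ile1; rewrite ?powR_ge0//.
    rewrite (_ : d%:R - 4 * b = - alpha)%R; last by field.
    rewrite powRN invf_le1 ?powR_gt0//.
    have := @ge0_ler_powR R alpha (ltW alpha_gt0) 1%R r.
    by rewrite !nnegrE powR1; apply => //; exact: ltW.
  have B1 : (1 <= 1 + r ^- 2 * enorm x ^+ 2)%R.
    by rewrite lerDl mulr_ge0 ?sqr_ge0// invr_ge0 sqr_ge0.
  rewrite powRN invf_le1 ?powR_gt0// ?(lt_le_trans ltr01)//.
  have b0 : (0 <= 2 * b)%R by rewrite mulr_ge0// divr_ge0// addr_ge0// ltW.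
  have := @ge0_ler_powR R (2 * b)%R b0 1%R (1 + r ^- 2 * enorm x ^+ 2)%R.
  by rewrite !nnegrE powR1; apply => //; exact: le_trans B1.
rewrite !energyE//; last by meas.
pose D (z : V * V) : \bar R := (dirichlet_sq u z * k (z.1 - z.2)%R)%:E.
have mD : measurable_fun setT D by rewrite /D /dirichlet_sq; meas.
have D0 z : 0 <= D z by rewrite /D lee_fin mulr_ge0 ?sqr_ge0.
have key : \int[mu \x mu]_z (dirichlet_sq (fun x => cutoff r x * u x) z * k (z.1 - z.2))%:E <=
    2%:E * \int[mu \x mu]_z D z + 2%:E * \int[mu \x mu]_z F z.
  rewrite -!ge0_integralkl; last 8 first.
  - by [].
  - exact: mF.
  - exact: F0.
  - by rewrite lee_fin.
  - by [].
  - exact: mD.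
  - exact: D0.
  - by rewrite lee_fin.
  rewrite -ge0_integralDT; last 4 first.
  - by meas.
  - by meas.
  - by move=> z; rewrite mule_ge0// ?lee_fin.
  - by move=> z; rewrite mule_ge0// ?lee_fin.
  apply: ge0_le_integralT.
  - by rewrite /dirichlet_sq; meas.
  - by meas.
  - by move=> z; rewrite lee_fin mulr_ge0 ?sqr_ge0.
  move=> z; rewrite /D /F -!EFinM -EFinD lee_fin /dirichlet_sq.
  have := cutoff_norm_le1 r z.2; move: (k0 (z.1 - z.2)%R).
  move: (cutoff r z.1) (cutoff r z.2) (u z.1) (u z.2) (k _) => c1 c2 u1 u2 kk kk0 c21.
  rewrite [leRHS](_ : _ = (2 * (u1 - u2) ^+ 2 + 2 * (u1 ^+ 2 * (c1 - c2) ^+ 2)) * kk)%R; last by ring.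
  apply: ler_wpM2r => //.
  have c22 : (c2 ^+ 2 <= 1)%R by rewrite -real_normK ?num_real// expr_le1.
  apply: (@le_trans _ _ (2 * (c2 ^+ 2 * (u1 - u2) ^+ 2) + 2 * (u1 ^+ 2 * (c1 - c2) ^+ 2))%R).
    rewrite -subr_ge0 (_ : _ - _ = (c2 * (u1 - u2) - u1 * (c1 - c2)) ^+ 2)%R ?sqr_ge0//; ring.
  by rewrite lerD2r ler_wpM2l// ler_piMl ?sqr_ge0.
apply: le_trans (lee_wpmul2l _ key) _; first by rewrite lee_fin.
rewrite ge0_muleDr; last 2 first.
- by apply: mule_ge0; [rewrite lee_fin|apply: integral_ge0].
- by apply: mule_ge0; [rewrite lee_fin|apply: integral_ge0].
apply: leeD; first by rewrite muleCA.
rewrite muleA -EFinM (_ : A / 2 * 2 = A)%R; last by field.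
by rewrite [(A * C)%:E]EFinM -muleA; apply: lee_wpmul2l; rewrite ?lee_fin.
Qed.

Lemma sqint_sub_lty u v : measurable_fun setT u -> measurable_fun setT v ->
  L u < +oo -> L v < +oo -> L (fun x => u x - v x)%R < +oo.
Proof.
move=> mu_ mv Lu Lv; apply: le_lt_trans (sqint_sub_le _ mu_ mv) _.
by apply: lte_mul_pinfty; rewrite ?lee_fin//; exact: lte_add_pinfty.
Qed.

Lemma energy_sub_le u v (C D : R) : measurable_fun setT u -> measurable_fun setT v ->
  energy u <= C%:E -> energy v <= D%:E ->
  energy (fun x => u x - v x)%R <= (2 * (C + D))%:E.
Proof.
move=> mu_ mv uC vD; apply: le_trans (pform_sub_le mone mek mu_ mv) _.
by rewrite EFinM [(C + D)%:E]EFinD; apply: lee_wpmul2l; rewrite ?lee_fin//; exact: leeD.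
Qed.

(** Only a uniform energy bound is recorded, not convergence in energy; [bounded_hull_cauchy]
    supplies the Cauchy property afterwards. *)
Definition approximable u := exists v_ : nat -> V -> R, exists C : R,
  [/\ forall n, measurable_fun setT (v_ n), forall n, C0 (v_ n),
      forall n, L (v_ n) < +oo, forall n, energy (v_ n) <= C%:E & L2_cvg v_ u].

Lemma approximable_ge0 u : measurable_fun setT u -> (forall x, (0 <= u x)%R) ->
  L u < +oo -> energy u < +oo -> approximable u.
Proof.
move=> mu_ u0 Lu Eu.
have [C C0_ hC] := energy_cutoff_le.
have [K K0 hK] := mollifier_le_kernel alpha_gt0 d0.
have Euf : energy u \is a fin_num by rewrite ge0_fin_numE// pform_ge0.
have Luf : L u \is a fin_num by rewrite ge0_fin_numE// sqint_ge0.
pose C1 : R := (2 * fine (energy u) + C * fine (L u))%R.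
have C10 : (0 <= C1)%R by rewrite addr_ge0// mulr_ge0// fine_ge0// ?pform_ge0 ?sqint_ge0.
pose w n x : R := (cutoff n.+1%:R x * u x)%R.
have mc n := @measurable_cutoff R d n.+1%:R.
have mw n : measurable_fun setT (w n) by have := mc n => ?; rewrite /w; meas.
have w0 n x : (0 <= w n x)%R by rewrite /w mulr_ge0 ?cutoff_ge0.
have wu n x : (`|w n x| <= `|u x|)%R.
  by rewrite /w normrM ler_piMl// cutoff_norm_le1.
have Lw n : L (w n) < +oo by apply: le_lt_trans Lu; apply: le_sqint.
have Ew n : energy (w n) <= C1%:E.
  apply: le_trans (hC n.+1%:R u _ mu_) _; first by rewrite ler1n.
  by rewrite -(fineK Euf) -(fineK Luf) -!EFinM -EFinD.
have w_cvg : L2_cvg w u.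
  apply: (@sqint_dominated _ _ _ mu (fun n x => w n x - u x)%R u).
  - by move=> n; have := mw n => ?; meas.
  - exact: mu_.
  - move=> x; apply/cvgrPdist_le => e e0; near=> n.
    have xn : (`|x| <= n.+1%:R)%R.
      apply: (@le_trans _ _ n%:R); last by rewrite ler_nat.
      by near: n; exact: nbhs_infty_ger.
    by rewrite /w cutoff_eq1// mul1r subrr subr0 normr0 ltW.
  - move=> n x; rewrite /w -{2}[u x]mul1r -mulrBl normrM ler_piMl//.
    have := @cutoff_ge0 R d n.+1%:R x; have := @cutoff_le1 R d n.+1%:R x.
    by move=> *; rewrite ler_norml; apply/andP; split; lra.
  - exact: Lu.
(* Chosen so that [r ^ alpha = 1 / (n + 1)] in the mollification error. *)
pose r (n : nat) : R := (n.+1%:R `^ (- alpha^-1))%R.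
have r0 n : (0 < r n)%R by rewrite /r powR_gt0.
have rE n : (r n `^ alpha = n.+1%:R^-1)%R.
  by rewrite /r -powRrM mulNr mulVf ?gt_eqF// powR_inv1.
pose v n := mollify (r n) (w n).
have mv n : measurable_fun setT (v n) by exact: measurable_mollify.
pose K1 : R := (K * (2 / A) * C1)%R.
have K10 : (0 <= K1)%R by rewrite /K1 !mulr_ge0// invr_ge0 ltW.
have vw n : L (fun x => v n x - w n x)%R <= (K1 * r n `^ alpha)%:E.
  have Kr0 : (0 <= K * r n `^ alpha)%R by rewrite mulr_ge0 ?powR_ge0.
  have h := sqint_mollify_sub alpha_gt0 alpha_lt2 d0 (r0 n) (mw n) (w0 n) (Lw n) Kr0 (fun z => hK (r n) z (r0 n)).
  apply: (le_trans h); apply: le_trans (lee_wpmul2l _ (Ew n)) _.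
    by rewrite lee_fin mulr_ge0// divr_ge0// ltW.
  by rewrite -EFinM lee_fin /K1 le_eqVlt; apply/orP; left; apply/eqP; ring.
exists v, C1; split => //.
- move=> n; apply: (@mollify_C0 _ _ _ _ (r0 n) (mw n) (w0 n) (Lw n) (2 * n.+1%:R)%R).
    by rewrite mulr_gt0.
  by move=> x /ltW xn; rewrite /w cutoff_eq0// mul0r.
- move=> n; have h := sqint_add_le mu (measurable_funB (mv n) (mw n)) (mw n).
  rewrite (_ : v n = fun x => v n x - w n x + w n x)%R; last first.
    by apply/funext => x; rewrite subrK.
  apply: (le_lt_trans h); apply: lte_mul_pinfty; rewrite ?lee_fin//.
  by apply: lte_add_pinfty => //; apply: le_lt_trans (vw n) _; rewrite ltry.
- move=> n; apply: le_trans (Ew n).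
  exact: (energy_mollify_le alpha_gt0 alpha_lt2 d0 (r0 n) (mw n) (w0 n) (Lw n)).
move=> e e0; have e4 : (0 < e / 4)%R by rewrite divr_gt0.
have [N1 hN1] := w_cvg _ e4.
pose N2 := (Num.truncn (K1 / (e / 4))).+1.
exists (maxn N1 N2) => n; rewrite geq_max => /andP[n1 n2].
rewrite (_ : (fun x => _) = fun x => (v n x - w n x) + (w n x - u x))%R; last first.
  by apply/funext => x; rewrite addrA subrK.
apply: le_trans (sqint_add_le _ (measurable_funB (mv n) (mw n)) (measurable_funB (mw n) mu_)) _.
apply: (@le_trans _ _ (2%:E * ((e / 4)%:E + (e / 4)%:E))); last first.
  by rewrite -EFinD -EFinM lee_fin le_eqVlt; apply/orP; left; apply/eqP; field.
apply: lee_wpmul2l; rewrite ?lee_fin//; apply: leeD; last exact: hN1.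
apply: (le_trans (vw n)); rewrite lee_fin rE ler_pdivrMr// mulrC -ler_pdivrMr//.
apply: ltW; apply: lt_le_trans (truncnS_gt _) _.
by rewrite ler_nat; apply: leq_trans n2 _.
Unshelve. all: by end_near. Qed.

(** The mollifier lemmas are for nonnegative functions. Positive and negative parts are contractions
    of [u], so they have no more energy and are treated separately. *)
Lemma approximable_dom u : measurable_fun setT u -> L u < +oo -> energy u < +oo ->
  approximable u.
Proof.
move=> mu_ Lu Eu.
pose up x : R := Num.max 0%R (u x); pose um x : R := Num.max 0%R (- u x)%R.
have mp : measurable_fun setT up by rewrite /up; meas.
have mm : measurable_fun setT um by rewrite /um; meas.
have pu x : (`|up x| <= `|u x|)%R.
  by have := max_dist_le 0%R (u x) 0%R; rewrite maxxx !subr0.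
have mu' x : (`|um x| <= `|u x|)%R.
  by have := max_dist_le 0%R (- u x)%R 0%R; rewrite maxxx !subr0 normrN.
have Ep : energy up <= energy u by apply: le_energy => // x y; exact: max_dist_le.
have Em : energy um <= energy u.
  apply: le_energy => // x y; apply: le_trans (max_dist_le _ _ _) _.
  by rewrite opprK addrC distrC.
have Lp : L up < +oo by apply: le_lt_trans Lu; exact: le_sqint.
have Lm : L um < +oo by apply: le_lt_trans Lu; exact: le_sqint.
have p0 x : (0 <= up x)%R by rewrite le_max lexx.
have m0 x : (0 <= um x)%R by rewrite le_max lexx.
have [vp [Cp [mvp cvp Lvp Evp hp]]] := approximable_ge0 mp p0 Lp (le_lt_trans Ep Eu).
have [vm [Cm [mvm cvm Lvm Evm hm]]] := approximable_ge0 mm m0 Lm (le_lt_trans Em Eu).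
exists (fun n x => vp n x - vm n x)%R, (2 * (Cp + Cm))%R; split.
- by move=> n; apply: measurable_funB.
- move=> n; have := C0_lin 1 (-1) (cvp n) (cvm n).
  by under [X in C0 X -> _]eq_fun do rewrite mul1r mulN1r.
- by move=> n; exact: sqint_sub_lty.
- by move=> n; exact: energy_sub_le.
move=> e e0; have e4 : (0 < e / 4)%R by rewrite divr_gt0.
have [N1 h1] := hp _ e4; have [N2 h2] := hm _ e4.
exists (maxn N1 N2) => n; rewrite geq_max => /andP[n1 n2].
rewrite (_ : (fun x => _) = fun x => (vp n x - up x) - (vm n x - um x))%R; last first.
  apply/funext => x; have -> : u x = (up x - um x)%R.
    by rewrite /up /um; case: (leP 0%R (u x)) => ux; case: (leP 0%R (- u x)%R) => ux'; lra.
  by ring.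
apply: le_trans (sqint_sub_le _ (measurable_funB (mvp n) mp) (measurable_funB (mvm n) mm)) _.
apply: (@le_trans _ _ (2%:E * ((e / 4)%:E + (e / 4)%:E))).
  by apply: lee_wpmul2l; rewrite ?lee_fin//; apply: leeD; [exact: h1|exact: h2].
by rewrite -EFinD -EFinM lee_fin le_eqVlt; apply/orP; left; apply/eqP; field.
Qed.

End density.

(** * Extended Dirichlet and Schroedinger spaces *)

Section forms.
Context {R : realType} {d : nat} (alpha : R).
Hypotheses (alpha_gt0 : (0 < alpha)%R) (alpha_lt2 : (alpha < 2)%R).
Hypotheses (d0 : (0 < d)%N) (alpha_ltd : (alpha < d%:R)%R).
#[local] Opaque Gamma.
Local Open Scope ereal_scope.
Local Notation mu := (@lebesgue_rV R d).
Local Notation V := 'rV[R]_d.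
Local Notation kappa := (kappa_star d alpha).
Local Notation L := (sqint mu).
Local Notation W := (hardy_mass alpha).
Local Notation energy := (energy alpha).
Local Notation gform := (gform alpha).
Local Notation phi := (@phi R d alpha).
Local Notation stable := (stable_form d alpha).
Local Notation preform := (hardy_preform d alpha).
Local Notation hardy := (hardy_form d alpha).
Implicit Types (u v w : V -> R).

Let kappa0 : (0 < kappa)%R := kappa_gt0 alpha_gt0 d0 alpha_ltd.
Let mone : measurable_fun setT (@one_weight R d).
Proof. by rewrite /one_weight; meas. Qed.
Let mek := @measurable_energy_kernel R d alpha.
Let mip := @measurable_inv_phi R d alpha.
Let mgk := @measurable_ground_kernel R d alpha.

Lemma stable_domP u : qdom stable u <-> [/\ measurable_fun setT u, L u < +oo & energy u < +oo].
Proof.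
by split=> -[mu_ Lu Eu]; split => //; first [exact/finite_norm2 |
  by rewrite -?stable_energyE// stable_energyE].
Qed.

Lemma stable_represented : represented (@one_weight R d) (energy_kernel alpha) stable.
Proof.
split=> [u /stable_domP//|u /stable_domP[mu_ _ _]|u v /stable_domP[mu_ Lu Eu] /stable_domP[mv Lv Ev]].
  by rewrite /= stable_energyE.
apply/stable_domP; split; [by meas|exact: sqint_sub_lty|].
apply: le_lt_trans (pform_sub_le mone mek mu_ mv) _.
by apply: lte_mul_pinfty; rewrite ?lee_fin//; exact: lte_add_pinfty.
Qed.

Lemma hardy_preform_represented :
  represented (inv_phi alpha) (ground_kernel alpha) preform.
Proof.
have [sfin sval ssub] := stable_represented.
split=> [u [/stable_domP[mu_ Lu Eu] _]|u [/stable_domP[mu_ Lu Eu] _]|u v [du cu] [dv cv]].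
- split => //.
  exact: (le_lt_trans (gform_le_energy alpha_gt0 alpha_lt2 d0 alpha_ltd mu_ Lu Eu) Eu).
- rewrite -[RHS]/(fine (gform u)) fine_gform//= stable_energyE//.
split; first exact: ssub.
rewrite (_ : (fun x => _) = fun x => 1 * u x + (-1) * v x)%R; first exact: C0_lin.
by apply/funext => x; rewrite mul1r mulN1r.
Qed.

Lemma hardy_represented : represented (inv_phi alpha) (ground_kernel alpha) hardy.
Proof. by apply: closure_represented => //; exact: hardy_preform_represented. Qed.

Lemma hardy_preform_mid u v : qdom preform u -> qdom preform v -> qdom preform (midpoint u v).
Proof.
move=> [/stable_domP[mu_ Lu Eu] cu] [/stable_domP[mv Lv Ev] cv]; split.
  apply/stable_domP; split.
  - by rewrite /midpoint; meas.
  - apply: (@le_lt_trans _ _ (L u + L v)); last exact: lte_add_pinfty.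
    by apply: sqint_mid_le => //; rewrite ?leeDl ?leeDr// sqint_ge0.
  - apply: (@le_lt_trans _ _ (energy u + energy v)); last exact: lte_add_pinfty.
    by apply: pform_mid_le => //; rewrite ?leeDl ?leeDr// pform_ge0.
rewrite (_ : midpoint u v = fun x => 2^-1 * u x + 2^-1 * v x)%R; first exact: C0_lin.
by apply/funext => x; rewrite /midpoint; ring.
Qed.

Lemma tail_hull_preform (u_ : nat -> V -> R) n v : (forall n, qdom preform (u_ n)) ->
  tail_hull u_ n v -> qdom preform v.
Proof. by move=> du; elim => [//|v1 v2 _ h1 _ h2]; exact: hardy_preform_mid. Qed.

(** The bridge from boundedness to the Cauchy property, used both for [phi] and for the inclusion of
    the domains: on C0 functions of finite energy [G] is finite and satisfies the parallelogram
    identity. *)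
Lemma bounded_hull_cauchy (u_ : nat -> V -> R) (C : R) :
  (forall n, qdom preform (u_ n)) -> (forall n, gform (u_ n) <= C%:E) ->
  exists2 w_ : nat -> V -> R, (forall n, tail_hull u_ n (w_ n)) &
    seq_cauchy (inv_phi alpha) (ground_kernel alpha) w_.
Proof.
move=> du uC; have [pfin pval psub] := hardy_preform_represented.
have hd n v (h : tail_hull u_ n v) := tail_hull_preform du h.
have gf v : qdom preform v -> gform v = (fine (gform v))%:E.
  by move=> /pfin[_ _ gv]; rewrite fineK// ge0_fin_numE// pform_ge0.
have [||v w hv hw|w_ hw cw] := @banach_saks R V u_ (fun v => fine (gform v)) C.
- by move=> v _; rewrite fine_ge0// pform_ge0.
- by move=> n; rewrite -lee_fin -gf.
- have dv := hd _ _ hv; have dw := hd _ _ hw.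
  have [mv _ _] := pfin _ dv; have [mw _ _] := pfin _ dw.
  have h := pform_mid mip mgk mv mw; rewrite -!/(gform _) in h.
  rewrite (gf _ (hardy_preform_mid dv dw)) (gf _ (psub _ _ dv dw)) (gf _ dv) (gf _ dw) in h.
  by move: h; rewrite -!EFinD -!EFinM -?EFinD => -[]; lra.
exists w_ => // e e0; have [N hN] := cw _ e0; exists N => n m Nn Nm.
rewrite -/(gform _) gf ?lee_fin; last by apply: psub; exact: hd.
exact: hN.
Qed.

(** Approximants of bounded energy have bounded [G], so their hulls contain a [G]-Cauchy sequence
    that still converges to [u] in L2. *)
Lemma stable_sub_hardy u : qdom stable u -> qdom hardy u.
Proof.
move=> /stable_domP[mu_ Lu Eu].
have [v_ [C [mv cv Lv Ev vu]]] := approximable_dom alpha_gt0 alpha_lt2 d0 mu_ Lu Eu.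
have Ev' n : energy (v_ n) < +oo by apply: le_lt_trans (Ev n) _; rewrite ltry.
have dv n : qdom preform (v_ n) by split => //; exact/stable_domP.
have gv n : gform (v_ n) <= C%:E.
  by apply: le_trans (Ev n); exact: gform_le_energy.
have [w_ hw cw] := bounded_hull_cauchy dv gv.
apply: (@closure_intro _ _ _ _ _ hardy_preform_represented w_) => //.
- by move=> n; exact: tail_hull_preform (hw n).
move=> e e0; have [N hN] := vu _ e0; exists N => n Nn.
(* L2 balls around [u] are stable under midpoints, so the bound on the tail of [v_] passes to its
   hull by induction. *)
have [] : measurable_fun setT (w_ n) /\ L (fun x => w_ n x - u x)%R <= e%:E; last by [].
have := tail_hull_le Nn (hw n); move: (w_ n) => w; elim.
  by move=> k Nk; split; [exact: mv|exact: hN].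
move=> w1 w2 _ [m1 h1] _ [m2 h2]; split; first by rewrite /midpoint; meas.
rewrite (_ : (fun x => _) = fun x => ((w1 x - u x) + (w2 x - u x)) / 2)%R; last first.
  by apply/funext => x; rewrite /midpoint; field.
by apply: sqint_mid_le => //; exact: measurable_funB.
Qed.

Lemma gform_phi : gform phi = 0.
Proof.
rewrite /gform /pform /sqint integral0_eq// => z _.
rewrite /pair_diff /ground_kernel /inv_phi.
move: (phi z.1) (phi z.2) (energy_kernel alpha z) => s t k.
have [->|s0] := eqVneq s 0%R; first by rewrite [(0 * t)%R]mul0r sqrtr0 [(0 * k)%R]mul0r mulr0 expr0n.
have [->|t0] := eqVneq t 0%R; first by rewrite [(s * 0)%R]mulr0 sqrtr0 [(0 * k)%R]mul0r mulr0 expr0n.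
by rewrite !divff// subrr mul0r expr0n.
Qed.

Lemma power_deltaE : @power_delta R d alpha = EFin \o phi.
Proof. by apply/funext => x; rewrite /power_delta /= phiE. Qed.

Lemma fine_power_delta : fine \o @power_delta R d alpha = phi.
Proof. by rewrite power_deltaE; apply/funext => x. Qed.

Lemma ae_neq0 : {ae mu, forall x : V, x != 0%R}.
Proof.
exists [set 0%R]; split.
- exact: measurable_rV_set0.
- exact: lebesgue_rV_set0.
- by move=> x /= /negP/negPn/eqP.
Qed.

(** The test functions are bounded in [G]; hull elements of their tails remain in the form domain
    and keep the pointwise limit [phi]. *)
Lemma ext_dom_power_delta : ext_dom mu hardy (@power_delta R d alpha).
Proof.
have [C C0_ hC] := gform_test_le alpha_gt0 alpha_lt2 d0 alpha_ltd.
have dt n : qdom preform (test_fun alpha n).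
  split; last exact: test_fun_C0.
  apply/stable_domP; split.
  - exact: measurable_test_fun.
  - exact: sqint_test_fun.
  - exact: energy_test_fun.
have [w_ hw cw] := bounded_hull_cauchy dt hC.
rewrite power_deltaE; apply: (ext_dom_intro hardy_represented) cw _.
- exact: measurable_phi.
- move=> n; apply: sub_closure; first exact: hardy_preform_represented.
  exact: tail_hull_preform (hw n).
- apply: nearW => x; apply: (tail_hull_cvg hw); exact: test_fun_cvg.
Qed.

Lemma ext_val_power_delta : ext_val mu hardy (@power_delta R d alpha) = 0%R.
Proof.
have dp := ext_dom_power_delta; have [m f _] := dp.
rewrite (ext_valE mip mgk hardy_represented m f dp).
by rewrite fine_power_delta -/(gform phi) gform_phi.
Qed.

Lemma power_delta_gt0 : {ae mu, forall x, 0 < @power_delta R d alpha x}.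
Proof.
by apply: filterS ae_neq0 => x x0; rewrite power_deltaE lte_fin phi_gt0.
Qed.

Lemma hardy_mass_phi : W phi = +oo.
Proof.
rewrite -(integral_power_dim d0); apply: eq_integral => x _; congr EFin.
rewrite /phi /gphi; have [->|x0] := eqVneq x 0%R.
  rewrite (_ : enorm 0 = 0)%R; last by apply/eqP; rewrite enorm_eq0.
  rewrite [X in (_ * X)%R]powR0 ?mulr0 ?powR0// oppr_eq0 gt_eqF//.
  by rewrite ltr0n.
rewrite -powR_mulrn ?powR_ge0// -powRrM -gt0_powRD ?enorm_gt0//.
by congr (_ `^ _)%R; field.
Qed.

Section ext_stable.
Variable u : V -> \bar R.
Hypothesis du : ext_dom mu stable u.
Local Notation v := (fine \o u).

(** Along an energy-Cauchy sequence, [G <= E] and Hardy's inequality make both parts of the ground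
    state identity converge. The identity therefore extends to the limit, which need not be in
    L2. *)
Lemma ext_stable_approx : exists2 u_ : nat -> V -> R, ext_approx mu stable u_ u &
  [/\ W v < +oo, gform v < +oo, energy v < +oo &
      fine (energy v) = (fine (gform v) + kappa * fine (W v))%R].
Proof.
have [mu_ fu [u_ hu]] := du; exists u_ => //.
have [cu Ev Evu uv] := ext_approx_cvg mone mek stable_represented mu_ fu hu.
have [dn /(represented_cauchyP stable_represented dn) cn _] := hu.
have [sfin sval ssub] := stable_represented.
have mv : measurable_fun setT v by exact: measurableT_comp.
have mn n : measurable_fun setT (u_ n) by have [] := sfin _ (dn n).
have Ln n : L (u_ n) < +oo by have [] := sfin _ (dn n).
have En n : energy (u_ n) < +oo by have [] := sfin _ (dn n).
have Gn n : gform (u_ n) < +oo.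
  by apply: le_lt_trans (En n); exact: (gform_le_energy alpha_gt0 alpha_lt2 d0 alpha_ltd (mn n)).
have Wn n : W (u_ n) < +oo.
  exact: (hardy_mass_fin alpha_gt0 alpha_lt2 d0 alpha_ltd (mn n) (Ln n) (En n)).
have cG : seq_cauchy (inv_phi alpha) (ground_kernel alpha) u_.
  move=> e e0; have [N hN] := cn _ e0; exists N => n m Nn Nm.
  apply: le_trans (hN n m Nn Nm); have [m1 L1 E1] := sfin _ (ssub _ _ (dn n) (dn m)).
  exact: (gform_le_energy alpha_gt0 alpha_lt2 d0 alpha_ltd m1 L1 E1).
have [Gv _ Gcvg] := pform_cauchy mip mgk mn mv Gn cu cG.
have mm n : measurable_fun setT (mass_map alpha (u_ n)) by exact: measurable_mass_map.
have mmv : measurable_fun setT (mass_map alpha v) by exact: measurable_mass_map.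
have cm : {ae mu, forall x, mass_map alpha (u_ n) x @[n --> \oo] --> mass_map alpha v x}.
  by apply: filterS cu => x cx; apply: cvgM; [exact: cx|exact: cvg_cst].
have cW e : (0 < e)%R -> exists N, forall n, (N <= n)%N ->
    sqint mu (fun x => mass_map alpha (u_ n) x - mass_map alpha v x)%R <= e%:E.
  move=> e0; have [N hN] := cn _ (mulr_gt0 kappa0 e0); exists N => n Nn.
  apply: (sqint_cauchy_cvg mm mmv cm _ Nn) => i j Ni Nj.
  rewrite (_ : (fun z => _) = mass_map alpha (fun x => u_ i x - u_ j x)%R); last first.
    by apply/funext => x; rewrite /mass_map; ring.
  have [m1 L1 E1] := sfin _ (ssub _ _ (dn i) (dn j)).
  rewrite -hardy_massE -(@lee_pmul2l _ kappa%:E) ?lte_fin//.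
  apply: le_trans (hardy_inequality alpha_gt0 alpha_lt2 d0 alpha_ltd m1 L1) _.
  exact: hN.
have Wv : W v < +oo.
  have [N hN] := cW _ ltr01.
  have := @sqint_absD_le _ _ _ mu _ _ _ ltr01 (mm N) mmv.
  rewrite hardy_massE => /le_lt_trans; apply.
  apply: lte_add_pinfty; apply: lte_mul_pinfty => //.
    by rewrite -hardy_massE; exact: Wn.
  by apply: le_lt_trans (hN _ (leqnn _)) _; rewrite ltry.
split => //.
have Wcvg : fine (W (u_ n)) @[n --> \oo] --> fine (W v).
  rewrite (_ : (fun n => fine (W (u_ n))) = fun n => fine (sqint mu (mass_map alpha (u_ n)))).
    rewrite hardy_massE; apply: sqint_cvg => //.
    by rewrite -hardy_massE.
  by apply/funext => n; rewrite hardy_massE.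
have lim : (fine (gform (u_ n)) + kappa * fine (W (u_ n)))%R @[n --> \oo] -->
    (fine (gform v) + kappa * fine (W v))%R.
  by apply: cvgD => //; apply: cvgM => //; exact: cvg_cst.
have uv' := uv; rewrite (_ : (fun n => stable (u_ n)) =
    fun n => (fine (gform (u_ n)) + kappa * fine (W (u_ n)))%R) in uv'; last first.
  apply/funext => n; rewrite (fine_gform alpha_gt0 alpha_lt2 d0 alpha_ltd (mn n) (Ln n) (En n)).
  by rewrite subrK sval.
exact: (cvg_unique _ uv' lim).
Qed.

End ext_stable.

(** The same approximating sequence works: its members lie in the Hardy form domain, and [G <= E]
    applied to differences preserves the Cauchy property. *)
Lemma ext_stable_sub_hardy : ext_dom mu stable `<=` ext_dom mu hardy.
Proof.
move=> u [mu_ fu [u_ [dn cn un]]]; split => //; exists u_.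
have dn' n : qdom hardy (u_ n) by exact: stable_sub_hardy.
split => //; apply/(represented_cauchyP hardy_represented dn') => e e0.
have /(represented_cauchyP stable_represented dn)/(_ _ e0)[N hN] := cn.
exists N => n m Nn Nm; apply: le_trans (hN n m Nn Nm).
have [sfin _ ssub] := stable_represented.
have [m1 L1 E1] := sfin _ (ssub _ _ (dn n) (dn m)).
exact: gform_le_energy.
Qed.

Lemma power_delta_notin : ~ ext_dom mu stable (@power_delta R d alpha).
Proof.
move=> /ext_stable_approx[u_ _ [Wv _ _ _]]; move: Wv.
by rewrite fine_power_delta hardy_mass_phi.
Qed.

End forms.

(** * Minimizers and compactness *)

Section minimizer.
Context {R : realType} {d : nat} (alpha : R).
Hypotheses (alpha_gt0 : (0 < alpha)%R) (alpha_lt2 : (alpha < 2)%R).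
Hypotheses (d0 : (0 < d)%N) (alpha_ltd : (alpha < d%:R)%R).
#[local] Opaque Gamma.
Local Open Scope ereal_scope.
Local Notation mu := (@lebesgue_rV R d).
Local Notation V := 'rV[R]_d.
Local Notation kappa := (kappa_star d alpha).
Local Notation L := (sqint mu).
Local Notation W := (hardy_mass alpha).
Local Notation energy := (energy alpha).
Local Notation gform := (gform alpha).
Local Notation phi := (@phi R d alpha).
Local Notation test_fun := (@test_fun R d alpha).
Local Notation stable := (stable_form d alpha).
Local Notation mus := (@mu_star R d alpha).
Local Notation nu := (@power_measure R d alpha).
Implicit Types (u v w : V -> R).

Let kappa0 : (0 < kappa)%R := kappa_gt0 alpha_gt0 d0 alpha_ltd.
Let gsi := ground_state_identity alpha_gt0 alpha_lt2 d0 alpha_ltd.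
Let mone : measurable_fun setT (@one_weight R d).
Proof. by rewrite /one_weight; meas. Qed.
Let mek := @measurable_energy_kernel R d alpha.
Let mip := @measurable_inv_phi R d alpha.
Let sdP := @stable_domP R d alpha alpha_gt0 alpha_lt2 d0.
Let mgk := @measurable_ground_kernel R d alpha.

Lemma integral_mu_star (f : V -> \bar R) : measurable_fun setT f -> (forall x, 0 <= f x) ->
  \int[mus]_x f x = kappa%:E * \int[mu]_x (f x * (enorm x `^ (- alpha))%:E).
Proof.
move=> mf f0.
rewrite (@integral_density _ _ _ mu mus (fun x => kappa * enorm x `^ (- alpha))%R)//; last 2 first.
- by meas.
- by move=> x; rewrite mulr_ge0 ?powR_ge0// ltW.
rewrite -ge0_integralkl; last 4 first.
- by [].
- by meas.
- by move=> x; rewrite mule_ge0// lee_fin powR_ge0.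
- by rewrite lee_fin ltW.
by apply: eq_integral => x _; rewrite EFinM muleCA.
Qed.

Lemma integral_power_measure (f : V -> \bar R) : measurable_fun setT f -> (forall x, 0 <= f x) ->
  \int[nu]_x f x = \int[mu]_x (f x * (enorm x `^ (- alpha))%:E).
Proof.
move=> mf f0; apply: integral_density => //; first by meas.
by move=> x; exact: powR_ge0.
Qed.

Lemma hardy_massZ (c : R) u : measurable_fun setT u ->
  W (fun x => c * u x)%R = (c ^+ 2)%:E * W u.
Proof.
move=> mu_; rewrite !hardy_massE -sqintZ; last exact: measurable_mass_map.
by congr sqint; apply/funext => x; rewrite /mass_map mulrA.
Qed.

(** Otherwise Fatou's lemma would make the Hardy mass of [phi] finite. *)
Lemma test_mass_unbounded (C : R) : exists n, C%:E < W (test_fun n).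
Proof.
apply: contrapT => /forallNP h.
have : W phi <= C%:E.
  rewrite hardy_massE; apply: (@sqint_fatou _ _ _ mu (fun n => mass_map alpha (test_fun n))).
  - by move=> n; apply: measurable_mass_map; exact: measurable_test_fun.
  - by apply: measurable_mass_map; exact: measurable_phi.
  - apply: nearW => x; apply: cvgM; last exact: cvg_cst.
    exact: test_fun_cvg.
  by move=> n; rewrite -hardy_massE leNgt; exact/negP/h.
by rewrite (hardy_mass_phi alpha_gt0 d0) leye_eq.
Qed.

Lemma stable_dom_scale (c : R) u : qdom stable u -> qdom stable (fun x => c * u x)%R.
Proof.
move=> /sdP[mu_ Lu Eu]; apply/sdP; split.
- by meas.
- by rewrite sqintZ//; apply: lte_mul_pinfty; rewrite ?lee_fin ?sqr_ge0.
- by rewrite /energy pformZ//; apply: lte_mul_pinfty; rewrite ?lee_fin ?sqr_ge0.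
Qed.

Lemma test_fun_stable n : qdom stable (test_fun n).
Proof.
apply/sdP; split.
- exact: measurable_test_fun.
- exact: sqint_test_fun.
- exact: energy_test_fun.
Qed.

Lemma hardy_lambda_eq1 : @hardy_lambda R d alpha = 1.
Proof.
apply/eqP; rewrite eq_le; apply/andP; split; last first.
  apply: le_ereal_inf_tmp => _ [u [/sdP[mu_ Lu Eu] _ u1] <-].
  rewrite stable_energyE// -u1 integral_mu_star; last 2 first.
  - by meas.
  - by move=> x; rewrite lee_fin sqr_ge0.
  exact: (hardy_inequality alpha_gt0 alpha_lt2 d0 alpha_ltd mu_ Lu).
have [C C0_ hC] := gform_test_le alpha_gt0 alpha_lt2 d0 alpha_ltd.
apply/lee_addgt0Pr => e e0.
(* After normalization the energy is [1 + G / (kappa W)]. Since [G <= C], a mass above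
   [C / (kappa e)] brings it below [1 + e]. *)
have [n hn] := test_mass_unbounded (C / (kappa * e))%R.
have mt := @measurable_test_fun R d alpha n.
have Wn := hardy_mass_test_fun alpha_gt0 d0 alpha_ltd n.
have Lt := @sqint_test_fun R d alpha alpha_ltd n.
have WE : W (test_fun n) = (fine (W (test_fun n)))%:E.
  by rewrite fineK// ge0_fin_numE// hardy_mass_ge0.
set w := fine _ in WE; rewrite WE lte_fin in hn.
have w0 : (0 < w)%R by apply: le_lt_trans hn; rewrite divr_ge0// mulr_ge0// ltW.
have GE : gform (test_fun n) = (fine (gform (test_fun n)))%:E.
  by rewrite fineK// ge0_fin_numE ?pform_ge0// (le_lt_trans (hC n)) ?ltry.
have gC : (fine (gform (test_fun n)) <= C)%R by rewrite -lee_fin -GE.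
set g := fine _ in GE gC.
pose c : R := ((Num.sqrt (kappa * w))^-1)%R.
have c2 : (c ^+ 2 = (kappa * w)^-1)%R.
  by rewrite /c exprVn sqr_sqrtr// mulr_ge0// ltW.
apply: ge_ereal_inf; exists (stable_energy alpha (fun x => c * test_fun n x)%R).
  exists (fun x => c * test_fun n x)%R => //; split.
  - by apply: stable_dom_scale; exact: test_fun_stable.
  - have tC := @test_fun_C0 R d alpha n.
    have := C0_lin c 0 tC tC.
    by congr C0; apply/funext => x; rewrite mul0r addr0.
  - rewrite integral_mu_star; last 2 first.
    + by meas.
    + by move=> x; rewrite lee_fin sqr_ge0.
    rewrite -/(W (fun x => c * test_fun n x)%R) hardy_massZ// WE -!EFinM c2.
    by congr EFin; field; rewrite !gt_eqF.
have mct : measurable_fun setT (fun x => c * test_fun n x)%R by meas.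
rewrite stable_energyE//.
rewrite /energy pformZ// -/(energy _) gsi// ?WE ?ltry// GE.
rewrite -[kappa%:E * _]EFinM -[g%:E + _]EFinD -EFinM -EFinD lee_fin c2.
have kw : (0 < kappa * w)%R by rewrite mulr_gt0.
rewrite mulrC ler_pdivrMr// mulrDl mul1r addrC lerD2l.
apply: (le_trans gC); move: hn; rewrite ltr_pdivrMr ?(mulr_gt0 kappa0 e0)// => /ltW h.
by rewrite (_ : e * (kappa * w) = w * (kappa * e))%R//; ring.
Qed.

Lemma lebesgue_rV_setT_gt0 : 0 < mu [set: V].
Proof.
have c0 := @cutoff_mass_gt0 R d 1 ltr01.
apply: (@lt_le_trans _ _ (@cutoff_mass R d 1)%:E); first by rewrite lte_fin.
rewrite -cutoff_massE// -[leRHS]mul1e -(@integral_cst _ _ _ mu setT measurableT 1).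
have mc := @measurable_cutoff R d 1.
apply: ge0_le_integralT; [by meas|by meas|by move=> x; rewrite lee_fin cutoff_ge0|].
by move=> x; rewrite lee_fin cutoff_le1.
Qed.

Lemma ae_exists (P : V -> Prop) : {ae mu, forall x, P x} -> exists x, P x.
Proof.
have pf := @ae_properfilter_algebraOfSetsType _ _ _ mu lebesgue_rV_setT_gt0.
exact: filter_ex.
Qed.

Lemma ae_sqint_eq0 (F : V -> R) : measurable_fun setT F -> L F = 0 ->
  {ae mu, forall x, F x = 0%R}.
Proof.
move=> mF LF; have mF2 : measurable_fun setT (fun x => (F x ^+ 2)%:E) by meas.
have /ae_eq_integral_abs : \int[mu]_x `|(F x ^+ 2)%:E| = 0.
  by rewrite -LF; apply: eq_integral => x _; rewrite gee0_abs// lee_fin sqr_ge0.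
move=> /(_ measurableT mF2); apply: filterS => x /(_ I)/= [/eqP].
by rewrite sqrf_eq0 => /eqP.
Qed.

(** The integrand vanishes a.e. on the product. Fixing one good base point [x] forces
    [v (y) / phi (y) = v (x) / phi (x)] for almost every [y], since the kernel is positive off the
    diagonal and the origin. *)
Lemma gform_eq0 v : measurable_fun setT v -> gform v = 0 ->
  exists c : R, {ae mu, forall x, v x = c * phi x}%R.
Proof.
move=> mv; have md := measurable_pair_diff mip mgk mv.
pose F (z : V * V) : \bar R := (pair_diff (inv_phi alpha) (ground_kernel alpha) v z ^+ 2)%:E.
have mF : measurable_fun setT F by rewrite /F; meas.
have F0 z : 0 <= F z by rewrite /F; pos.
have mI := @measurable_integral_rV R d _ V F mF F0.
rewrite /gform /pform /sqint (integral_rV2 mF F0) => I0.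
have /ae_eq_integral_abs : \int[mu]_x `|\int[mu]_y F (x, y)| = 0.
  by rewrite -I0; apply: eq_integral => x _; rewrite gee0_abs//; exact: integral_ge0.
move=> /(_ measurableT mI) aeI.
have [x [x0 Ix]] : exists x : V, x != 0%R /\ \int[mu]_y F (x, y) = 0.
  apply: ae_exists; apply: filterS2 (ae_neq0 d0) aeI => x x0 Ix.
  by split => //; exact: (Ix I).
exists (v x / phi x)%R.
have mx : measurable_fun setT (fun y => pair_diff (inv_phi alpha) (ground_kernel alpha) v (x, y)).
  by meas.
apply: filterS2 (ae_neq0 d0) (ae_sqint_eq0 mx Ix) => y y0.
have [<- _|xy] := eqVneq x y; first by rewrite divfK// gt_eqF// phi_gt0.
have px := @phi_gt0 R d alpha x x0; have py := @phi_gt0 R d alpha y y0.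
have k0 : (0 < ground_kernel alpha (x, y))%R.
  have sxy : (0 < Num.sqrt (phi x * phi y))%R by rewrite sqrtr_gt0; exact: mulr_gt0 px py.
  have sA : (0 < Num.sqrt (stable_const d alpha / 2))%R.
    rewrite sqrtr_gt0.
    exact: divr_gt0 (stable_const_gt0 alpha_gt0 alpha_lt2 d0) (ltr0Sn _ 1).
  apply: (mulr_gt0 sxy (mulr_gt0 sA _)).
  by apply: powR_gt0; rewrite enorm_gt0 subr_eq0.
rewrite /pair_diff/= => /eqP; rewrite mulf_eq0 (gt_eqF k0) orbF subr_eq0 => /eqP.
rewrite /inv_phi => h; rewrite h divfK//; exact: lt0r_neq0 py.
Qed.

Lemma minimizer_not_exists : ~ (exists u : V -> \bar R, hardy_minimizer alpha u).
Proof.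
move=> [u [du u1]]; rewrite hardy_lambda_eq1 => -[val].
have [mu_ fu _] := du.
have mv : measurable_fun setT (fine \o u) by exact: measurableT_comp.
have mu2 : measurable_fun setT (fun x => u x ^+ 2).
  by apply: emeasurable_funM.
have kW : kappa%:E * W (fine \o u) = 1.
  rewrite -u1 integral_mu_star//; last by move=> x; exact: sqre_ge0.
  congr (_ * _); apply: ge0_ae_eq_integral => //.
  - by meas.
  - by apply: emeasurable_funM => //; meas.
  - by move=> x _; rewrite lee_fin mulr_ge0 ?sqr_ge0 ?powR_ge0.
  - by move=> x _; rewrite mule_ge0 ?sqre_ge0// lee_fin powR_ge0.
  apply: filterS fu => x; rewrite -fin_num_abs => ux _ /=.
  by rewrite -[in RHS](fineK ux) -!EFinM expr2.
have := ext_stable_approx alpha_gt0 alpha_lt2 d0 alpha_ltd du.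
move=> [u_ _ [Wv Gv Ev]].
rewrite (ext_valE mone mek (stable_represented alpha_gt0 alpha_lt2 d0) mu_ fu du) -/(energy _) in val.
have WE : W (fine \o u) = (fine (W (fine \o u)))%:E.
  by rewrite fineK// ge0_fin_numE// hardy_mass_ge0.
have kw1 := kW; rewrite val; move: kW; rewrite WE -EFinM => -[->] g0.
(* The energy and [kappa W] both equal 1, so the ground state identity leaves nothing for [G]. *)
have GE : gform (fine \o u) = 0.
  rewrite -(@fineK _ (gform _)) ?ge0_fin_numE ?pform_ge0//.
  by congr EFin; lra.
have [c hc] := gform_eq0 mv GE.
have Wc : W (fine \o u) = (c ^+ 2)%:E * W phi.
  rewrite -hardy_massZ; last exact: measurable_phi.
  have mp := @measurable_phi R d alpha.
  apply: ge0_ae_eq_integral => //.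
  - by meas.
  - by meas.
  - by move=> x _; rewrite lee_fin mulr_ge0 ?sqr_ge0 ?powR_ge0.
  - by move=> x _; rewrite lee_fin mulr_ge0 ?sqr_ge0 ?powR_ge0.
  by apply: filterS hc => x hx _; rewrite hx.
have := Wv; rewrite Wc (hardy_mass_phi alpha_gt0 d0).
(* If [c = 0] the normalization fails; otherwise the Hardy mass is infinite. *)
have [c0|c0] := eqVneq c 0%R.
  move=> _; have := kw1; rewrite Wc c0 expr0n/= mul0e mule0 => /esym/eqP.
  by rewrite onee_eq0.
by rewrite gt0_muley// lte_fin exprn_even_gt0.
Qed.

(** The limit in [compactly_embedded] takes extended real values; this allows it to be replaced by
    the real function [fine \o v]. *)
Lemma ae_fin_Lnorm2 (v : V -> \bar R) : measurable_fun setT v ->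
  Lnorm nu 2%:E v < +oo -> {ae nu, forall x, v x \is a fin_num}.
Proof.
move=> mv; rewrite unlock => /lty_poweRy; rewrite invr_eq0 pnatr_eq0 => /(_ isT) h.
have mv2 : measurable_fun setT (fun x => `|v x| `^ 2).
  by apply: (measurableT_comp (measurable_poweR _)); exact: measurableT_comp.
have /integrable_ae : nu.-integrable setT (fun x => `|v x| `^ 2).
  apply/integrableP; split => //.
  by under eq_integral do rewrite gee0_abs ?poweR_ge0//.
move=> /(_ measurableT); apply: filterS => x /(_ I).
by case: (v x) => [r//||]; rewrite ?abseNy poweRyr ?pnatr_eq0.
Qed.

Lemma Lnorm2_fine (u : V -> R) (v : V -> \bar R) : measurable_fun setT u -> measurable_fun setT v ->
  {ae nu, forall x, v x \is a fin_num} ->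
  Lnorm nu 2%:E (fun x => (u x)%:E - v x) =
  Lnorm nu 2%:E (EFin \o (fun x => u x - fine (v x))%R).
Proof.
move=> mu_ mv fv; rewrite unlock; congr (_ `^ _).
have mfv : measurable_fun setT (fine \o v) by exact: measurableT_comp.
apply: ge0_ae_eq_integral => //.
- apply: (measurableT_comp (measurable_poweR _)); apply: measurableT_comp => //.
  by apply: emeasurable_funB => //; exact/measurable_EFinP.
- apply: (measurableT_comp (measurable_poweR _)); apply: measurableT_comp => //; apply/measurable_EFinP.
  exact: measurable_funB.
- by move=> x _; exact: poweR_ge0.
- by move=> x _; exact: poweR_ge0.
by apply: filterS fv => x vx _ /=; rewrite -[in LHS](fineK vx).
Qed.

Lemma sqint_power_measure u : measurable_fun setT u -> sqint nu u = W u.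
Proof.
move=> mu_; rewrite /sqint integral_power_measure; [|by meas|by move=> x; rewrite lee_fin sqr_ge0].
by apply: eq_integral => x _; rewrite EFinM.
Qed.

(** Test functions divided by the square root of their Hardy mass: [|test_fun| <= phi] and growing
    masses give the pointwise limit 0, while bounded [G] keeps the energies bounded. *)
Lemma noncompact_sequence : exists v_ : nat -> V -> R,
  [/\ forall n, qdom stable (v_ n), forall n, W (v_ n) = 1,
      (forall x, v_ n x @[n --> \oo] --> 0%R) &
      exists C : R, forall n, energy (v_ n) <= C%:E].
Proof.
have [C C0_ hC] := gform_test_le alpha_gt0 alpha_lt2 d0 alpha_ltd.
have /choice[k hk] : forall n : nat, exists i, (n.+1%:R)%:E < W (test_fun i).
  by move=> n; exact: test_mass_unbounded.
pose w n := fine (W (test_fun (k n))).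
have WE n : W (test_fun (k n)) = (w n)%:E.
  by rewrite /w fineK// ge0_fin_numE ?hardy_mass_ge0// (hardy_mass_test_fun alpha_gt0 d0 alpha_ltd).
have wn n : (n.+1%:R < w n)%R by rewrite -lte_fin -WE.
have w0 n : (0 < w n)%R by apply: lt_trans (wn n).
have w1 n : (1 <= w n)%R by apply: le_trans (ltW (wn n)); rewrite ler1n.
pose c n : R := (Num.sqrt (w n))^-1%R.
have c0 n : (0 <= c n)%R by rewrite invr_ge0 sqrtr_ge0.
have c2 n : (c n ^+ 2 = (w n)^-1)%R by rewrite /c exprVn sqr_sqrtr// ltW.
have mt n := @measurable_test_fun R d alpha n.
exists (fun n x => c n * test_fun (k n) x)%R; split.
- by move=> n; apply: stable_dom_scale; exact: test_fun_stable.
- by move=> n; rewrite hardy_massZ// WE -EFinM c2 mulVf// gt_eqF.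
- move=> x; apply/norm_cvg0P; apply: (@squeeze_cvgr _ _ _ _ (fun=> 0%R) (fun n => c n * phi x)%R).
  + apply: nearW => n; rewrite normr_ge0 normrM ger0_norm//=.
    by apply: ler_wpM2l => //; exact: test_fun_le.
  + exact: cvg_cst.
  + rewrite -[X in _ --> X](mul0r (phi x)); apply: cvgM; last exact: cvg_cst.
    apply/cvgrPdist_le => e e0; near=> n; rewrite sub0r normrN ger0_norm//.
    rewrite -(@ler_pXn2r _ 2)// ?nnegrE ?(ltW e0)// c2.
    rewrite -[leRHS]invrK lef_pV2 ?posrE ?invr_gt0 ?exprn_gt0//.
    apply: le_trans (ltW (wn n)); near: n.
    exists (Num.bound (e ^+ 2)^-1)%R => // n /= hn.
    apply: le_trans (ltW (archi_boundP _)) _; first by rewrite invr_ge0 sqr_ge0.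
    by rewrite ler_nat; apply: leq_trans hn _.
exists (C + kappa)%R => n; have mtk := mt (k n).
have GE : gform (test_fun (k n)) = (fine (gform (test_fun (k n))))%:E.
  by rewrite fineK// ge0_fin_numE ?pform_ge0// (le_lt_trans (hC _)) ?ltry.
have gC : (fine (gform (test_fun (k n))) <= C)%R by rewrite -lee_fin -GE.
rewrite /energy pformZ// -/(energy _) gsi// ?WE ?ltry//; last first.
  exact: sqint_test_fun.
rewrite GE -[kappa%:E * _]EFinM -[X in _ * X]EFinD -EFinM lee_fin c2 mulrDr; apply: lerD.
  apply: le_trans gC; rewrite -[leRHS]mul1r; apply: ler_wpM2r; last by rewrite invf_le1.
  by rewrite fine_ge0// pform_ge0.
by rewrite mulrCA mulVf ?mulr1// gt_eqF.
Unshelve. all: by end_near. Qed.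

Lemma not_compactly_embedded : ~ compactly_embedded mu stable nu.
Proof.
move=> [_ emb].
have [v_ [dv Wv v0 [C hC]]] := noncompact_sequence.
have rep := stable_represented alpha_gt0 alpha_lt2 d0.
have mv n : measurable_fun setT (v_ n) by have /sdP[] := dv n.
have ev n : ext_dom mu stable (EFin \o v_ n).
  apply: (@ext_dom_intro _ _ _ _ _ (fun=> v_ n) _ rep) => //; last by apply: nearW => x; exact: cvg_cst.
  move=> e e0; exists 0%N => i j _ _; rewrite (_ : (fun x => _) = fun=> 0%R); last first.
    by apply/funext => x; rewrite subrr.
  rewrite /pform /sqint integral0_eq ?lee_fin ?ltW// => z _.
  by rewrite /pair_diff !mul0r subrr mul0r expr0n.
have [||k [v [hk mv' Lv cv]]] := emb (fun n => EFin \o v_ n).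
- exact: ev.
- exists C => n; rewrite (ext_valE mone mek rep)//; last 2 first.
  + exact/measurable_EFinP.
  + by apply: nearW => x /=; rewrite ltry.
  have := hC n; have := pform_ge0 (@one_weight R d) (energy_kernel alpha) (v_ n).
  by rewrite -/(energy _); case: (energy _).
have fv := ae_fin_Lnorm2 mv' Lv.
pose f := fine \o v.
have mf : measurable_fun setT f by exact: measurableT_comp.
have cvf : forall e : R, (0 < e)%R -> exists N, forall n, (N <= n)%N ->
    sqint nu (fun x => v_ (k n) x - f x)%R <= e%:E.
  apply/Lnorm2_cvg0; rewrite (_ : (fun n => _) =
    fun n => Lnorm nu 2%:E (fun x => (EFin \o v_ (k n)) x - v x))//.
  by apply/funext => n; rewrite (Lnorm2_fine _ mv' fv).
have kn n : (n <= k n)%N.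
  by elim: n => // n IH; apply: leq_ltn_trans IH _; exact: hk.
(* The pointwise limit is 0, so by Fatou's lemma [f], the limit in norm, can only be 0 as well. *)
have f0 : sqint nu f = 0.
  apply/eqP; rewrite eq_le sqint_ge0 andbT; apply/lee_addgt0Pr => e e0; rewrite add0e.
  have [N hN] := cvf _ e0.
  have := @sqint_fatou _ _ _ nu (fun n x => v_ (k (N + n)%N) x - f x)%R (fun x => 0 - f x)%R e%:E.
  have -> : sqint nu (fun x => 0 - f x)%R = sqint nu f.
    by apply: eq_integral => x _; rewrite sub0r sqrrN.
  apply.
  - by move=> n; meas.
  - by meas.
  - apply: nearW => x; apply: cvgB; last exact: cvg_cst.
    apply/cvgrPdist_le => e1 e10; have /cvgrPdist_le/(_ _ e10)[M _ hM] := v0 x.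
    exists M => // n Mn; apply: hM => /=; apply: leq_trans Mn _.
    by apply: leq_trans (kn _); exact: leq_addl.
  by move=> n; apply: hN; exact: leq_addr.
have e4 : (0 < (4^-1 : R))%R by rewrite invr_gt0.
have [N /(_ _ (leqnn _)) hN] := cvf _ e4.
(* With [t = 1] the mass 1 of [v_ (k N)] is at most twice the mass of [f], which is 0, plus twice a
   distance of at most [1 / 4]: a contradiction. *)
have := sqint_absD_le nu ltr01 mf (mv (k N)).
rewrite sqint_power_measure// Wv f0 mule0 add0e invr1 leNgt => /negP; apply.
have -> : sqint nu (fun x => f x - v_ (k N) x)%R = sqint nu (fun x => v_ (k N) x - f x)%R.
  by apply: eq_integral => x _; rewrite -sqrrN opprB.
apply: (@le_lt_trans _ _ ((1 + 1)%:E * (4^-1)%:E)).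
  by apply: lee_wpmul2l => //; rewrite lee_fin; lra.
by rewrite -EFinM lte_fin; lra.
Qed.

Lemma integral_power_delta_sqr :
  \int[mu]_x (enorm x `^ (- 2 * delta_star d alpha) * enorm x `^ (- alpha))%:E =
  \int[mu]_x (enorm x `^ (- d%:R))%:E.
Proof.
apply: eq_integral => x _; congr EFin.
have := sqrtr_ge0 (\sum_(i < d) x ord0 i ^+ 2)%R; rewrite -/(enorm x) le_eqVlt => /predU1P[<-|x0].
  by rewrite [in RHS]powR0 ?oppr_eq0 ?pnatr_eq0 -?lt0n// [X in (_ * X)%R]powR0 ?mulr0// oppr_eq0 gt_eqF.
rewrite -powRD; last by rewrite (gt_eqF x0) implybT.
by congr powR; rewrite /delta_star; lra.
Qed.

End minimizer.

Theorem mainTheorem8 (R : realType) (d : nat) (alpha : R)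
    (alpha_gt0 : 0 < alpha) (alpha_lt2 : alpha < 2)
    (d_ge1 : (1 <= d)%N) (alpha_ltd : alpha < d%:R) :
  [/\ (* (a) *)
      [/\ ext_dom lebesgue_rV (hardy_form d alpha) (@power_delta R d alpha),
          ext_val lebesgue_rV (hardy_form d alpha) (@power_delta R d alpha) = 0,
          ground_state lebesgue_rV (hardy_form d alpha) (@power_delta R d alpha) &
          critical lebesgue_rV (hardy_form d alpha)],
      (* (b) *)
      [/\ (\int[@lebesgue_rV R d]_x
             (enorm x `^ (- 2 * delta_star d alpha) * enorm x `^ (- alpha))%:E =
           \int[@lebesgue_rV R d]_x (enorm x `^ (- d%:R))%:E)%E,
          (\int[@lebesgue_rV R d]_x (enorm x `^ (- d%:R))%:E = +oo)%E,
          ~ ext_dom lebesgue_rV (stable_form d alpha) (@power_delta R d alpha) &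
          ext_dom lebesgue_rV (stable_form d alpha) `<`
            ext_dom lebesgue_rV (hardy_form d alpha)] &
      (* (c) *)
      [/\ @hardy_lambda R d alpha = 1%E,
          ~ (exists u : 'rV[R]_d -> \bar R, hardy_minimizer alpha u) &
          ~ compactly_embedded lebesgue_rV (stable_form d alpha)
              (@power_measure R d alpha)]].
Proof.
have dom := ext_dom_power_delta alpha_gt0 alpha_lt2 d_ge1 alpha_ltd.
have val := ext_val_power_delta alpha_gt0 alpha_lt2 d_ge1 alpha_ltd.
have ground : ground_state lebesgue_rV (hardy_form d alpha) (@power_delta R d alpha).
  by split => //; exact: power_delta_gt0.
have notin := power_delta_notin alpha_gt0 alpha_lt2 d_ge1 alpha_ltd.
split; split.
- exact: dom.
- exact: val.
- exact: ground.
- by exists (@power_delta R d alpha).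
- exact: integral_power_delta_sqr.
- exact: integral_power_dim.
- exact: notin.
- split; first exact: ext_stable_sub_hardy.
  by move=> /(_ _ dom).
- exact: hardy_lambda_eq1.
- exact: minimizer_not_exists.
- exact: not_compactly_embedded.
Qed.
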